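(* Let $L$ be a $G$-equivariant holomorphic line bundle over $\mathcal{D}$, and let $l$ be the representation of $G$ on the space $\Gamma^{hol}(L)$ of holomorphic sections given by $l(g)s(z)=g\,s(g^{-1}z)$. Let $\mathcal{H}\subset\Gamma^{hol}(L)$ be a reproducing kernel Hilbert space. Suppose that $l(b)\mathcal{H}\subset\mathcal{H}$ for all $b\in B$ and $\|l(b)s\|=\|s\|$ for all $b\in B$ and $s\in\mathcal{H}$. Then $l(g)\mathcal{H}\subset\mathcal{H}$ for all $g\in G$ and $\|l(g)s\|=\|s\|$ for all $g\in G$ and $s\in\mathcal{H}$. In particular, unitarizability of $l$ as a representation of $B$ implies unitarizability of $l$ as a representation of $G$.
   Context: Setting: $\mathcal{D}\subset\mathbb{C}^N$ is a domain biholomorphic to a bounded homogeneous domain (a bounded domain on which the holomorphic automorphism group acts transitively). $\mathrm{Aut}_{hol}(\mathcal{D})$ is a Lie group, and its identity component $\mathrm{Aut}_{hol}(\mathcal{D})^o$ is isomorphic to the identity component of a linear real algebraic group. $G$ is the identity component of a real algebraic subgroup of $\mathrm{Aut}_{hol}(\mathcal{D})^o$, and $G$ acts transitively on $\mathcal{D}$. An Iwasawa subgroup of a Lie group is a maximal connected real split solvable Lie subgroup. $B$ is an Iwasawa subgroup of $G$; it acts simply transitively on $\mathcal{D}$. A reproducing kernel Hilbert space $\mathcal{H}\subset\Gamma^{hol}(L)$ is a Hilbert space that is a linear subspace of $\Gamma^{hol}(L)$ whose inclusion map into $\Gamma^{hol}(L)$ (with the compact-open topology) is continuous. $\|\cdot\|$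 is the norm of $\mathcal{H}$. For a subgroup $G_0\subset G$, $l$ is called unitarizable as a representation of $G_0$ if there is a nonzero such $\mathcal{H}$ with $l(g)\mathcal{H}\subset\mathcal{H}$ and $\|l(g)s\|=\|s\|$ for all $g\in G_0$, $s\in\mathcal{H}$. *)

(* Defs.v *)
From HB Require Import structures.
From mathcomp Require Import all_boot all_order all_algebra sesquilinear.
From mathcomp Require Import all_classical all_reals all_analysis.
From mathcomp Require Import complex.
(* Required without Import: mpoly's notations clash with those of all_analysis. *)
From mathcomp Require mpoly.
Import Order.TTheory GRing.Theory Num.Theory.
Import numFieldNormedType.Exports.

Set Implicit Arguments.
Unset Strict Implicit.
Unset Printing Implicit Defensive.

Local Open Scope classical_set_scope.
Local Open Scope ring_scope.
Local Open Scope complex_scope.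

(* With this instance ['rV[R[i]]_N] is a normed space over the field [R[i]], so
   that [differentiable] means complex (Fréchet) differentiable. *)
HB.instance Definition _ (R : realType) := NormedModule.copy R[i] R[i]^o.

Section Holomorphy.
Context {R : realType} {N : nat}.
Implicit Types D : set 'rV[R[i]]_N.

Definition is_domain D := [/\ D !=set0, open D & connected D].

(* A function on the subtype [D] is holomorphic on the relatively open [U] if
   it is the restriction of a function on C^N that is complex differentiable
   at the points of [U]; this is only meant for [D] open. *)
Definition holomorphic_on D (V : normedModType R[i]) (U : set D) (f : D -> V) :=
  exists F : 'rV[R[i]]_N -> V,
    forall z : D, U z -> differentiable F (val z) /\ F (val z) = f z.

Definition holomorphic_map D D' (f : D -> D') :=
  holomorphic_on [set: D] (fun z : D => val (f z) : 'rV[R[i]]_N).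

Definition biholomorphic D D' :=
  exists (f : D -> D') (g : D' -> D),
    [/\ cancel f g, cancel g f, holomorphic_map f & holomorphic_map g].

Record Aut D := MkAut {
  aut_fun :> D -> D;
  aut_inv : D -> D;
  aut_funK : cancel aut_fun aut_inv;
  aut_invK : cancel aut_inv aut_fun;
  aut_fun_holo : holomorphic_map aut_fun;
  aut_inv_holo : holomorphic_map aut_inv }.

Definition homogeneous D := forall z w : D, exists g : Aut D, g z = w.

Definition bounded_homogeneous_domain D :=
  [/\ is_domain D, bounded_set D & homogeneous D].

Lemma Aut_eq D (g h : Aut D) : aut_fun g =1 aut_fun h -> g = h.
Proof.
case: g => f f' fK f'K hf hf'; case: h => k k' kK k'K hk hk' /= /funext E.
case: _ / E kK k'K hk => kK k'K hk.
have E : f' = k' by apply/funext => z; rewrite -{1}(k'K z) fK.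
case: _ / E kK k'K hk' => kK k'K hk'.
by congr MkAut; apply: Prop_irrelevance.
Qed.

Lemma holomorphic_map_id D : holomorphic_map (@id D).
Proof. by exists id => z _; split. Qed.

Lemma holomorphic_map_comp D D' D'' (f : D' -> D'') (g : D -> D') :
  holomorphic_map f -> holomorphic_map g -> holomorphic_map (f \o g).
Proof.
move=> [F hF] [G hG]; exists (F \o G) => z _.
have [dG eG] := hG z I; have [dF eF] := hF (g z) I.
split; last by rewrite /= eG eF.
have dF' : differentiable F (G (val z)) by rewrite eG.
exact: (@differentiable_comp _ _ _ _ G F (val z) dG dF').
Qed.

Definition aut_one D : Aut D :=
  @MkAut D id id (fun=> erefl) (fun=> erefl)
    (holomorphic_map_id D) (holomorphic_map_id D).

Definition aut_mul D (g h : Aut D) : Aut D :=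
  MkAut (can_comp (aut_funK g) (aut_funK h))
        (can_comp (aut_invK h) (aut_invK g))
        (holomorphic_map_comp (aut_fun_holo g) (aut_fun_holo h))
        (holomorphic_map_comp (aut_inv_holo h) (aut_inv_holo g)).

Definition aut_invg D (g : Aut D) : Aut D :=
  MkAut (aut_invK g) (aut_funK g) (aut_inv_holo g) (aut_fun_holo g).

End Holomorphy.

Section AutGroup.
Context {R : realType} {N : nat} (D : set 'rV[R[i]]_N).

HB.instance Definition _ := gen_eqMixin (Aut D).
HB.instance Definition _ := gen_choiceMixin (Aut D).

Lemma aut_mulA : associative (@aut_mul R N D).
Proof. by move=> g h k; apply: Aut_eq. Qed.
Lemma aut_mul1 : left_id (aut_one D) (@aut_mul R N D).
Proof. by move=> g; apply: Aut_eq. Qed.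
Lemma aut_mulr1 : right_id (aut_one D) (@aut_mul R N D).
Proof. by move=> g; apply: Aut_eq. Qed.
Lemma aut_mulV : left_inverse (aut_one D) (@aut_invg R N D) (@aut_mul R N D).
Proof. by move=> g; apply: Aut_eq => z; apply: aut_funK. Qed.
Lemma aut_mulrV : right_inverse (aut_one D) (@aut_invg R N D) (@aut_mul R N D).
Proof. by move=> g; apply: Aut_eq => z; apply: aut_invK. Qed.

HB.instance Definition _ :=
  isGroup.Build (Aut D) aut_mulA aut_mul1 aut_mulr1 aut_mulV aut_mulrV.

HB.instance Definition _ := Topological.copy (Aut D)
  (initial_topology (fun g : Aut D => (g : D -> D) : {compact-open, D -> D})).

Lemma aut_mulVK (g : Aut D) (z : D) : g ((g^-1)%g z) = z.
Proof. exact: aut_invK. Qed.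

Definition Aut0 : set (Aut D) := connected_component [set: Aut D] 1%g.

Definition transitive_on (G : set (Aut D)) :=
  forall z w : D, exists2 g, G g & g z = w.

Definition simply_transitive_on (G : set (Aut D)) :=
  forall z w : D, exists! g, G g /\ g z = w.

End AutGroup.

Section MatrixGroups.
Context {R : realType} {m : nat}.
Implicit Types (H G B : set 'M[R]_m) (g b : set 'M[R]_m).

Definition matrix_group H :=
  [/\ H `<=` [set x | x \in unitmx], H 1%:M,
      (forall x y, H x -> H y -> H (x *m y))
    & (forall x, H x -> H (invmx x))].

Definition real_algebraic_group H :=
  matrix_group H /\
  exists S : set (mpoly.mpoly (m * m) R),
    H = [set x | x \in unitmx /\
                 forall p, S p -> mpoly.meval (fun k => mxvec x 0 k) p = 0].

Definition expmx (X : 'M[R]_m) : 'M[R]_m :=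
  lim (series (fun k => (k`!%:R)^-1 *: X ^+ k) @ \oo).

Definition lie_algebra H := [set X | forall t : R, H (expmx (t *: X))].

Definition lie_bracket (K : pzRingType) (X Y : 'M[K]_m) := X *m Y - Y *m X.

Definition lie_subalgebra b :=
  (exists V : {vspace 'M[R]_m}, b = [set` V]) /\
  (forall X Y, b X -> b Y -> b (lie_bracket X Y)).

Definition generated_group (S : set 'M[R]_m) : set 'M[R]_m :=
  [set x | forall H, matrix_group H -> S `<=` H -> H x].

(* Connected Lie subgroups need not be closed: they are the subgroups
   generated by the exponentials of their Lie algebra. *)
Definition connected_lie_subgroup H :=
  lie_subalgebra (lie_algebra H) /\
  H = generated_group (expmx @` lie_algebra H).

(* The linear span of all brackets of elements of [b]. *)
Definition derived_algebra b : set 'M[R]_m :=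
  [set X | forall V : {vspace 'M[R]_m},
     (forall Y Z, b Y -> b Z -> lie_bracket Y Z \in V) -> X \in V].

Definition solvable_lie_algebra b :=
  exists k, iter k derived_algebra b `<=` [set 0].

Definition complexification g : set 'M[R[i]]_m :=
  [set W | g (map_mx (@complex.Re R) W) /\ g (map_mx (@complex.Im R) W)].

(* For X in b, the endomorphism ad X of the real Lie algebra g has only real
   eigenvalues, eigenvectors being taken in g + ig. *)
Definition ad_real_eigenvalues g b :=
  forall X, b X -> forall (a : R[i]) (W : 'M[R[i]]_m),
    complexification g W -> W != 0 ->
    lie_bracket (map_mx (fun x => x%:C) X) W = a *: W -> complex.Im a = 0.

(* The eigenvalues are those of the adjoint action on the Lie algebra of the
   ambient group [G], not only on that of [B]: with the latter, every connected
   abelian subgroup would qualify, and SO(2) would be an Iwasawa subgroup of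
   SL(2,R). *)
Definition real_split_solvable_subgroup G B :=
  [/\ B `<=` G, connected_lie_subgroup B, solvable_lie_algebra (lie_algebra B)
    & ad_real_eigenvalues (lie_algebra G) (lie_algebra B)].

Definition matrix_iwasawa_subgroup G B :=
  real_split_solvable_subgroup G B /\
  forall B', real_split_solvable_subgroup G B' -> B `<=` B' -> B' = B.

End MatrixGroups.

Section LinearRealization.
Context {R : realType} {N m : nat} {D : set 'rV[R[i]]_N}.
Implicit Types (A : set 'M[R]_m) (phi : Aut D -> 'M[R]_m) (G B : set (Aut D)).

(* [phi] restricts to an isomorphism of topological groups (equivalently, of
   Lie groups) from Aut(D)^o onto the identity component of the real algebraic
   group [A]; its values outside of Aut(D)^o are irrelevant. *)
Definition linear_realization A phi :=
  [/\ real_algebraic_group A,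
      (forall g h, Aut0 g -> Aut0 h -> phi (g * h)%g = phi g *m phi h),
      set_bij (@Aut0 R N D) (connected_component A 1%:M) phi,
      {within (@Aut0 R N D), continuous phi}
    & exists2 psi : 'M[R]_m -> Aut D,
        {within connected_component A 1%:M, continuous psi}
        & forall g, Aut0 g -> psi (phi g) = g].

(* Real algebraic subgroups of Aut(D)^o are those cut out, in the realization
   [phi], by real algebraic matrix groups. *)
Definition algebraic_identity_component phi G :=
  exists2 H, real_algebraic_group H &
    G = connected_component (@Aut0 R N D `&` phi @^-1` H) 1%g.

Definition iwasawa_subgroup phi G B :=
  B `<=` G /\ matrix_iwasawa_subgroup (phi @` G) (phi @` B).

End LinearRealization.

(* A family of complex lines with an atlas of fibrewise linear trivializations
   whose transition functions are holomorphic; outside of [lb_dom i] the maps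
   [lb_triv i] and [lb_inv i] are irrelevant. *)
Record line_bundle (R : realType) (N : nat) (D : set 'rV[R[i]]_N) := LineBundle {
  lb_fiber : D -> lmodType R[i];
  lb_chart : Type;
  lb_dom : lb_chart -> set D;
  lb_triv : forall (i : lb_chart) (z : D), {linear lb_fiber z -> R[i]^o};
  lb_inv : forall (i : lb_chart) (z : D), R[i] -> lb_fiber z;
  lb_open : forall i, open (lb_dom i);
  lb_cover : forall z, exists i, lb_dom i z;
  lb_trivK : forall i z, lb_dom i z -> cancel (lb_triv i z) (lb_inv i z);
  lb_invK : forall i z, lb_dom i z -> cancel (lb_inv i z) (lb_triv i z);
  lb_transition : forall i j,
    holomorphic_on (lb_dom i `&` lb_dom j)
      (fun z => lb_triv j z (lb_inv i z 1) : R[i]) }.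

Section LineBundles.
Context {R : realType} {N : nat} {D : set 'rV[R[i]]_N}.

Definition total (L : line_bundle D) : Type := {z : D & lb_fiber L z}.

Definition in_total (L : line_bundle D) (z : D) (v : lb_fiber L z) : total L :=
  existT _ z v.

Section TotalSpace.
Variable L : line_bundle D.

HB.instance Definition _ := gen_eqMixin (total L).
HB.instance Definition _ := gen_choiceMixin (total L).

(* The topology for which the trivializations are homeomorphisms onto the
   [lb_dom i * C]. *)
Definition total_open (O : set (total L)) :=
  forall i : lb_chart L, open [set x : D * R[i] |
    lb_dom i x.1 /\ O (in_total (lb_inv i x.1 x.2))].

Lemma total_openT : total_open setT.
Proof.
move=> i.
have -> : [set x : D * R[i] | lb_dom i x.1 /\ setT (in_total (lb_inv i x.1 x.2))]
  = fst @^-1` lb_dom i by apply/seteqP; split => x //= [].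
by apply: open_comp (lb_open i) => x _; apply: cvg_fst.
Qed.

Lemma total_openI (A B : set (total L)) :
  total_open A -> total_open B -> total_open (A `&` B).
Proof.
move=> oA oB i; apply: (@eq_ind _ _ open (openI (oA i) (oB i))).
apply/seteqP; split => x /=; first by case=> [[? ?] [? ?]].
by case=> ? [? ?].
Qed.

Lemma total_open_bigU (I : Type) (f : I -> set (total L)) :
  (forall i, total_open (f i)) -> total_open (\bigcup_i f i).
Proof.
move=> of_ i.
apply: (@eq_ind _ _ open (bigcup_open (fun j (_ : setT j) => of_ j i))).
apply/seteqP; split => x /=; first by case=> j _ [? ?]; split => //; exists j.
by case=> ? [j _ ?]; exists j.
Qed.

HB.instance Definition _ := isOpenTopological.Build (total L)
  total_openT total_openI total_open_bigU.

End TotalSpace.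

Definition sections (L : line_bundle D) : Type := forall z : D, lb_fiber L z.

Definition section_map (L : line_bundle D) (s : sections L) : D -> total L :=
  fun z => in_total (s z).

Definition holomorphic_section (L : line_bundle D) (s : sections L) :=
  forall i : lb_chart L,
    holomorphic_on (lb_dom i) (fun z => lb_triv i z (s z) : R[i]).

Definition total_act (L : line_bundle D)
    (act : forall (g : Aut D) (z : D), lb_fiber L z -> lb_fiber L (g z))
    (g : Aut D) (e : total L) : total L :=
  in_total (act g (projT1 e) (projT2 e)).

(* [eq_act g] maps the fibre over z to the fibre over g z; it is irrelevant
   for [g] outside of [G]. As [g] acts linearly on the fibres, its action on the
   total space is holomorphic as soon as the images of the local frames
   [lb_inv i z 1] are. *)
Record equivariant_structure (G : set (Aut D)) (L : line_bundle D) :=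
  EquivariantStructure {
  eq_act : forall (g : Aut D) (z : D), lb_fiber L z -> lb_fiber L (g z);
  eq_act_linear : forall g z, G g -> linear (@eq_act g z);
  eq_act1 : forall e, total_act eq_act 1%g e = e;
  eq_actM : forall g h e, G g -> G h ->
    total_act eq_act (g * h)%g e = total_act eq_act g (total_act eq_act h e);
  eq_act_holo : forall g (i j : lb_chart L), G g ->
    holomorphic_on (lb_dom i `&` g @^-1` lb_dom j)
      (fun z => lb_triv j (g z) (eq_act g (lb_inv i z 1)) : R[i]);
  eq_act_continuous :
    {within [set x : Aut D * total L | G x.1],
      continuous (fun x => total_act eq_act x.1 x.2)} }.

(* (l(g) s)(z) = g (s (g^-1 z)), transported from the fibre over g (g^-1 z) to
   the fibre over z. *)
Definition lrep (G : set (Aut D)) (L : line_bundle D)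
    (E : equivariant_structure G L) (g : Aut D) (s : sections L) : sections L :=
  fun z => eq_rect (g ((g^-1)%g z)) (lb_fiber L)
             (eq_act E g (s ((g^-1)%g z))) z (aut_mulVK g z).

(* The subspace of sections is the image of the injective linear map
   [rk_incl], defined on an abstract Hilbert space. *)
Record rkhs (L : line_bundle D) := Rkhs {
  rk_space : completeNormedModType R[i];
  rk_dot : {dot rk_space for Num.conj};
  rk_norm : forall v, `|v| ^+ 2 = rk_dot v v;
  rk_incl : rk_space -> sections L;
  rk_linear : forall (a : R[i]) u v z,
    rk_incl (a *: u + v) z = a *: rk_incl u z + rk_incl v z;
  rk_inj : injective rk_incl;
  rk_holo : forall v, holomorphic_section (rk_incl v);
  rk_continuous :
    continuous (fun v => section_map (rk_incl v) : {compact-open, D -> total L}) }.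

Section Unitarity.
Variables (G : set (Aut D)) (L : line_bundle D) (E : equivariant_structure G L).
Implicit Types (S : set (Aut D)) (H : rkhs L).

Definition stable_under S H := forall g, S g ->
  forall v : rk_space H, exists w : rk_space H, rk_incl w = lrep E g (rk_incl v).

Definition isometric_under S H := forall g, S g ->
  forall v w : rk_space H, rk_incl w = lrep E g (rk_incl v) -> `|w| = `|v|.

Definition unitarizable S := exists H : rkhs L,
  [/\ exists v : rk_space H, v != 0, stable_under S H & isometric_under S H].

End Unitarity.
End LineBundles.

(* Main.v *)
From mathcomp Require Import all_boot all_order all_algebra sesquilinear.
From mathcomp Require Import all_classical all_reals all_analysis.
From mathcomp Require Import complex ring lra.
Require Import Defs.
Import Order.TTheory GRing.Theory Num.Theory.
Import numFieldNormedType.Exports.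

Set Implicit Arguments.
Unset Strict Implicit.
Unset Printing Implicit Defensive.

Local Open Scope classical_set_scope.
Local Open Scope ring_scope.
Local Open Scope complex_scope.

(** The reproducing kernel of a Hilbert space of sections is determined by its
    restriction to the diagonal, that is, by the norms of the evaluations at the
    points of [D], and these are invariant under [G] as soon as they are invariant
    under [B].

    Let [g] be in [G].  For [z] in [D] the transitivity of [B] gives [b] in [B] with
    [b z = g z], so that [k = g^-1 * b] fixes [z].  As [l(b)] is an isometry of [H],
    the evaluation at [z] has, on [H] and on the translate [l(g^-1) H], norms which
    differ by the modulus of the scalar by which [k] acts on the fibre over [z].
    This modulus is one ([isotropy_unitary]).  Indeed [k] corresponds to an
    automorphism with a fixed point of a bounded domain, and such an automorphism is
    recurrent: Cauchy's estimates make its powers equicontinuous near the fixed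
    point, hence two of them are uniformly close there, and by a quantitative form
    of the identity theorem closeness near the fixed point spreads to all compact
    sets.  So powers of [k] with positive exponents accumulate at the identity in
    the compact-open topology ([powers_recur_at_one]).  If [k] acted on the
    fibre by a scalar of modulus larger than one, these powers would act by scalars
    of modulus bounded away from one, against the continuity of the action.

    Thus the two families of evaluations have the same norms at each point.  Along a
    complex line through a given point both are holomorphic in the parameter, and
    the expansion of the kernels into power series in [s] and its conjugate shows
    that the norms determine the scalar products of the kernels at two neighbouring
    points ([polar_slice]).  As the kernel with one argument fixed is a holomorphic
    section, the identity theorem extends the equality to all pairs of points.
    Finally, two total families of vectors with the same Gram matrix differ by an
    isometry ([gram_transfer]), which here says that [l(g)] maps [H] into itself and
    preserves the norm ([transport_by_B]).

    The function theory of one variable which this uses is derived from Goursat's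
    theorem for rectangles, through Cauchy's formula on squares, in the form of the
    Taylor expansion with remainder ([taylor]); several variables are reduced to one
    by restriction to complex lines.  That [G] is a group, being the identity
    component of one, follows from the continuity of right translations in the
    compact-open topology ([component_subgroup]). *)

(** * Real-valued norms over the complex numbers *)

Section RealNorm.
Context {R : realType}.

(** Norms of complex normed spaces take their values in [R[i]]; estimates are
    carried out on real numbers. *)
Definition nrm (V : normedModType R[i]) (v : V) : R := complex.Re `|v|.

Section NormedModule.
Variable V : normedModType R[i].
Implicit Types (u v w : V) (a : R[i]).

Lemma nrmE v : `|v| = (nrm v)%:C.
Proof. by rewrite /nrm RRe_real// normr_real. Qed.

Lemma nrm_ge0 v : 0 <= nrm v.
Proof. by rewrite -ler0c -nrmE. Qed.

Lemma nrm0 : nrm (0 : V) = 0.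
Proof. by rewrite /nrm normr0. Qed.

Lemma nrmN v : nrm (- v) = nrm v.
Proof. by rewrite /nrm normrN. Qed.

Lemma nrmBC u v : nrm (u - v) = nrm (v - u).
Proof. by rewrite -nrmN opprB. Qed.

Lemma nrm0_eq0 v : nrm v = 0 -> v = 0.
Proof. by move=> v0; apply/eqP; rewrite -normr_eq0 nrmE v0. Qed.

Lemma nrm_gt0 v : v != 0 -> 0 < nrm v.
Proof.
move=> v0; rewrite lt_def nrm_ge0 andbT; apply: contra v0 => /eqP/nrm0_eq0 ->.
by rewrite eqxx.
Qed.

Lemma nrmD u v : nrm (u + v) <= nrm u + nrm v.
Proof. by rewrite -lecR rmorphD /= -!nrmE ler_normD. Qed.

Lemma nrmB u v : nrm (u - v) <= nrm u + nrm v.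
Proof. by rewrite -(nrmN v) nrmD. Qed.

Lemma nrm_tri v u w : nrm (u - w) <= nrm (u - v) + nrm (v - w).
Proof. by apply: le_trans (nrmD _ _); rewrite addrA subrK. Qed.

Lemma nrm_subr u v : nrm u <= nrm v + nrm (u - v).
Proof. by apply: le_trans (nrmD _ _); rewrite addrC subrK. Qed.

Lemma nrm_sum (I : Type) (r : seq I) (P : pred I) (F : I -> V) :
  nrm (\sum_(j <- r | P j) F j) <= \sum_(j <- r | P j) nrm (F j).
Proof.
elim/big_ind2: _ => [|x1 x2 y1 y2 h1 h2|//]; first by rewrite nrm0.
by apply: le_trans (nrmD _ _) (lerD h1 h2).
Qed.

Lemma nrmZ a v : nrm (a *: v) = nrm a * nrm v.
Proof. by apply: complexI; rewrite rmorphM /= -!nrmE normrZ. Qed.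

Lemma nrm_eps0 v : (forall e, 0 < e -> nrm v <= e) -> v = 0.
Proof.
move=> h; apply: nrm0_eq0; apply/eqP; rewrite eq_le nrm_ge0 andbT.
by apply/ler_addgt0Pr => e e0; rewrite add0r; apply: h.
Qed.

Lemma nbhs_nrmP v (A : set V) :
  nbhs v A <-> exists2 e : R, 0 < e & forall w, nrm (w - v) < e -> A w.
Proof.
split.
  move=> /nbhs_ballP[e /= e0 he]; exists (complex.Re e).
    by move: e0; rewrite ltcE => /andP[].
  move=> w hw; apply: he; rewrite -ball_normE /=.
  have er : e = (complex.Re e)%:C by rewrite RRe_real// gtr0_real.
  by rewrite er -opprB normrN nrmE ltcR.
move=> [e e0 he]; apply/nbhs_ballP; exists e%:C; first by rewrite /= ltcR.
move=> w; rewrite -ball_normE /= -opprB normrN nrmE ltcR; exact: he.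
Qed.

Lemma open_nrmP (A : set V) :
  open A <-> forall v, A v -> exists2 e : R, 0 < e &
    forall w, nrm (w - v) < e -> A w.
Proof.
rewrite openE; split => [h v /h/nbhs_nrmP//|h v /h hv].
by apply/nbhs_nrmP.
Qed.

End NormedModule.

Implicit Types z w : R[i].

Lemma nrmM z w : nrm (z * w) = nrm z * nrm w.
Proof. by apply: complexI; rewrite rmorphM /= -!nrmE normrM. Qed.

Lemma nrm1 : nrm (1 : R[i]) = 1.
Proof. by rewrite /nrm normr1. Qed.

Lemma nrmX z n : nrm (z ^+ n) = nrm z ^+ n.
Proof. by elim: n => [|n IH]; rewrite ?expr0 ?nrm1// !exprS nrmM IH. Qed.

Lemma nrmV z : nrm z^-1 = (nrm z)^-1.
Proof. by apply: complexI; rewrite fmorphV /= -!nrmE normfV. Qed.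

Lemma nrmC (x : R) : nrm (x%:C : R[i]) = `|x|.
Proof. by rewrite /nrm normc_def /= expr0n addr0 sqrtr_sqr. Qed.

Lemma nrm_sqr z : nrm z ^+ 2 = complex.Re z ^+ 2 + complex.Im z ^+ 2.
Proof. by apply: complexI; rewrite add_Re2_Im2 nrmE rmorphXn. Qed.

Lemma nrm_Re z : `|complex.Re z| <= nrm z.
Proof. by rewrite -lecR -nrmE normc_ge_Re. Qed.

Lemma nrm_Im z : `|complex.Im z| <= nrm z.
Proof.
rewrite -(@ler_pXn2r _ 2)// ?nnegrE ?nrm_ge0// nrm_sqr real_normK ?num_real//.
by rewrite lerDr sqr_ge0.
Qed.

Lemma nrm_le_ReIm z : nrm z <= `|complex.Re z| + `|complex.Im z|.
Proof.
rewrite -(@ler_pXn2r _ 2)// ?nnegrE ?nrm_ge0 ?addr_ge0// nrm_sqr.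
by rewrite sqrrD !real_normK ?num_real// lerD2r lerDl mulrn_wge0// mulr_ge0.
Qed.

Lemma cReD z w : complex.Re (z + w) = complex.Re z + complex.Re w.
Proof. by case: z w => [? ?] [? ?]. Qed.
Lemma cImD z w : complex.Im (z + w) = complex.Im z + complex.Im w.
Proof. by case: z w => [? ?] [? ?]. Qed.
Lemma cReN z : complex.Re (- z) = - complex.Re z. Proof. by case: z. Qed.
Lemma cImN z : complex.Im (- z) = - complex.Im z. Proof. by case: z. Qed.
Lemma cReB z w : complex.Re (z - w) = complex.Re z - complex.Re w.
Proof. by rewrite cReD cReN. Qed.
Lemma cImB z w : complex.Im (z - w) = complex.Im z - complex.Im w.
Proof. by rewrite cImD cImN. Qed.
Lemma cReM z w : complex.Re (z * w) =
  complex.Re z * complex.Re w - complex.Im z * complex.Im w.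
Proof. by case: z w => [? ?] [? ?]. Qed.
Lemma cImM z w : complex.Im (z * w) =
  complex.Re z * complex.Im w + complex.Im z * complex.Re w.
Proof. by case: z w => [? ?] [? ?]. Qed.

(** First-order expansion, which unlike the difference quotient needs no exception
    at [w = p]. *)
Lemma derivable_nrmP (f : R[i] -> R[i]) (p : R[i]) : derivable f p 1 ->
  exists d : R[i], forall e : R, 0 < e -> exists2 del : R, 0 < del &
    forall w, nrm (w - p) < del ->
      nrm (f w - f p - d * (w - p)) <= e * nrm (w - p).
Proof.
move=> /cvg_ex[d] /=; move: d => d hd; exists d => e e0.
have /nbhs_nrmP[r r0 hr] : nbhs (0 : R[i])
    (fun h => h != 0 -> nrm (d - h^-1 *: (f (h *: 1 + p) - f p)) < e).
  have nd : nbhs d (fun q => nrm (d - q) < e).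
    by apply: (nbhs_nrmP d _).2; exists e => // w; rewrite nrmBC.
  exact: hd _ nd.
exists r => // w wr; have [->|wp] := eqVneq w p.
  by rewrite !subrr mulr0 subr0 nrm0 mulr0.
have wp0 : w - p != 0 by rewrite subr_eq0.
have /(_ _ wp0)/ltW := hr (w - p); rewrite subr0 => /(_ wr).
rewrite [(w - p) *: 1]mulr1 subrK => h.
rewrite -ler_pdivrMr ?nrm_gt0// -nrmV -nrmM mulrC mulrBr nrmBC.
by rewrite mulrCA mulVf// mulr1.
Qed.

Definition cont_at (f : R[i] -> R[i]) z := forall e : R, 0 < e ->
  exists2 del : R, 0 < del & forall w, nrm (w - z) < del -> nrm (f w - f z) < e.

Lemma derivable_cont_at f z : derivable f z 1 -> cont_at f z.
Proof.
move=> /derivable1_diffP/differentiable_continuous fc e e0.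
have /nbhs_nrmP[r r0 hr] : nbhs z (fun w => nrm (f w - f z) < e).
  have ne : nbhs (f z) (fun w => nrm (w - f z) < e).
    by apply: (nbhs_nrmP (f z) _).2; exists e.
  exact: fc _ ne.
by exists r.
Qed.

End RealNorm.

(** * Complex integrals over real segments *)

Section ComplexIntegral.
Context {R : realType}.
Notation mu := (@lebesgue_measure R).
Implicit Types (a b c : R) (h k : R -> R[i]) (f : R[i] -> R[i]).

Definition rcts (g : R -> R) a b := {within `[a, b], continuous g}.

Definition ccts h a b :=
  rcts (fun t => complex.Re (h t)) a b /\ rcts (fun t => complex.Im (h t)) a b.

Definition cint h a b : R[i] :=
  (\int[mu]_(t in `[a, b]) complex.Re (h t)) +i*
  (\int[mu]_(t in `[a, b]) complex.Im (h t)).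

Lemma rcts_integrable (g : R -> R) a b :
  rcts g a b -> mu.-integrable `[a, b] (EFin \o g).
Proof. by move=> cg; apply: continuous_compact_integrable => //; exact: segment_compact. Qed.

Lemma mu_seg a b : a <= b -> fine (mu `[a, b]%classic) = b - a.
Proof.
by move=> ab; rewrite lebesgue_measure_itv/= lte_fin; case: ltgtP ab => //= ->; rewrite subrr.
Qed.

Lemma Rint_bound (g : R -> R) a b M : a <= b -> rcts g a b ->
  (forall t, a <= t <= b -> `|g t| <= M) ->
  `|\int[mu]_(t in `[a, b]) g t| <= M * (b - a).
Proof.
move=> ab cg gM; rewrite -(mu_seg ab).
have ig := rcts_integrable cg.
apply: le_trans (le_normr_Rintegral _ ig) _ => //.
rewrite -Rintegral_cst//; apply: le_Rintegral => //.
- exact: (integrable_norm ig).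
- by apply: rcts_integrable; apply: continuous_subspaceT => x; exact: cvg_cst.
Qed.

Lemma Rint_ge (g : R -> R) a b M : a <= b -> rcts g a b ->
  (forall t, a <= t <= b -> M <= g t) ->
  M * (b - a) <= \int[mu]_(t in `[a, b]) g t.
Proof.
move=> ab cg gM; rewrite -(mu_seg ab) -Rintegral_cst//; apply: le_Rintegral => //.
- apply: rcts_integrable; apply: continuous_subspaceT => x; exact: cvg_cst.
- exact: rcts_integrable.
Qed.

Lemma Rint_le (g : R -> R) a b M : a <= b -> rcts g a b ->
  (forall t, a <= t <= b -> g t <= M) ->
  \int[mu]_(t in `[a, b]) g t <= M * (b - a).
Proof.
move=> ab cg gM; rewrite -(mu_seg ab) -Rintegral_cst//; apply: le_Rintegral => //.
- exact: rcts_integrable.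
- by apply: rcts_integrable; apply: continuous_subspaceT => x; exact: cvg_cst.
Qed.

Lemma Rint_split (g : R -> R) a c b : a <= c <= b -> rcts g a b ->
  \int[mu]_(t in `[a, b]) g t =
  \int[mu]_(t in `[a, c]) g t + \int[mu]_(t in `[c, b]) g t.
Proof.
move=> /andP[ac cb] cg; have ig := rcts_integrable cg.
have /= := @Rintegral_itvB R g (BLeft a) (BRight b) c ig.
rewrite !bnd_simp => /(_ ac cb) E.
rewrite -[X in _ + X]Rintegral_itv_obnd_cbnd; last first.
  apply: integrableS ig => // x /=; rewrite !in_itv/= => /andP[cx ->].
  by rewrite (le_trans ac (ltW cx)).
by rewrite -E addrC subrK.
Qed.

Lemma cint_split h a c b : a <= c <= b -> ccts h a b ->
  cint h a b = cint h a c + cint h c b.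
Proof. by move=> acb [c1 c2]; rewrite /cint !(Rint_split acb). Qed.

(** The factor 2 comes from estimating the real and the imaginary part separately. *)
Lemma cint_bound h a b M : a <= b -> ccts h a b ->
  (forall t, a <= t <= b -> nrm (h t) <= M) ->
  nrm (cint h a b) <= 2 * M * (b - a).
Proof.
move=> ab [c1 c2] hM; apply: le_trans (nrm_le_ReIm _) _ => /=.
rewrite -mulrA mulr_natl mulr2n; apply: lerD; apply: Rint_bound => // t /hM;
  apply: le_trans; [exact: nrm_Re|exact: nrm_Im].
Qed.

Lemma rctsZ (g1 : R -> R) a b r : rcts g1 a b -> rcts (fun t => r * g1 t) a b.
Proof. by move=> h1 x; apply: cvgM; [exact: cvg_cst|exact: h1]. Qed.

Lemma cintD h k a b : ccts h a b -> ccts k a b ->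
  cint (fun t => h t + k t) a b = cint h a b + cint k a b.
Proof.
move=> [h1 h2] [k1 k2]; rewrite /cint.
apply/eqP; rewrite eq_complex /=; apply/andP; split; apply/eqP.
  rewrite -RintegralD//; try exact: rcts_integrable.
  by apply: eq_Rintegral => t _; rewrite cReD.
rewrite -RintegralD//; try exact: rcts_integrable.
by apply: eq_Rintegral => t _; rewrite cImD.
Qed.

Lemma cintZ z h a b : ccts h a b ->
  cint (fun t => z * h t) a b = z * cint h a b.
Proof.
move=> [h1 h2]; rewrite /cint; case: z => x y.
apply/eqP; rewrite eq_complex /=; apply/andP; split; apply/eqP.
  rewrite -!RintegralZl//; try exact: rcts_integrable.
  rewrite -RintegralB//; try (apply: rcts_integrable; exact: rctsZ).
  by apply: eq_Rintegral => t _; rewrite cReM.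
rewrite -!RintegralZl//; try exact: rcts_integrable.
rewrite -RintegralD//; try (apply: rcts_integrable; exact: rctsZ).
by apply: eq_Rintegral => t _; rewrite cImM.
Qed.

Lemma eq_cint h k a b : (forall t, a <= t <= b -> h t = k t) ->
  cint h a b = cint k a b.
Proof.
move=> hk; rewrite /cint; congr (_ +i* _); apply: eq_Rintegral => t;
  by rewrite inE/= in_itv/= => /hk ->.
Qed.

Lemma ccts_of h a b : (forall t, a <= t <= b -> forall e, 0 < e ->
    exists2 del, 0 < del & forall u, `|u - t| < del -> nrm (h u - h t) < e) ->
  ccts h a b.
Proof.
move=> H; split; apply: continuous_in_subspaceT => t; rewrite inE/= in_itv/=.
  move=> /H ct; apply/cvgrPdist_lt => e /ct[d d0 hd].
  apply/nbhs_ballP; exists d => //= u; rewrite /ball/= distrC => /hd.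
  by apply: le_lt_trans; rewrite distrC -cReB nrm_Re.
move=> /H ct; apply/cvgrPdist_lt => e /ct[d d0 hd].
apply/nbhs_ballP; exists d => //= u; rewrite /ball/= distrC => /hd.
by apply: le_lt_trans; rewrite distrC -cImB nrm_Im.
Qed.

End ComplexIntegral.

(** * Goursat's theorem for rectangles *)

Section Goursat.
Context {R : realType}.
Implicit Types (x y : R) (f g : R[i] -> R[i]).

Definition hint f y x0 x1 : R[i] := cint (fun t => f (t +i* y)) x0 x1.
Definition vint f x y0 y1 : R[i] := cint (fun t => f (x +i* t)) y0 y1.

(** The integral of [f] along the boundary of the rectangle, counterclockwise. *)
Definition rectint f x0 x1 y0 y1 : R[i] :=
  hint f y0 x0 x1 - hint f y1 x0 x1 + 'i%C * (vint f x1 y0 y1 - vint f x0 y0 y1).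

Definition hcont f y x0 x1 := forall t, x0 <= t <= x1 -> cont_at f (t +i* y).
Definition vcont f x y0 y1 := forall t, y0 <= t <= y1 -> cont_at f (x +i* t).

Definition rcont f x0 x1 y0 y1 := [/\ hcont f y0 x0 x1, hcont f y1 x0 x1,
  vcont f x0 y0 y1 & vcont f x1 y0 y1].

Lemma nrm_imaginary : nrm ('i%C : R[i]) = 1.
Proof. by rewrite /nrm normc_def /= expr0n add0r expr1n sqrtr1. Qed.

Lemma hcontP f y x0 x1 : hcont f y x0 x1 -> ccts (fun t => f (t +i* y)) x0 x1.
Proof.
move=> H; apply: ccts_of => t /H ct e /ct[d d0 hd]; exists d => // u ut.
apply: hd; rewrite (_ : _ - _ = (u - t)%:C) ?nrmC//.
by apply/eqP; rewrite eq_complex /= subrr !eqxx.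
Qed.

Lemma vcontP f x y0 y1 : vcont f x y0 y1 -> ccts (fun t => f (x +i* t)) y0 y1.
Proof.
move=> H; apply: ccts_of => t /H ct e /ct[d d0 hd]; exists d => // u ut.
apply: hd; rewrite (_ : _ - _ = 'i%C * (u - t)%:C).
  by rewrite nrmM nrmC nrm_imaginary mul1r.
by apply/eqP; rewrite eq_complex /=; apply/andP; split; apply/eqP; ring.
Qed.

Lemma hint_split f y x0 x x1 : x0 <= x <= x1 -> hcont f y x0 x1 ->
  hint f y x0 x1 = hint f y x0 x + hint f y x x1.
Proof. by move=> h /hcontP c; exact: cint_split. Qed.

Lemma vint_split f x y0 y y1 : y0 <= y <= y1 -> vcont f x y0 y1 ->
  vint f x y0 y1 = vint f x y0 y + vint f x y y1.
Proof. by move=> h /vcontP c; exact: cint_split. Qed.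

Lemma rect_splitx f x0 x x1 y0 y1 : x0 <= x <= x1 ->
  hcont f y0 x0 x1 -> hcont f y1 x0 x1 ->
  rectint f x0 x1 y0 y1 = rectint f x0 x y0 y1 + rectint f x x1 y0 y1.
Proof. by move=> h c0 c1; rewrite /rectint !(hint_split h)//; ring. Qed.

Lemma rect_splity f x0 x1 y0 y y1 : y0 <= y <= y1 ->
  vcont f x0 y0 y1 -> vcont f x1 y0 y1 ->
  rectint f x0 x1 y0 y1 = rectint f x0 x1 y0 y + rectint f x0 x1 y y1.
Proof. by move=> h c0 c1; rewrite /rectint !(vint_split h)//; ring. Qed.

Lemma rectintD f g x0 x1 y0 y1 : rcont f x0 x1 y0 y1 -> rcont g x0 x1 y0 y1 ->
  rectint (fun z => f z + g z) x0 x1 y0 y1 = rectint f x0 x1 y0 y1 + rectint g x0 x1 y0 y1.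
Proof.
move=> [/hcontP ? /hcontP ? /vcontP ? /vcontP ?] [/hcontP ? /hcontP ? /vcontP ? /vcontP ?].
by rewrite /rectint /hint /vint !cintD//; ring.
Qed.

Lemma rectintZ a f x0 x1 y0 y1 : rcont f x0 x1 y0 y1 ->
  rectint (fun z => a * f z) x0 x1 y0 y1 = a * rectint f x0 x1 y0 y1.
Proof.
move=> [/hcontP ? /hcontP ? /vcontP ? /vcontP ?].
by rewrite /rectint /hint /vint !cintZ//; ring.
Qed.

Definition bdry x0 x1 y0 y1 (z : R[i]) :=
  x0 <= complex.Re z <= x1 /\ (complex.Im z = y0 \/ complex.Im z = y1) \/
  y0 <= complex.Im z <= y1 /\ (complex.Re z = x0 \/ complex.Re z = x1).

Lemma rcont_bdry f x0 x1 y0 y1 :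
  (forall z, bdry x0 x1 y0 y1 z -> cont_at f z) -> rcont f x0 x1 y0 y1.
Proof.
by move=> H; split=> t ht; apply: H; rewrite /bdry /=; tauto.
Qed.

Lemma eq_rectint f g x0 x1 y0 y1 : (forall z, bdry x0 x1 y0 y1 z -> f z = g z) ->
  rectint f x0 x1 y0 y1 = rectint g x0 x1 y0 y1.
Proof.
move=> H; rewrite /rectint /hint /vint; congr (_ - _ + _ * (_ - _));
  by apply: eq_cint => t ht; apply: H; rewrite /bdry /=; tauto.
Qed.

(** Each of the four sides contributes with the factor 2 of [cint_bound]. *)
Lemma rectint_bound f x0 x1 y0 y1 M : x0 <= x1 -> y0 <= y1 ->
  rcont f x0 x1 y0 y1 -> (forall z, bdry x0 x1 y0 y1 z -> nrm (f z) <= M) ->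
  nrm (rectint f x0 x1 y0 y1) <= 4 * M * ((x1 - x0) + (y1 - y0)).
Proof.
move=> hx hy [/hcontP c1 /hcontP c2 /vcontP c3 /vcontP c4] H.
have b1 : nrm (hint f y0 x0 x1) <= 2 * M * (x1 - x0).
  by apply: cint_bound => // t ht; apply: H; rewrite /bdry /=; tauto.
have b2 : nrm (hint f y1 x0 x1) <= 2 * M * (x1 - x0).
  by apply: cint_bound => // t ht; apply: H; rewrite /bdry /=; tauto.
have b3 : nrm (vint f x0 y0 y1) <= 2 * M * (y1 - y0).
  by apply: cint_bound => // t ht; apply: H; rewrite /bdry /=; tauto.
have b4 : nrm (vint f x1 y0 y1) <= 2 * M * (y1 - y0).
  by apply: cint_bound => // t ht; apply: H; rewrite /bdry /=; tauto.
apply: le_trans (nrmD _ _) _; rewrite nrmM nrm_imaginary mul1r.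
have := nrmB (hint f y0 x0 x1) (hint f y1 x0 x1).
have := nrmB (vint f x1 y0 y1) (vint f x0 y0 y1).
lra.
Qed.

Lemma cont_affine (a b z : R[i]) : cont_at (fun w => a + b * w) z.
Proof.
move=> e e0; have n0 : 0 < nrm b + 1 by rewrite ltr_wpDl ?nrm_ge0.
exists (e / (nrm b + 1)); first by rewrite divr_gt0.
move=> w hw; rewrite (_ : _ - _ = b * (w - z)); last by ring.
rewrite nrmM; apply: le_lt_trans (_ : _ <= (nrm b + 1) * nrm (w - z)) _.
  by rewrite ler_wpM2r ?nrm_ge0// lerDl.
by rewrite mulrC -ltr_pdivlMr.
Qed.

(** The constant parts of the four side integrals are explicit, and the integrals of
    the parameter cancel between opposite sides. *)
Lemma rectint_affine (a b : R[i]) x0 x1 y0 y1 : x0 <= x1 -> y0 <= y1 ->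
  rectint (fun w => a + b * w) x0 x1 y0 y1 = 0.
Proof.
move=> hx hy.
have Hc (c : R[i]) (u v : R) : u <= v -> cint (fun=> c) u v = c * (v - u)%:C.
  move=> uv; rewrite /cint !Rintegral_cst// mu_seg//; case: c => p q.
  by apply/eqP; rewrite eq_complex /= !(mulr0, subr0, addr0, add0r) !eqxx.
have c1 (c : R[i]) (u v : R) : ccts (fun=> c : R[i]) u v.
  by split; apply: continuous_subspaceT => x; exact: cvg_cst.
have cIz (c : R[i]) (u v : R) : ccts (fun t => c * t%:C) u v.
  apply: ccts_of => t _ e e0; have [d d0 hd] := @cont_affine 0 c t%:C e e0.
  exists d => // w wt; have := hd w%:C; rewrite -rmorphB nrmC => /(_ wt).
  by rewrite !add0r.
have cI (u v : R) : ccts (fun t => t%:C) u v.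
  have := cIz 1 u v; rewrite (_ : (fun t : R => _) = (fun t => t%:C))//.
  by apply/funext => t; rewrite mul1r.
have Hl (c d : R[i]) (u v : R) : u <= v -> cint (fun t => c + d * t%:C) u v =
    c * (v - u)%:C + d * cint (fun t => t%:C) u v.
  by move=> uv; rewrite cintD// cintZ// Hc.
have EH y : hint (fun w => a + b * w) y x0 x1 =
    (a + b * 'i%C * y%:C) * (x1 - x0)%:C + b * cint (fun t => t%:C) x0 x1.
  rewrite -Hl//; apply: eq_cint => t _; rewrite (complexE (t +i* y)) /=; ring.
have EV x : vint (fun w => a + b * w) x y0 y1 =
    (a + b * x%:C) * (y1 - y0)%:C + b * 'i%C * cint (fun t => t%:C) y0 y1.
  rewrite -Hl//; apply: eq_cint => t _; rewrite (complexE (x +i* t)) /=; ring.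
rewrite /rectint !EH !EV !rmorphB /=; ring.
Qed.

Lemma nested_point (x r : nat -> R) :
  (forall n, x n <= x n.+1) -> (forall n, r n.+1 <= r n) ->
  (forall n, x n <= r n) -> exists p, forall n, x n <= p <= r n.
Proof.
move=> hx hr hxr.
have mx : {homo x : n m / (n <= m)%N >-> n <= m}.
  by apply: homo_leq => // a b c; exact: le_trans.
have mr : forall n m, (n <= m)%N -> r m <= r n.
  move=> n m /subnK <-; elim: (m - n)%N => // k IH.
  by rewrite addSn (le_trans _ IH).
have ub n : ubound (range x) (r n).
  move=> _ [m _ <-]; apply: le_trans (mx _ _ (leq_maxl m n)) _.
  exact: le_trans (hxr _) (mr _ _ (leq_maxr m n)).
exists (sup (range x)) => n; apply/andP; split.
  by apply: ub_le_sup; [exists (r 0%N)|exists n].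
by apply: ge_sup; [exists (x 0%N), 0%N|exact: ub].
Qed.

Lemma dep_choice (T : Type) (P : nat -> T -> Prop) (S : nat -> T -> T -> Prop)
    (t0 : T) : P 0%N t0 ->
  (forall n t, P n t -> exists s, P n.+1 s /\ S n t s) ->
  exists2 u : nat -> T, u 0%N = t0 & forall n, P n (u n) /\ S n (u n) (u n.+1).
Proof.
move=> P0 H.
have [[n t] /=|F hF] := @choice (nat * T) T
    (fun q s => P q.1 q.2 -> P q.1.+1 s /\ S q.1 q.2 s).
  have [Pt|nPt] := pselect (P n t); last by exists t.
  by have [s hs] := H n t Pt; exists s.
pose u := fix u n := if n is m.+1 then F (m, u m) else t0.
have Pu n : P n (u n) by elim: n => //= n IH; have [] := hF (n, u n) IH.
by exists u => // n; split=> //; have [] := hF (n, u n) (Pu n).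
Qed.

Lemma cont_atD f g z : cont_at f z -> cont_at g z ->
  cont_at (fun w => f w + g w) z.
Proof.
move=> cf cg e e0; have e2 : 0 < e / 2 by rewrite divr_gt0.
have [d1 d10 h1] := cf _ e2; have [d2 d20 h2] := cg _ e2.
exists (Num.min d1 d2); first by rewrite lt_min d10.
move=> w; rewrite lt_min => /andP[/h1 w1 /h2 w2].
rewrite (_ : _ - _ = (f w - f z) + (g w - g z)); last by ring.
by apply: le_lt_trans (nrmD _ _) _; lra.
Qed.

Definition inrect x0 x1 y0 y1 (z : R[i]) :=
  x0 <= complex.Re z <= x1 /\ y0 <= complex.Im z <= y1.

Lemma bdry_inrect x0 x1 y0 y1 z : x0 <= x1 -> y0 <= y1 ->
  bdry x0 x1 y0 y1 z -> inrect x0 x1 y0 y1 z.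
Proof.
by rewrite /inrect => hx hy [[h [->|->]]|[h [->|->]]]; split; rewrite ?lexx ?hx ?hy.
Qed.

Lemma half_pow_lt (a e : R) : 0 < e -> exists n, a / 2 ^+ n < e.
Proof.
move=> e0; have [n hn] : exists n, a / e < n%:R.
  exists (Num.bound `|a / e|); apply: le_lt_trans (ler_norm _) _.
  exact: archi_boundP.
exists n; rewrite ltr_pdivrMr ?exprn_gt0// -ltr_pdivrMl//.
by rewrite mulrC (lt_trans hn)// -natrX ltr_nat ltn_expl.
Qed.

Lemma half_powS n : ((2 : R) ^+ n)^-1 = (2 ^+ n.+1)^-1 + (2 ^+ n.+1)^-1.
Proof. by rewrite exprS invfM -mulrDl (_ : 2^-1 + 2^-1 = 1 :> R) ?mul1r//; lra. Qed.

(** Repeated halving of a rectangle with sides [w] and [h]: [bad n u] speaks of the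
    rectangle with lower left corner [u] and sides [w / 2 ^+ n] and [h / 2 ^+ n]. By
    completeness the chosen rectangles have a common point. *)
Lemma bisection (w h : R) (bad : nat -> R * R -> Prop) u0 : 0 <= w -> 0 <= h ->
  bad 0%N u0 ->
  (forall n u, bad n u -> exists2 v, bad n.+1 v &
     (v.1 = u.1 \/ v.1 = u.1 + w / 2 ^+ n.+1) /\
     (v.2 = u.2 \/ v.2 = u.2 + h / 2 ^+ n.+1)) ->
  exists p : R * R, forall n, exists u, [/\ bad n u,
    u.1 <= p.1 <= u.1 + w / 2 ^+ n & u.2 <= p.2 <= u.2 + h / 2 ^+ n].
Proof.
move=> w0 h0 bad0 step.
have [n u /step[v bv uv]|u _ hu] := dep_choice bad0
  (S := fun n u v => (v.1 = u.1 \/ v.1 = u.1 + w / 2 ^+ n.+1) /\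
                     (v.2 = u.2 \/ v.2 = u.2 + h / 2 ^+ n.+1)); first by exists v.
have key (l : R) (x : nat -> R) : 0 <= l ->
    (forall n, x n.+1 = x n \/ x n.+1 = x n + l / 2 ^+ n.+1) ->
    exists p, forall n, x n <= p <= x n + l / 2 ^+ n.
  move=> l0 hx.
  have q0 n : 0 <= l / 2 ^+ n by rewrite divr_ge0// exprn_ge0.
  have qS n : l / 2 ^+ n = l / 2 ^+ n.+1 + l / 2 ^+ n.+1 by rewrite half_powS mulrDr.
  apply: nested_point => n; last by rewrite lerDl.
    by have := q0 n.+1; case: (hx n) => ->; lra.
  by have := q0 n.+1; rewrite (qS n); case: (hx n) => ->; lra.
have [px hpx] := key w (fun n => (u n).1) w0 (fun n => (hu n).2.1).
have [py hpy] := key h (fun n => (u n).2) h0 (fun n => (hu n).2.2).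
by exists (px, py) => n; exists (u n); split; [exact: (hu n).1|exact: hpx|exact: hpy].
Qed.

Lemma rect_quarters f (x y a b : R) : 0 <= a -> 0 <= b ->
  (forall z, inrect x (x + a + a) y (y + b + b) z -> cont_at f z) ->
  rectint f x (x + a + a) y (y + b + b) =
  (rectint f x (x + a) y (y + b) + rectint f x (x + a) (y + b) (y + b + b)) +
  (rectint f (x + a) (x + a + a) y (y + b) +
   rectint f (x + a) (x + a + a) (y + b) (y + b + b)).
Proof.
move=> a0 b0 cf; set X := x + a; set Y := y + b; set X' := X + a; set Y' := Y + b.
have [x1 x2 y1 y2] : [/\ x <= X, X <= X', y <= Y & Y <= Y'].
  by rewrite /X' /X /Y' /Y; split; rewrite lerDl.
have [x3 y3] := (le_trans x1 x2, le_trans y1 y2).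
have ch t u v : y <= t <= Y' -> x <= u -> v <= X' -> hcont f t u v.
  move=> ht xu vX s /andP[us sv]; apply: cf; split => //=.
  by rewrite (le_trans xu us) (le_trans sv vX).
have cv t u v : x <= t <= X' -> y <= u -> v <= Y' -> vcont f t u v.
  move=> ht yu vY s /andP[us sv]; apply: cf; split => //=.
  by rewrite (le_trans yu us) (le_trans sv vY).
have [X1 Y1] : x <= X <= X' /\ y <= Y <= Y' by rewrite x1 x2 y1 y2.
rewrite (rect_splitx X1); first last.
- by apply: ch; rewrite ?lexx ?y3.
- by apply: ch; rewrite ?lexx ?y3.
rewrite (rect_splity Y1); first last.
- by apply: cv; rewrite ?lexx ?x1 ?x2.
- by apply: cv; rewrite ?lexx ?x3.
rewrite (rect_splity (f := f) (x0 := X) Y1) //.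
- by apply: cv; rewrite ?lexx ?x1 ?x2.
- by apply: cv; rewrite ?lexx ?x3.
Qed.

(** Near a point of differentiability the integrand is affine up to an error which
    is small compared with the size of the rectangle, and an affine function
    integrates to zero. *)
Lemma rectint_local f p e : derivable f p 1 -> 0 < e -> exists2 del : R, 0 < del &
  forall x y a b, 0 <= a -> 0 <= b -> a + b < del ->
    inrect x (x + a) y (y + b) p ->
    (forall z, inrect x (x + a) y (y + b) z -> cont_at f z) ->
    nrm (rectint f x (x + a) y (y + b)) <= 4 * e * (a + b) ^+ 2.
Proof.
move=> df e0; have [d /(_ e e0)[del del0 hd]] := derivable_nrmP df.
exists del => // x y a b a0 b0 abd [/andP[p1 p2] /andP[p3 p4]] cf.
have [xa yb] : x <= x + a /\ y <= y + b by rewrite !lerDl.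
(* [psi] is [f] minus its first-order expansion at [p] *)
pose psi z := f z + ((- f p + d * p) + (- d) * z).
have sub z : bdry x (x + a) y (y + b) z -> inrect x (x + a) y (y + b) z.
  exact: bdry_inrect.
have -> : rectint f x (x + a) y (y + b) = rectint psi x (x + a) y (y + b).
  rewrite /psi rectintD ?rectint_affine ?addr0//; apply: rcont_bdry => z.
    by move=> /sub/cf.
  by move=> _; exact: cont_affine.
have -> : 4 * e * (a + b) ^+ 2 =
    4 * (e * (a + b)) * ((x + a - x) + (y + b - y)) by ring.
apply: rectint_bound => //.
  by apply: rcont_bdry => z /sub/cf cz; apply: cont_atD cz (cont_affine _ _ _).
move=> z /sub[/andP[z1 z2] /andP[z3 z4]].
have zp : nrm (z - p) <= a + b.
  apply: le_trans (nrm_le_ReIm _) _; rewrite cReB cImB.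
  by clear -p1 p2 p3 p4 z1 z2 z3 z4; apply: lerD; rewrite ler_norml; lra.
have -> : psi z = f z - f p - d * (z - p) by rewrite /psi; ring.
apply: le_trans (hd _ (le_lt_trans zp abd)) _.
by rewrite ler_pM2l.
Qed.

(** If the integral were not zero, bisection would produce nested rectangles
    shrinking to a point [p] over each of which the integral is at least a fixed
    multiple of the square of the size, contradicting [rectint_local] at [p]. *)
Theorem goursat f x0 x1 y0 y1 : x0 <= x1 -> y0 <= y1 ->
  (forall z, inrect x0 x1 y0 y1 z -> derivable f z 1) ->
  rectint f x0 x1 y0 y1 = 0.
Proof.
move=> hx hy df.
have cf z : inrect x0 x1 y0 y1 z -> cont_at f z.
  by move=> /df /derivable_cont_at.
set w := x1 - x0; set h := y1 - y0.
have w0 : 0 <= w by rewrite subr_ge0.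
have h0 : 0 <= h by rewrite subr_ge0.
suff main e : 0 < e -> nrm (rectint f x0 x1 y0 y1) <= 4 * e * (w + h) ^+ 2.
  apply: nrm_eps0 => e e0.
  have k0 : 0 < 4 * (w + h) ^+ 2 + 1 by rewrite ltr_wpDl// mulr_ge0// sqr_ge0.
  apply: le_trans (main _ (divr_gt0 e0 k0)) _.
  rewrite mulrAC mulrA [_ * e]mulrC -mulrA ler_piMr ?(ltW e0)//.
  by rewrite ler_pdivrMr// mul1r mulrC lerDl.
move=> e0; apply: contrapT => /negP; rewrite -ltNge => big.
pose W n := w / 2 ^+ n; pose Hh n := h / 2 ^+ n.
have W0 n : 0 <= W n by rewrite divr_ge0// exprn_ge0.
have H0 n : 0 <= Hh n by rewrite divr_ge0// exprn_ge0.
have WS n : W n = W n.+1 + W n.+1 by rewrite /W half_powS mulrDr.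
have HS n : Hh n = Hh n.+1 + Hh n.+1 by rewrite /Hh half_powS mulrDr.
pose bad n (u : R * R) := [/\ x0 <= u.1 /\ u.1 + W n <= x1, y0 <= u.2 /\ u.2 + Hh n <= y1
  & 4 * e * (W n + Hh n) ^+ 2 < nrm (rectint f u.1 (u.1 + W n) u.2 (u.2 + Hh n))].
have bad0 : bad 0%N (x0, y0).
  have e1 : x0 + W 0%N = x1 by rewrite /W /w expr0; field.
  have e2 : y0 + Hh 0%N = y1 by rewrite /Hh /h expr0; field.
  by rewrite /bad /= e1 e2 /W /Hh expr0 !divr1.
have step n u : bad n u -> exists2 v, bad n.+1 v &
    (v.1 = u.1 \/ v.1 = u.1 + W n.+1) /\ (v.2 = u.2 \/ v.2 = u.2 + Hh n.+1).
  case: u => x y [[/= xa]]; rewrite (WS n) (HS n) !addrA => xb [ya yb] big_n.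
  have := W0 n.+1; have := H0 n.+1; rewrite /bad /=.
  move: (W n.+1) (Hh n.+1) xb yb big_n => a b xb yb big_n b0 a0.
  pose Q := 4 * e * (a + b) ^+ 2.
  have QE : 4 * e * (a + a + b + b) ^+ 2 = Q + Q + Q + Q by rewrite /Q; ring.
  apply: contrapT => none.
  have K u v : (u = x \/ u = x + a) -> (v = y \/ v = y + b) ->
      nrm (rectint f u (u + a) v (v + b)) <= Q.
    move=> hu hv; rewrite leNgt; apply/negP => lt; apply: none.
    have [? ?] : x0 <= u /\ u + a <= x1.
      by clear -hu xa xb a0; case: hu => ->; lra.
    have [? ?] : y0 <= v /\ v + b <= y1.
      by clear -hv ya yb b0; case: hv => ->; lra.
    by exists (u, v).
  move: big_n; rewrite QE rect_quarters//; last first.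
    move=> z [/andP[? ?] /andP[? ?]]; apply: cf.
    by split; apply/andP; split; apply: le_trans; eassumption.
  rewrite ltNge => /negP; apply.
  have := K x y (or_introl erefl) (or_introl erefl).
  have := K x (y + b) (or_introl erefl) (or_intror erefl).
  have := K (x + a) y (or_intror erefl) (or_introl erefl).
  have := K (x + a) (y + b) (or_intror erefl) (or_intror erefl).
  move: (rectint _ _ _ _ _) (rectint _ _ _ _ _) (rectint _ _ _ _ _) (rectint _ _ _ _ _).
  move=> A1 A2 A3 A4 k1 k2 k3 k4; apply: le_trans (nrmD _ _) _.
  have := nrmD A3 A4; have := nrmD A1 A2.
  clear -k1 k2 k3 k4; lra.
have [p hp] := bisection w0 h0 bad0 step.
have pin : inrect x0 x1 y0 y1 (p.1 +i* p.2).
  have [u [[[? ?] [? ?] _] /andP[? ?] /andP[? ?]]] := hp 0%N.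
  by split; apply/andP; split => /=; apply: le_trans; eassumption.
have [del del0 hd] := rectint_local (df _ pin) e0.
have [n hn] := half_pow_lt (w + h) del0.
have [u [[[xa xb] [ya yb] lt]  px py]] := hp n.
move: lt; rewrite ltNge => /negP; apply; apply: hd => //.
  by rewrite /W /Hh -mulrDl.
move=> z [/andP[? ?] /andP[? ?]]; apply: cf.
by split; apply/andP; split; apply: le_trans; eassumption.
Qed.

End Goursat.

(** * Cauchy's formula and Taylor expansion *)

Section Cauchy.
Context {R : realType}.
Implicit Types (f g : R[i] -> R[i]) (a b z : R[i]).

Lemma derivable_mul f g z : derivable f z 1 -> derivable g z 1 ->
  derivable (fun w => f w * g w) z 1.
Proof. by move=> df dg; exact: (derivableM df dg). Qed.

Lemma derivable_subc f a z : derivable f z 1 -> derivable (fun w => f w - a) z 1.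
Proof. by move=> df; apply: (derivableB df); exact: derivable_cst. Qed.

Lemma derivable_inv_sub a z : z != a -> derivable (fun w : R[i] => (w - a)^-1) z 1.
Proof.
move=> za; apply: (@derivableV _ _ (fun w => w - a)); first by rewrite subr_eq0.
by apply: derivable_subc; exact: derivable_id.
Qed.

Lemma derivable_invX n z : z != 0 -> derivable (fun w : R[i] => w^-1 ^+ n) z 1.
Proof.
move=> z0; elim: n => [|n IH].
  rewrite (_ : (fun _ => _) = cst (1 : R[i])); first exact: derivable_cst.
  by apply/funext => w; rewrite expr0.
rewrite (_ : (fun _ => _) = (fun w : R[i] => (w - 0)^-1 * w^-1 ^+ n)).
  exact (derivable_mul (@derivable_inv_sub 0 z z0) IH).
by apply/funext => w; rewrite exprS subr0.
Qed.

(** Deformation of the contour: the region between the two rectangles is cut into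
    four rectangles, on which [goursat] applies. *)
Lemma annulus f (x0 a0 a1 x1 y0 b0 b1 y1 : R) :
  x0 <= a0 -> a0 <= a1 -> a1 <= x1 -> y0 <= b0 -> b0 <= b1 -> b1 <= y1 ->
  (forall z, inrect x0 x1 y0 y1 z ->
     ~ (a0 < complex.Re z < a1 /\ b0 < complex.Im z < b1) -> derivable f z 1) ->
  rectint f x0 x1 y0 y1 = rectint f a0 a1 b0 b1.
Proof.
move=> xa aa ax yb bb by1 df.
have cf z : inrect x0 x1 y0 y1 z ->
     ~ (a0 < complex.Re z < a1 /\ b0 < complex.Im z < b1) -> cont_at f z.
  by move=> h /(df _ h); exact: derivable_cont_at.
have hc y u v : (y0 <= y <= b0 \/ b1 <= y <= y1) -> x0 <= u -> v <= x1 -> hcont f y u v.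
  move=> hy hu hv t /andP[? ?]; apply: cf => /=.
    by split => /=; [lra|case: hy => /andP[? ?]; lra].
  by case: hy => /andP[? ?] [_ /andP[? ?]]; lra.
have vc x u v : (x0 <= x <= a0 \/ a1 <= x <= x1) -> y0 <= u -> v <= y1 -> vcont f x u v.
  move=> hx hu hv t /andP[? ?]; apply: cf => /=.
    by split => /=; [case: hx => /andP[? ?]; lra|lra].
  by case: hx => /andP[? ?] [/andP[? ?] _]; lra.
rewrite (@rect_splitx _ f x0 a0 x1); try (by apply: hc; lra); last by lra.
rewrite (@rect_splitx _ f a0 a1 x1); try (by apply: hc; lra); last by lra.
rewrite (@rect_splity _ f a0 a1 y0 b0 y1); try (by apply: vc; lra); last by lra.
rewrite (@rect_splity _ f a0 a1 b0 b1 y1); try (by apply: vc; lra); last by lra.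
have G u v p q : u <= v -> p <= q -> x0 <= u -> v <= x1 -> y0 <= p -> q <= y1 ->
  (v <= a0 \/ a1 <= u \/ q <= b0 \/ b1 <= p) -> rectint f u v p q = 0.
  move=> uv pq hu hv hp hq H; apply: goursat => // z [/andP[? ?] /andP[? ?]].
  apply: df; first by split; lra.
  by move=> [/andP[? ?] /andP[? ?]]; case: H => [|[|[|]]] ?; lra.
have [? ? ? ?] : [/\ b0 <= y1, y0 <= b1, x0 <= a1 & a0 <= x1] by split; lra.
have ? : y0 <= y1 by lra.
rewrite (G x0 a0)//; last by left.
rewrite (G a1 x1)//; last by right; left.
rewrite (G a0 a1 y0 b0)//; last by right; right; left.
rewrite (G a0 a1 b1 y1)//; last by right; right; right.
by rewrite !add0r !addr0.
Qed.

Definition square_int (r : R) f := rectint f (- r) r (- r) r.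

Definition in_open_square (r : R) a := `|complex.Re a| < r /\ `|complex.Im a| < r.

Lemma small_square r a : in_open_square r a -> exists2 d : R, 0 < d & forall s, 0 < s -> s < d ->
  [/\ - r <= complex.Re a - s, complex.Re a + s <= r,
      - r <= complex.Im a - s & complex.Im a + s <= r].
Proof.
rewrite /in_open_square !ltr_norml => -[/andP[? ?] /andP[? ?]].
exists (Num.min (Num.min (r - complex.Re a) (r + complex.Re a))
                (Num.min (r - complex.Im a) (r + complex.Im a))).
  by rewrite !lt_min; apply/andP; split; apply/andP; split; lra.
by move=> s s0; rewrite !lt_min => /andP[/andP[? ?] /andP[? ?]]; split; lra.
Qed.

Lemma square_int_shrink f r a s : 0 < s ->
  [/\ - r <= complex.Re a - s, complex.Re a + s <= r,
      - r <= complex.Im a - s & complex.Im a + s <= r] ->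
  (forall z, inrect (- r) r (- r) r z -> z != a -> derivable f z 1) ->
  square_int r f = rectint f (complex.Re a - s) (complex.Re a + s)
                      (complex.Im a - s) (complex.Im a + s).
Proof.
move=> s0 [h1 h2 h3 h4] df; apply: annulus; try lra.
move=> z /df h nz; apply: h; apply: contra_notN nz => /eqP ->.
by split; apply/andP; split; lra.
Qed.

Lemma bdry_sq_far a (s : R) z : 0 <= s -> bdry (complex.Re a - s) (complex.Re a + s)
  (complex.Im a - s) (complex.Im a + s) z -> s <= nrm (z - a) <= s + s.
Proof.
move=> s0 h; apply/andP; split; last first.
  apply: le_trans (nrm_le_ReIm _) _; rewrite cReB cImB.
  by apply: lerD; rewrite ler_norml; case: h => -[/andP[? ?] [?|?]];
    apply/andP; split; lra.
case: h => -[_ [E|E]].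
- apply: le_trans (nrm_Im _); rewrite cImB E ler_normr; apply/orP; right; lra.
- apply: le_trans (nrm_Im _); rewrite cImB E ler_normr; apply/orP; left; lra.
- apply: le_trans (nrm_Re _); rewrite cReB E ler_normr; apply/orP; right; lra.
- apply: le_trans (nrm_Re _); rewrite cReB E ler_normr; apply/orP; left; lra.
Qed.

Lemma bdry0_far (s : R) z : 0 <= s -> bdry (- s) s (- s) s z ->
  s <= nrm z <= s + s.
Proof.
move=> s0 h; rewrite -(subr0 z); apply: (@bdry_sq_far 0) => //=.
by rewrite sub0r add0r.
Qed.

Lemma bdry0_inrect (s : R) z : 0 <= s -> bdry (- s) s (- s) s z -> inrect (- s) s (- s) s z.
Proof. by move=> s0; apply: bdry_inrect; lra. Qed.

Lemma bdry0_neq (s : R) a z : bdry (- s) s (- s) s z -> in_open_square s a -> z != a.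
Proof.
move=> h; rewrite /in_open_square !ltr_norml => -[/andP[? ?] /andP[? ?]].
by apply/eqP => E; move: h; rewrite E => -[[_ [?|?]]|[_ [?|?]]]; lra.
Qed.

(** The difference quotient is bounded near [a], so its integral over a square
    centred at [a] tends to zero with the size of the square, while by [annulus] it
    does not depend on that size. *)
Lemma cauchy_vanish f r a : in_open_square r a ->
  (forall z, inrect (- r) r (- r) r z -> derivable f z 1) ->
  square_int r (fun z => (f z - f a) * (z - a)^-1) = 0.
Proof.
move=> ia df.
have [d d0 hd] := small_square ia.
have ra : inrect (- r) r (- r) r a.
  by move: ia; rewrite /in_open_square !ltr_norml => -[/andP[? ?] /andP[? ?]]; split; lra.
have [D /(_ 1 ltr01)[del del0 hdel]] := derivable_nrmP (df a ra).
have dq z : inrect (- r) r (- r) r z -> z != a ->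
    derivable (fun z => (f z - f a) * (z - a)^-1) z 1.
  move=> /df dz za; apply: derivable_mul; first exact: derivable_subc.
  exact: derivable_inv_sub.
apply: nrm_eps0 => e e0.
have K0 : 0 < 16 * (nrm D + 1) by rewrite mulr_gt0// ltr_wpDl// nrm_ge0.
pose s := Num.min (Num.min (d / 2) (del / 3)) (e / (16 * (nrm D + 1))).
have s0 : 0 < s by rewrite !lt_min !divr_gt0.
have [s1 s2 s3] : [/\ s <= d / 2, s <= del / 3 & s <= e / (16 * (nrm D + 1))].
  by split; rewrite !ge_min lexx ?orbT.
have hs := hd s s0 ltac:(lra).
rewrite (square_int_shrink s0 hs dq).
have [h1 h2 h3 h4] := hs.
have sub z : bdry (complex.Re a - s) (complex.Re a + s)
    (complex.Im a - s) (complex.Im a + s) z -> inrect (- r) r (- r) r z /\ z != a.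
  move=> hz; split.
    by have [|| /andP[? ?] /andP[? ?]] := bdry_inrect _ _ hz; try lra; split; lra.
  have /andP[+ _] := bdry_sq_far (ltW s0) hz.
  by apply: contraTneq => ->; rewrite subrr nrm0 -ltNge.
apply: le_trans (@rectint_bound _ _ _ _ _ _ (nrm D + 1) _ _ _ _) _; try lra.
- by apply: rcont_bdry => z /sub[hz za]; apply: derivable_cont_at; exact: dq.
- move=> z hz; have [_ za] := sub _ hz.
  have /andP[_ zs] := bdry_sq_far (ltW s0) hz.
  have n0 : 0 < nrm (z - a) by rewrite nrm_gt0// subr_eq0.
  rewrite nrmM nrmV ler_pdivrMr//.
  have := hdel z ltac:(lra); have := nrm_subr (f z - f a) (D * (z - a)).
  by rewrite nrmM; lra.
- have : s * (16 * (nrm D + 1)) <= e by rewrite -ler_pdivlMr.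
  by lra.
Qed.

(** On each side, [(z - a)^-1] has in the relevant real direction a component of
    constant sign and of size at least [(2 * s)^-1], so that each of the four sides
    contributes at least 1 to the imaginary part. *)
Lemma winding_ge a (s : R) : 0 < s -> 4 <= complex.Im (rectint (fun z => (z - a)^-1)
  (complex.Re a - s) (complex.Re a + s) (complex.Im a - s) (complex.Im a + s)).
Proof.
move=> s0; set x0 := _ - s; set x1 := _ + s; set y0 := _ - s; set y1 := _ + s.
have C z : bdry x0 x1 y0 y1 z -> cont_at (fun z => (z - a)^-1) z.
  move=> /(bdry_sq_far (ltW s0))/andP[h _]; apply: derivable_cont_at.
  apply: derivable_inv_sub; apply: contraTneq h => ->.
  by rewrite subrr nrm0 -ltNge.
have [/hcontP[_ c1] /hcontP[_ c2] /vcontP[c3 _] /vcontP[c4 _]] := rcont_bdry C.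
have key (t : R) : `|t| <= s -> (2 * s)^-1 <= s / (s ^+ 2 + t ^+ 2).
  move=> ht; have t2 : t ^+ 2 <= s ^+ 2.
    by rewrite -real_normK ?num_real// lerXn2r// nnegrE ltW.
  have s20 : 0 < s ^+ 2 by rewrite exprn_gt0.
  have t20 : 0 <= t ^+ 2 by rewrite sqr_ge0.
  rewrite ler_pdivlMr; last by lra.
  rewrite mulrC ler_pdivrMr; last by lra.
  by rewrite (_ : s * (2 * s) = s ^+ 2 + s ^+ 2); [lra|ring].
have invE (x y : R) : (x +i* y)^-1 = (x / (x ^+ 2 + y ^+ 2)) -i* (y / (x ^+ 2 + y ^+ 2)).
  by [].
have subE (x y : R) : x +i* y - a = (x - complex.Re a) +i* (y - complex.Im a).
  by case: (a).
have E2s : (2 * s)^-1 * (s + s) = 1.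
  by rewrite (_ : s + s = 2 * s); [rewrite mulVf// gt_eqF// mulr_gt0|ring].
have lx : x1 - x0 = s + s by rewrite /x1 /x0; ring.
have ly : y1 - y0 = s + s by rewrite /y1 /y0; ring.
have [ex1 ex0] : x1 - complex.Re a = s /\ x0 - complex.Re a = - s.
  by rewrite /x1 /x0; split; ring.
have [ey1 ey0] : y1 - complex.Im a = s /\ y0 - complex.Im a = - s.
  by rewrite /y1 /y0; split; ring.
have tx t : x0 <= t <= x1 -> `|t - complex.Re a| <= s.
  by rewrite ler_norml => /andP[? ?]; apply/andP; split; lra.
have ty t : y0 <= t <= y1 -> `|t - complex.Im a| <= s.
  by rewrite ler_norml => /andP[? ?]; apply/andP; split; lra.
have ? : x0 <= x1 by lra.
have ? : y0 <= y1 by lra.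
have I1 : 1 <= complex.Im (hint (fun z => (z - a)^-1) y0 x0 x1).
  rewrite -E2s -lx; apply: Rint_ge => // t /tx/key.
  by rewrite subE ey0 invE /= mulNr opprK sqrrN (addrC (s ^+ 2)).
have I2 : complex.Im (hint (fun z => (z - a)^-1) y1 x0 x1) <= - 1.
  rewrite -E2s -lx -mulNr; apply: Rint_le => // t /tx/key.
  by rewrite subE ey1 invE /= lerN2 (addrC (s ^+ 2)).
have I3 : 1 <= complex.Re (vint (fun z => (z - a)^-1) x1 y0 y1).
  rewrite -E2s -ly; apply: Rint_ge => // t /ty/key.
  by rewrite subE ex1 invE.
have I4 : complex.Re (vint (fun z => (z - a)^-1) x0 y0 y1) <= - 1.
  rewrite -E2s -ly -mulNr; apply: Rint_le => // t /ty/key.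
  by rewrite subE ex0 invE /= mulNr lerN2 sqrrN.
rewrite /rectint cImD cImB cImM cReB; move: I1 I2 I3 I4.
rewrite [complex.Re 'i%C]/= [complex.Im 'i%C]/= mul0r mul1r add0r.
by move: (complex.Im _) (complex.Im _) (complex.Re _) (complex.Re _) => *; lra.
Qed.

Lemma derivable_cauchy_kernel f n a z : derivable f z 1 -> z != 0 -> z != a ->
  derivable (fun w => f w * w^-1 ^+ n * (w - a)^-1) z 1.
Proof.
move=> df z0 za; have d1 := derivable_mul df (derivable_invX (n := n) z0).
exact (derivable_mul d1 (derivable_inv_sub za)).
Qed.

Lemma rcont_inv (r : R) a : 0 <= r -> in_open_square r a ->
  rcont (fun z => (z - a)^-1) (- r) r (- r) r.
Proof.
move=> r0 ia; apply: rcont_bdry => z hz; apply: derivable_cont_at.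
by apply: derivable_inv_sub; exact: bdry0_neq hz ia.
Qed.

(** The difference of the two kernels decays like [nrm z ^- 2]; its integral does
    not change when the square is enlarged, hence it vanishes. *)
Lemma winding_const (r : R) a b : 0 < r -> in_open_square r a -> in_open_square r b ->
  square_int r (fun z => (z - a)^-1) = square_int r (fun z => (z - b)^-1).
Proof.
move=> r0 ia ib.
pose h z := (z - a)^-1 + (- 1) * (z - b)^-1.
suff : square_int r h = 0.
  have cb := rcont_inv (ltW r0) ib.
  rewrite /square_int rectintD; last 2 first.
  - exact: rcont_inv (ltW r0) ia.
  - apply: rcont_bdry => z hz; apply: derivable_cont_at.
    apply: derivable_mul; first exact: derivable_cst.
    by apply: derivable_inv_sub; exact: bdry0_neq hz ib.
  rewrite rectintZ// mulN1r => /eqP; rewrite subr_eq0 => /eqP; exact.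
apply: nrm_eps0 => e e0.
pose K := nrm (b - a).
(* [T] is large enough for the square of half side [T] to be far from [a] and
   [b] and for the final bound to be at most [e] *)
have [T TE] : exists T, T = r + 2 * nrm a + 2 * nrm b + 64 * K / e by eexists.
have K0 : 0 <= K by exact: nrm_ge0.
have := nrm_ge0 a; have := nrm_ge0 b => b0 a0.
have Ke : 0 <= 64 * K / e by rewrite divr_ge0 ?mulr_ge0// ltW.
have T0 : 0 < T by lra.
have rT : r <= T by lra.
have dh z : z != a -> z != b -> derivable h z 1.
  move=> za zb; apply: derivableD; first exact: derivable_inv_sub.
  apply: derivable_mul; first exact: derivable_cst.
  exact: derivable_inv_sub.
have ann c z : in_open_square r c -> ~ (- r < complex.Re z < r /\ - r < complex.Im z < r) -> z != c.
  move=> ic; apply: contra_notN => /eqP ->.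
  by move: ic; rewrite /in_open_square !ltr_norml => -[/andP[? ?] /andP[? ?]]; lra.
have -> : square_int r h = square_int T h.
  apply/esym; apply: annulus; try lra.
  by move=> z _ nz; apply: dh; apply: ann nz.
have far z : bdry (- T) T (- T) T z -> [/\ T / 2 <= nrm (z - a), T / 2 <= nrm (z - b),
    z != a & z != b].
  move=> /(bdry0_far (ltW T0))/andP[zT _].
  have [h1 h2] : T / 2 <= nrm (z - a) /\ T / 2 <= nrm (z - b).
    have := nrm_subr z a; have := nrm_subr z b; by move: zT => ? ? ?; split; lra.
  split => //.
    by apply: contraTneq h1 => ->; rewrite subrr nrm0 -ltNge divr_gt0.
  by apply: contraTneq h2 => ->; rewrite subrr nrm0 -ltNge divr_gt0.
apply: le_trans (@rectint_bound _ _ _ _ _ _ (K * (4 / T ^+ 2)) _ _ _ _) _; try lra.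
- by apply: rcont_bdry => z /far[_ _ za zb]; apply: derivable_cont_at; exact: dh.
- move=> z /far[ha hb za zb].
  have -> : h z = - (b - a) * ((z - a)^-1 * (z - b)^-1).
    rewrite /h; have : z - a != 0 by rewrite subr_eq0.
    have : z - b != 0 by rewrite subr_eq0.
    by move=> ? ?; field; apply/andP.
  rewrite nrmM nrmN nrmM !nrmV ler_wpM2l//.
  have T2 : 0 < T / 2 by rewrite divr_gt0.
  apply: le_trans (_ : _ <= (T / 2)^-1 * (T / 2)^-1) _.
    by apply: ler_pM; rewrite ?invr_ge0 ?nrm_ge0// lef_pV2// posrE; lra.
  by rewrite le_eqVlt; apply/orP; left; apply/eqP; field; rewrite gt_eqF.
- rewrite (_ : 4 * _ * _ = 64 * K / T); last by field; rewrite gt_eqF.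
  by rewrite ler_pdivrMr// (mulrC e) -ler_pdivrMr//; lra.
Qed.

(** The value is [2 * pi * i]; [wind_ge] keeps of it what division requires, that it
    is not zero. *)
Definition wind (r : R) := square_int r (fun z => z^-1).

Lemma wind_center (r : R) a : 0 < r -> in_open_square r a ->
  square_int r (fun z => (z - a)^-1) = wind r.
Proof.
move=> r0 ia; rewrite (winding_const r0 ia (_ : in_open_square r 0)); last first.
  by rewrite /in_open_square /= normr0.
by apply: eq_rectint => z _; rewrite subr0.
Qed.

Lemma wind_ge (r : R) : 0 < r -> 4 <= nrm (wind r).
Proof.
move=> r0; have i0 : in_open_square r 0 by rewrite /in_open_square /= normr0.
rewrite -(wind_center r0 i0); have h := winding_ge 0 r0.
rewrite [complex.Re 0]/= [complex.Im 0]/= !sub0r !add0r in h.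
exact: le_trans h (le_trans (ler_norm _) (nrm_Im _)).
Qed.

Lemma cauchy_formula f r a : 0 < r -> in_open_square r a ->
  (forall z, inrect (- r) r (- r) r z -> derivable f z 1) ->
  square_int r (fun z => f z * (z - a)^-1) = f a * wind r.
Proof.
move=> r0 ia df; rewrite -(wind_center r0 ia).
have dz z : bdry (- r) r (- r) r z -> derivable f z 1.
  by move=> /(bdry0_inrect (ltW r0))/df.
have := cauchy_vanish ia df.
rewrite /square_int -(rectintZ _ (rcont_inv (ltW r0) ia)) => h.
rewrite -[RHS]add0r -h -rectintD.
- by apply: eq_rectint => z _; ring.
- apply: rcont_bdry => z hz; apply: derivable_cont_at.
  apply: derivable_mul; first by apply: derivable_subc; exact: dz.
  by apply: derivable_inv_sub; exact: bdry0_neq hz ia.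
- apply: rcont_bdry => z hz; apply: derivable_cont_at.
  apply: derivable_mul; first exact: derivable_cst.
  by apply: derivable_inv_sub; exact: bdry0_neq hz ia.
Qed.

(** The kernel [(z - a)^-1] is expanded into a finite geometric sum; the remainder
    is again a Cauchy integral, estimated by [rectint_bound]. The radius [2 * r] is
    that of a disc containing the square of half side [r]. *)
Theorem taylor f (r M : R) : 0 < r ->
  (forall z, nrm z <= 2 * r -> derivable f z 1) ->
  (forall z, nrm z <= 2 * r -> nrm (f z) <= M) ->
  exists2 c : nat -> R[i], forall n, nrm (c n) <= 8 * M / r ^+ n &
    forall T z, nrm z <= r / 2 ->
      nrm (f z - \sum_(n < T) c n * z ^+ n) <= 8 * M * (nrm z / r) ^+ T.
Proof.
move=> r0 df fM.
have r2 z : inrect (- r) r (- r) r z -> nrm z <= 2 * r.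
  move=> [/andP[? ?] /andP[? ?]]; apply: le_trans (nrm_le_ReIm _) _.
  rewrite (_ : 2 * r = r + r); last by ring.
  by apply: lerD; rewrite ler_norml; apply/andP; split; lra.
have bd z : bdry (- r) r (- r) r z -> [/\ derivable f z 1, nrm (f z) <= M, z != 0 & r <= nrm z].
  move=> hz; have /r2 h := bdry0_inrect (ltW r0) hz.
  have /andP[h1 _] := bdry0_far (ltW r0) hz.
  split; [exact: df|exact: fM| |by []].
  by apply: contraTneq h1 => ->; rewrite nrm0 -ltNge.
have M0 : 0 <= M by apply: le_trans (fM 0 _); rewrite ?nrm_ge0// nrm0 mulr_ge0// ltW.
set w := wind r.
have w4 : 4 <= nrm w by exact: wind_ge.
have w0 : w != 0 by apply: contraTneq w4 => ->; rewrite nrm0 -ltNge.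
have wV : nrm w^-1 <= 4^-1 by rewrite nrmV lef_pV2// posrE ?nrm_gt0//.
pose c n := w^-1 * square_int r (fun z => f z * z^-1 ^+ n.+1).
(* the remainder of order [T] is [a ^+ T * Rm T a] *)
pose Rm T a := w^-1 * square_int r (fun z => f z * z^-1 ^+ T * (z - a)^-1).
have cc n : rcont (fun z => f z * z^-1 ^+ n.+1) (- r) r (- r) r.
  apply: rcont_bdry => z /bd[dz _ z0 _]; apply: derivable_cont_at.
  exact (derivable_mul dz (derivable_invX z0)).
have ck n a : in_open_square r a -> rcont (fun z => f z * z^-1 ^+ n * (z - a)^-1) (- r) r (- r) r.
  move=> ia; apply: rcont_bdry => z hz; have [dz _ z0 _] := bd _ hz.
  apply: derivable_cont_at; apply: derivable_cauchy_kernel => //.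
  exact: bdry0_neq hz ia.
have RmS T a : in_open_square r a -> Rm T a = c T + a * Rm T.+1 a.
  move=> ia; rewrite /Rm /c mulrCA -mulrDr; congr (_ * _).
  rewrite /square_int -(rectintZ _ (ck T.+1 a ia)) -rectintD//; last first.
    apply: rcont_bdry => z hz; have [dz _ z0 _] := bd _ hz; apply: derivable_cont_at.
    apply: derivable_mul; first exact: derivable_cst.
    by apply: derivable_cauchy_kernel => //; exact: bdry0_neq hz ia.
  apply: eq_rectint => z hz; have [_ _ z0 _] := bd _ hz.
  have za : z - a != 0 by rewrite subr_eq0; exact: bdry0_neq hz ia.
  by rewrite exprS; set q := z^-1 ^+ T; field; apply/andP.
have inn z : nrm z <= r / 2 -> in_open_square r z.
  by move=> h; split; [apply: le_lt_trans (nrm_Re _) _|apply: le_lt_trans (nrm_Im _) _]; lra.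
exists c.
  move=> n; rewrite /c nrmM.
  have h : nrm (square_int r (fun z => f z * z^-1 ^+ n.+1)) <= 16 * M / r ^+ n.
    apply: le_trans (@rectint_bound _ _ _ _ _ _ (M / r ^+ n.+1) _ _ (cc n) _) _; try lra.
      move=> z /bd[_ zM z0 rz]; rewrite nrmM ler_pM ?nrm_ge0//.
      rewrite exprVn nrmV nrmX lef_pV2 ?posrE ?exprn_gt0 ?nrm_gt0//.
      by rewrite lerXn2r ?nnegrE ?nrm_ge0// ltW.
    rewrite exprS le_eqVlt; apply/orP; left; apply/eqP.
    by field; rewrite expf_eq0 gt_eqF// andbF.
  have rn : 0 <= M / r ^+ n by rewrite divr_ge0// exprn_ge0// ltW.
  apply: le_trans (ler_pM (nrm_ge0 _) (nrm_ge0 _) wV h) _; lra.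
move=> T z hz; have iz := inn z hz.
have -> : f z - \sum_(n < T) c n * z ^+ n = z ^+ T * Rm T z.
  elim: T => [|T IH].
    rewrite big_ord0 subr0 expr0 mul1r /Rm.
    rewrite (_ : square_int r _ = square_int r (fun y => f y * (y - z)^-1)); last first.
      by apply: eq_rectint => y _; rewrite expr0 mulr1.
    rewrite cauchy_formula// => [|y /r2/df//].
    by rewrite mulrCA mulVf ?mulr1.
  by rewrite big_ord_recr /= opprD addrA IH RmS// exprS; ring.
rewrite nrmM nrmX expr_div_n.
rewrite (_ : _ * (_ / _) = nrm z ^+ T * (8 * M / r ^+ T)); last by ring.
rewrite ler_wpM2l ?exprn_ge0 ?nrm_ge0//.
rewrite /Rm nrmM.
have h : nrm (square_int r (fun y => f y * y^-1 ^+ T * (y - z)^-1)) <= 32 * M / r ^+ T.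
  apply: le_trans (@rectint_bound _ _ _ _ _ _ (M / r ^+ T * (2 / r)) _ _ (ck T z iz) _) _; try lra.
    move=> y /bd[_ yM y0 ry]; rewrite !nrmM; apply: ler_pM; rewrite ?mulr_ge0 ?nrm_ge0//.
      rewrite ler_pM ?nrm_ge0//.
      rewrite exprVn nrmV nrmX lef_pV2 ?posrE ?exprn_gt0 ?nrm_gt0//.
      by rewrite lerXn2r ?nnegrE ?nrm_ge0// ltW.
    have hh : r / 2 <= nrm (y - z) by have := nrm_subr y z; lra.
    have r20 : 0 < r / 2 by rewrite divr_gt0.
    rewrite nrmV -(invf_div r 2) lef_pV2// posrE; lra.
  rewrite le_eqVlt; apply/orP; left; apply/eqP.
  by field; rewrite expf_eq0 gt_eqF// andbF.
have rn : 0 <= M / r ^+ T by rewrite divr_ge0// exprn_ge0// ltW.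
apply: le_trans (ler_pM (nrm_ge0 _) (nrm_ge0 _) wV h) _; lra.
Qed.

End Cauchy.

(** * Vanishing of coefficients of small polynomials *)

Section PowerSeries.
Context {R : realType}.
Implicit Types (f g : R[i] -> R[i]) (a b z s : R[i]).

(** The constant coefficient is [O(x)], hence zero; then the polynomial can be
    divided by [x]. *)
Lemma small_poly_coef0 (S T : nat) (d : nat -> R[i]) (K rho : R) : 0 < rho ->
  (forall x : R, 0 < x -> x <= rho -> nrm (\sum_(n < S) d n * x%:C ^+ n) <= K * x ^+ T) ->
  forall n, (n < S)%N -> (n < T)%N -> d n = 0.
Proof.
move=> rho0; elim: S T d => [//|S IH] [//|T] d H.
have d0 : d 0%N = 0.
  pose B : R := `|K| + \sum_(n < S) nrm (d n.+1).
  have B0 : 0 <= B by rewrite addr_ge0 ?normr_ge0 ?sumr_ge0// => ? _; exact: nrm_ge0.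
  have main x : 0 < x -> x <= rho -> x <= 1 -> nrm (d 0%N) <= B * x.
    move=> x0 xr x1; have := H x x0 xr.
    rewrite big_ord_recl expr0 mulr1; set s := \sum_(_ < _) _ => h.
    have hs : nrm s <= (\sum_(n < S) nrm (d n.+1)) * x.
      rewrite mulr_suml; apply: le_trans (nrm_sum _ _ _) _; apply: ler_sum => n _.
      rewrite nrmM nrmX nrmC gtr0_norm// ler_wpM2l ?nrm_ge0//.
      by rewrite exprS ler_piMr ?(ltW x0)// exprn_ile1// ltW.
    have hK : K * x ^+ T.+1 <= `|K| * x.
      apply: le_trans (_ : _ <= `|K| * x ^+ T.+1) _.
        by rewrite ler_wpM2r ?ler_norm// exprn_ge0// ltW.
      by rewrite ler_wpM2l// exprS ler_piMr ?(ltW x0)// exprn_ile1// ltW.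
    have := nrm_subr (d 0%N) (d 0%N + s); rewrite opprD addrA subrr add0r nrmN.
    by rewrite mulrDl; lra.
  apply: nrm_eps0 => e e0.
  pose x := Num.min (Num.min rho 1) (e / (B + 1)).
  have B1 : 0 < B + 1 by lra.
  have x0 : 0 < x by rewrite !lt_min rho0 ltr01 divr_gt0.
  have [x1 x2 x3] : [/\ x <= rho, x <= 1 & x <= e / (B + 1)].
    by split; rewrite !ge_min lexx ?orbT.
  apply: le_trans (main x x0 x1 x2) _.
  have : x * (B + 1) <= e by rewrite -ler_pdivlMr.
  by lra.
case=> [//|n]; rewrite !ltnS; apply: (IH T (fun n => d n.+1)) => x x0 xr.
have := H x x0 xr; rewrite big_ord_recl d0 mul0r add0r.
have -> : \sum_(n0 < S) d (lift ord0 n0) * x%:C ^+ lift ord0 n0 =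
    x%:C * \sum_(n0 < S) d n0.+1 * x%:C ^+ n0.
  by rewrite mulr_sumr; apply: eq_bigr => j _; rewrite lift0 exprS; ring.
by rewrite nrmM nrmC gtr0_norm// exprS mulrCA ler_pM2l.
Qed.

Lemma sum_antidiag (A : nmodType) (T d : nat) (F : nat -> nat -> A) : (d < T)%N ->
  \sum_(n < T) \sum_(m < T | (n + m == d)%N) F n m = \sum_(n < d.+1) F n (d - n)%N.
Proof.
move=> dT; rewrite (big_ord_widen T (fun n => F n (d - n)%N))// [RHS]big_mkcond /=.
apply: eq_bigr => n _; case: ltnP; rewrite ?ltnS => h.
  have hd : (d - n < T)%N by apply: leq_ltn_trans dT; rewrite leq_subr.
  rewrite (big_pred1 (Ordinal hd))// => m /=; rewrite -val_eqE /=.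
  by apply/eqP/eqP => [<-|->]; rewrite ?addKn ?subnKC.
rewrite big_pred0// => m; apply/negbTE; apply: contraTneq h => <-.
by rewrite -ltnNge ltnS leq_addr.
Qed.

(** Along the ray through a point [u] the sum is a polynomial in one real variable,
    so each of its homogeneous components of degree less than [T] vanishes at [u].
    Up to the factor [Num.conj u ^+ d], the component of degree [d] is a polynomial
    in [u / Num.conj u], which has infinitely many values. *)
Lemma hermitian_coef0 (T : nat) (del : nat -> nat -> R[i]) (K rho : R) : 0 < rho ->
  (forall s, nrm s <= rho -> nrm (\sum_(n < T) \sum_(m < T)
     del n m * s ^+ n * Num.conj s ^+ m) <= K * nrm s ^+ T) ->
  forall n m, (n + m < T)%N -> del n m = 0.
Proof.
move=> rho0 H.
(* the homogeneous component of degree [d] vanishes at each [u] *)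
have P0 d u : (d < T)%N -> u != 0 ->
    \sum_(n < d.+1) del n (d - n)%N * u ^+ n * Num.conj u ^+ (d - n) = 0.
  move=> dT u0; rewrite -(sum_antidiag (fun n m => del n m * u ^+ n * Num.conj u ^+ m) dT).
  have nu : 0 < nrm u by exact: nrm_gt0.
  have := @small_poly_coef0 (T + T) T (fun d => \sum_(n < T) \sum_(m < T | (n + m == d)%N)
     del n m * u ^+ n * Num.conj u ^+ m) (K * nrm u ^+ T) (rho / nrm u).
  apply => //; [exact: divr_gt0| |by rewrite ltn_addr].
  move=> x x0 xr.
  have := H (x%:C * u); rewrite nrmM nrmC gtr0_norm// -ler_pdivlMr// => /(_ xr).
  rewrite (_ : K * _ = K * nrm u ^+ T * x ^+ T); last by rewrite exprMn; ring.
  congr (nrm _ <= _).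
  under [RHS]eq_bigr => e _ do rewrite mulr_suml.
  rewrite [RHS]exchange_big /=; apply: eq_bigr => n _.
  under [RHS]eq_bigr => e _ do rewrite big_mkcond mulr_suml.
  rewrite [RHS]exchange_big /=; apply: eq_bigr => m _.
  have hnm : (n + m < T + T)%N by rewrite -addnS leq_add// ltnW.
  rewrite (bigD1 (Ordinal hnm))//= eqxx big1 ?addr0.
    rewrite rmorphM /= !exprMn (_ : Num.conj x%:C = x%:C); first by rewrite exprD; ring.
    by apply: conj_Creal; rewrite complex_real.
  move=> j; rewrite -val_eqE /= eq_sym => /negbTE ->; rewrite mul0r //.
have Q0 d n : (d < T)%N -> (n <= d)%N -> del n (d - n)%N = 0.
  move=> dT nd; pose p := \poly_(n < d.+1) del n (d - n)%N.
  suff p0 : p = 0 by have := coef_poly d.+1 (fun n => del n (d - n)%N) n;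
    rewrite ltnS nd -/p p0 coef0.
  apply/eqP/negPn/negP => pn0.
  (* the quotients [u k / Num.conj (u k)] are pairwise distinct roots of [p] *)
  pose u (k : nat) : R[i] := 1 + 'i%R * k%:R.
  have cu k : Num.conj (u k) = 1 - 'i%R * k%:R.
    by rewrite /u rmorphD rmorphM /= conjCi rmorph_nat rmorph1 mulNr.
  have uk2 k : u k + Num.conj (u k) = 2 by rewrite cu /u; ring.
  have u0 k : u k != 0.
    apply/eqP => uk; have := uk2 k; rewrite uk conjC0 addr0 => /eqP.
    by rewrite eq_sym pnatr_eq0.
  have cu0 k : Num.conj (u k) != 0 by rewrite conjC_eq0.
  pose v k := u k / Num.conj (u k).
  suff [h1 h2] : all (root p) (map v (iota 0 d.+1)) /\ uniq (map v (iota 0 d.+1)).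
    have := max_poly_roots pn0 h1 h2; rewrite size_map size_iota.
    by rewrite ltnNge size_poly.
  split.
  - apply/allP => _ /mapP[k _ ->]; rewrite /root horner_poly; apply/eqP.
    apply: (mulfI (expf_neq0 d (cu0 k))); rewrite mulr0 -[RHS](P0 d (u k) dT (u0 k)).
    rewrite mulr_sumr; apply: eq_bigr => -[j /=]; rewrite ltnS => jd _.
    rewrite -[in Num.conj (u k) ^+ d](subnK jd) exprD /v expr_div_n.
    by field; rewrite expf_neq0.
  - rewrite map_inj_uniq ?iota_uniq// => k l /eqP; rewrite /v eqr_div// !cu /u.
    rewrite -subr_eq0 (_ : _ - _ = 'i%R * 2 * (k%:R - l%:R)); last by ring.
    have i0 : ('i%R : R[i]) != 0 by exact: neq0Ci.
    rewrite !mulf_eq0 (negbTE i0) pnatr_eq0 /= subr_eq0 eqr_nat => /eqP; exact.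
by move=> n m nm; have := Q0 _ n nm (leq_addr _ _); rewrite addKn.
Qed.

End PowerSeries.

(** * Bounded holomorphic functions *)

Section OneVariable.
Context {R : realType}.
Implicit Types (f : R[i] -> R[i]) (s z : R[i]).

(** The partial sums of the two expansions differ by [O(nrm z ^+ n.+1)] at each
    order. *)
Lemma coef_unique (c c' : nat -> R[i]) f (K K' q q' r : R) : 0 < r ->
  (forall T z, nrm z <= r -> nrm (f z - \sum_(n < T) c n * z ^+ n) <= K * (nrm z / q) ^+ T) ->
  (forall T z, nrm z <= r -> nrm (f z - \sum_(n < T) c' n * z ^+ n) <= K' * (nrm z / q') ^+ T) ->
  c =1 c'.
Proof.
move=> r0 h h' n; apply/eqP; rewrite -subr_eq0; apply/eqP.
apply: (@small_poly_coef0 R n.+1 n.+1 (fun n => c n - c' n)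
  (K / q ^+ n.+1 + K' / q' ^+ n.+1) r) => //.
move=> x x0 xr; have nx : nrm x%:C = x by rewrite nrmC gtr0_norm.
have := h n.+1 x%:C; have := h' n.+1 x%:C.
rewrite nx !expr_div_n => /(_ xr) k' /(_ xr) k.
under eq_bigr => j _ do rewrite mulrBl.
rewrite big_split /= sumrN; set A := \sum_(_ < _) _; set B := \sum_(_ < _) _.
have -> : A - B = (f x%:C - B) - (f x%:C - A) by ring.
apply: le_trans (nrmB _ _) _; rewrite mulrDl addrC.
by apply: lerD; rewrite mulrAC -mulrA.
Qed.

(** A quantitative identity theorem. The Taylor coefficients of [f] on the large
    disc are also those on the disc of radius [tau], where Cauchy's estimates make
    them small; the remainder at [1] is controlled by [M] alone. *)
Lemma small_on_disc (M e tau : R) : 0 < e -> 0 < tau -> exists2 eta : R, 0 < eta &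
  forall f, (forall s, nrm s <= 4 -> derivable f s 1 /\ nrm (f s) <= M) ->
    (forall s, nrm s <= 4 -> nrm s <= tau -> nrm (f s) <= eta) -> nrm (f 1) <= e.
Proof.
move=> e0 tau0.
wlog tau1 : tau tau0 / tau <= 1.
  move=> W; have [|tau1] := leP tau 1; first exact: W.
  have [eta eta0 h] := W 1 ltr01 (lexx _); exists eta => // f fM fs; apply: h => // s s4 s1.
  by apply: fs => //; apply: le_trans s1 (ltW tau1).
have e20 : 0 < e / 2 by rewrite divr_gt0.
have [T hT] := half_pow_lt (8 * `|M|) e20.
pose r := tau / 2; have r0 : 0 < r by rewrite divr_gt0.
pose A : R := \sum_(n < T) 8 / r ^+ n.
have A0 : 0 <= A by apply: sumr_ge0 => n _; rewrite divr_ge0// exprn_ge0// ltW.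
exists (e / 2 / (A + 1)); first by rewrite !divr_gt0// ltr_wpDl.
set eta := e / 2 / (A + 1) => f fM fs.
have eta0 : 0 < eta by rewrite !divr_gt0// ltr_wpDl.
have e4 : 2 * 2 = 4 :> R by rewrite -natrM.
have M0 : 0 <= M by have [_ h] := fM 0 ltac:(rewrite nrm0; lra); apply: le_trans h; exact: nrm_ge0.
have [||c _ hc] := @taylor R f 2 M (ltr0Sn R 1).
- by move=> z; rewrite e4 => /fM[].
- by move=> z; rewrite e4 => /fM[].
have tr : 2 * r = tau by rewrite /r; field.
have [z|z|c' bc' hc'] := @taylor R f r eta r0.
- by rewrite tr => h; have [] := fM z ltac:(lra).
- by rewrite tr => h; apply: fs => //; lra.
have cc' : c =1 c'.
  apply: (@coef_unique _ _ f (8 * M) (8 * eta) 2 r (r / 2)) => //.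
    by rewrite divr_gt0.
  by move=> U z zr; apply: hc; rewrite divff//; rewrite /r in zr; lra.
have := hc T 1; rewrite nrm1 divff// => /(_ (lexx _)) h1.
have h2 : nrm (\sum_(n < T) c n * 1 ^+ n) <= e / 2.
  apply: le_trans (nrm_sum _ _ _) _.
  apply: le_trans (_ : _ <= eta * A) _.
    rewrite mulr_sumr; apply: ler_sum => n _; rewrite expr1n mulr1 cc'.
    by apply: le_trans (bc' n) _; rewrite mulrAC [8 / _ * _]mulrC.
  have : eta * (A + 1) = e / 2 by rewrite /eta; field; rewrite gt_eqF// ltr_wpDl.
  by lra.
have h3 : 8 * M * (1 / 2) ^+ T < e / 2.
  by rewrite mul1r exprVn; rewrite ger0_norm in hT.
have := nrm_subr (f 1) (\sum_(n < T) c n * 1 ^+ n); lra.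
Qed.

End OneVariable.

Section SeveralVariables.
Context {R : realType} {V : normedModType R[i]}.
Implicit Types (F : V -> R[i]) (x y z v w : V).

Lemma derivable_slice F x v s : differentiable F (x + s *: v) ->
  derivable (fun t : R[i] => F (x + t *: v)) s 1.
Proof.
move=> dF; apply/derivable1_diffP.
have da : differentiable (fun t : R[i] => x + t *: v) s.
  by apply: differentiableD; [exact: differentiable_cst|exact: differentiableZl].
exact: (differentiable_comp da dF).
Qed.

Definition bounded_holo F x (r M : R) := forall y, nrm (y - x) < r ->
  differentiable F y /\ nrm (F y) <= M.

(** This is [small_on_disc] on the complex line through [x] and [w], with [w] at the
    parameter [1]. The radius [r / 16] keeps the points with parameters of modulus
    at most 4 in the ball where [F] is controlled. It does not depend on [del],
    which allows the propagation in [small_propagates]. *)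
Lemma slice_small (M e r del : R) : 0 < e -> 0 < r -> 0 < del ->
  exists2 eta : R, 0 < eta & forall F z, bounded_holo F z r M ->
    forall x, nrm (x - z) < r / 16 ->
    (forall y, nrm (y - z) < r -> nrm (y - x) < del -> nrm (F y) <= eta) ->
    forall w, nrm (w - z) < r / 16 -> nrm (F w) <= e.
Proof.
move=> e0 r0 del0; have t0 : 0 < del / r by rewrite divr_gt0.
have [eta eta0 h] := small_on_disc M e0 t0; exists eta => // F z FM x xz Fs w wz.
pose f (s : R[i]) := F (x + s *: (w - x)).
have -> : F w = f 1 by rewrite /f scale1r addrC subrK.
have wx : nrm (w - x) < r / 8 by have := nrm_tri z w x; rewrite (nrmBC z x); lra.
have inb (s : R[i]) : nrm s <= 4 -> nrm (x + s *: (w - x) - z) < r.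
  move=> s4; rewrite addrAC; apply: le_lt_trans (nrmD _ _) _; rewrite nrmZ.
  have : nrm s * nrm (w - x) <= 4 * nrm (w - x) by rewrite ler_wpM2r// nrm_ge0.
  by lra.
apply: h => [s s4|s s4 st].
  by have [d b] := FM _ (inb s s4); split=> //; exact: derivable_slice.
apply: Fs; first exact: inb.
rewrite addrAC subrr add0r nrmZ.
apply: le_lt_trans (_ : _ <= (del / r) * nrm (w - x)) _.
  by rewrite ler_wpM2r// nrm_ge0.
rewrite mulrAC ltr_pdivrMr// ltr_pM2l//; lra.
Qed.

(** Cauchy's estimate on the complex line through [x] and [y]: the constant depends
    on [F] only through its bound [M]. Points far apart are handled by the bound
    itself. *)
Lemma bounded_holo_lipschitz F z (r M : R) : 0 < r -> bounded_holo F z r M ->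
  forall x y, nrm (x - z) < r / 2 -> nrm (y - z) < r / 2 ->
  nrm (F y - F x) <= 40 * M / r * nrm (y - x).
Proof.
move=> r0 FM x y xz yz.
have M0 : 0 <= M by have [_ h] := FM x ltac:(lra); apply: le_trans h; exact: nrm_ge0.
have [->|xy] := eqVneq y x; first by rewrite !subrr !nrm0 mulr0.
have v0 : 0 < nrm (y - x) by rewrite nrm_gt0// subr_eq0.
have [big|small] := leP (r / 10) (nrm (y - x)).
  have [_ h1] := FM x ltac:(lra); have [_ h2] := FM y ltac:(lra).
  apply: le_trans (nrmB _ _) _; apply: le_trans (lerD h2 h1) _.
  apply: le_trans (_ : _ <= 40 * M / r * (r / 10)) _.
    by rewrite (_ : _ * (_ / _) = 4 * M); [lra|field; rewrite gt_eqF].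
  by rewrite ler_wpM2l// divr_ge0 ?mulr_ge0// ltW.
pose f (s : R[i]) := F (x + s *: (y - x)).
pose rho := r / (5 * nrm (y - x)).
have rho0 : 0 < rho by rewrite divr_gt0// mulr_gt0.
have rhoE : rho * nrm (y - x) = r / 5 by rewrite /rho; field; rewrite gt_eqF.
have inb (s : R[i]) : nrm s <= 2 * rho -> nrm (x + s *: (y - x) - z) < r.
  move=> s4; rewrite addrAC; apply: le_lt_trans (nrmD _ _) _; rewrite nrmZ.
  have : nrm s * nrm (y - x) <= 2 * rho * nrm (y - x) by rewrite ler_wpM2r// nrm_ge0.
  by rewrite -mulrA rhoE; lra.
have [s /inb/FM[d _]|s /inb/FM[]//|c _ hc] := @taylor R f rho M rho0.
  exact: derivable_slice.
have := hc 1%N 0; have := hc 1%N 1; rewrite !big_ord_recl !big_ord0 !addr0 !expr0 !mulr1.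
have r1 : 1 <= rho / 2.
  by rewrite -(ler_pM2r v0) mulrAC rhoE mul1r; lra.
rewrite nrm1 nrm0 mul0r expr0n /= mulr0 => /(_ r1) h1 h0.
have {h0} f0 : f 0 = c 0%N.
  apply/eqP; rewrite -subr_eq0; apply/eqP; apply: nrm0_eq0; apply/eqP.
  by rewrite eq_le nrm_ge0 andbT h0// divr_ge0// ltW.
have -> : F x = f 0 by rewrite /f scale0r addr0.
have -> : F y = f 1 by rewrite /f scale1r addrC subrK.
rewrite f0; apply: le_trans h1 _.
by rewrite le_eqVlt; apply/orP; left; apply/eqP; rewrite /rho expr1; field; rewrite !gt_eqF.
Qed.

(** Both [P] and its negation are open conditions on the points of [D]. *)
Lemma connected_locally_constant (D : set V) (P : V -> Prop) z0 :
  open D -> connected D -> D z0 -> P z0 ->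
  (forall z, D z -> exists2 r : R, 0 < r & forall x y, D x -> D y ->
     nrm (x - z) < r -> nrm (y - z) < r -> P x -> P y) ->
  forall z, D z -> P z.
Proof.
move=> oD cD Dz0 Pz0 H.
have E : D `&` P = D.
  apply: cD.
  - by exists z0.
  - exists (D `&` P); last by rewrite setIA setIid.
    apply/open_nrmP => z [Dz Pz]; have [r r0 hr] := H z Dz.
    have [e e0 he] := (open_nrmP D).1 oD z Dz.
    exists (Num.min r e); first by rewrite lt_min r0.
    move=> w; rewrite lt_min => /andP[wr we]; split; first exact: he.
    by apply: (hr z w) => //; [exact: he|rewrite subrr nrm0].
  - exists (~` (D `&` ~` P)); last first.
      apply/seteqP; split => z /=; first by move=> [Dz Pz]; split => //; case.
      by move=> [Dz nP]; split => //; apply: contrapT => nPz; apply: nP.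
    apply: open_closedC; apply/open_nrmP => z [Dz Pz]; have [r r0 hr] := H z Dz.
    have [e e0 he] := (open_nrmP D).1 oD z Dz.
    exists (Num.min r e); first by rewrite lt_min r0.
    move=> w; rewrite lt_min => /andP[wr we]; split; first exact: he.
    by move=> Pw; apply: Pz; apply: (hr w z) => //; [exact: he|rewrite subrr nrm0].
by move=> z; rewrite -E => -[].
Qed.

(** A quantitative form of Vitali's theorem: that smallness near [z0] forces
    smallness near [z] is by [slice_small] a locally constant condition on [z]. The
    order of the quantifiers makes [eta] independent of [F]. *)
Lemma small_propagates (D : set V) (M del : R) z0 : open D -> connected D -> D z0 ->
  0 < del -> forall z, D z -> exists2 d : R, 0 < d &
  forall e, 0 < e -> exists2 eta : R, 0 < eta & forall F,
    (forall x, D x -> differentiable F x /\ nrm (F x) <= M) ->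
    (forall x, D x -> nrm (x - z0) < del -> nrm (F x) <= eta) ->
    forall x, D x -> nrm (x - z) < d -> nrm (F x) <= e.
Proof.
move=> oD cD Dz0 del0; apply: (connected_locally_constant oD cD Dz0).
  by exists del => // e e0; exists e.
move=> z Dz; have [r r0 hr] := (open_nrmP D).1 oD z Dz.
exists (r / 16); first by rewrite divr_gt0.
move=> x y Dx Dy xz yz [d d0 hx].
exists (r / 16 - nrm (y - z)); first by rewrite subr_gt0.
move=> e e0; have [eta1 eta10 h1] := slice_small M e0 r0 d0.
have [eta eta0 h] := hx eta1 eta10.
exists eta => // F FM Fs w Dw wy.
apply: (h1 F z _ x xz); last by have := nrm_tri y w z; lra.
  by move=> u /hr/FM.
by move=> u /hr Du ux; apply: h.
Qed.

End SeveralVariables.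

(** * Compactness in C^N *)

Section RowVectors.
Context {R : realType} {N : nat}.
Local Notation Cn := 'rV[R[i]]_N.
Implicit Types (x y z v : Cn).

Lemma nrm_coord v j : nrm (v ord0 j) <= nrm v.
Proof.
apply/ler_addgt0Pr => e e0.
have : ball (0 : Cn) (nrm v + e)%:C v.
  by rewrite -ball_normE /ball_ /= sub0r normrN nrmE ltcR ltrDl.
move=> [_ /(_ ord0 j)]; rewrite -ball_normE /ball_ /= mxE sub0r normrN nrmE ltcR; exact: ltW.
Qed.

Lemma nrm_le_coord v (e : R) : 0 <= e -> (forall j, nrm (v ord0 j) <= e) -> nrm v <= e.
Proof.
move=> e0 H; apply/ler_addgt0Pr => d d0.
have : ball (0 : Cn) (e + d)%:C v.
  split=> [|k j]; first by rewrite ltcR ltr_wpDl.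
  rewrite ord1 -ball_normE /ball_ /= mxE sub0r normrN nrmE ltcR.
  by apply: le_lt_trans (H j) _; rewrite ltrDl.
by rewrite -ball_normE /ball_ /= sub0r normrN nrmE ltcR; exact: ltW.
Qed.

Lemma compact_disc (M : R) : compact [set c : R[i] | nrm c <= M].
Proof.
have cm : continuous (fun p : R * R => (p.1 +i* p.2 : R[i])).
  move=> p A /nbhs_nrmP[e e0 he].
  have e2 : 0 < e / 2 by rewrite divr_gt0.
  exists (ball p.1 (e / 2), ball p.2 (e / 2)).
    by split; apply: nbhsx_ballx.
  move=> [a b] [/= ha hb]; apply: he; apply: le_lt_trans (nrm_le_ReIm _) _.
  by rewrite cReB cImB /= (distrC a) (distrC b); move: ha hb; rewrite /ball /=; lra.
apply: (@subclosed_compact _ _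
  ((fun p : R * R => (p.1 +i* p.2 : R[i])) @` (`[- M, M] `*` `[- M, M]))).
- rewrite -[X in closed X]setCK; apply: open_closedC; apply/open_nrmP => v /= /negP.
  rewrite -ltNge => vM; exists (nrm v - M); first by rewrite subr_gt0.
  move=> w wv; apply/negP; rewrite -ltNge.
  by have := nrm_subr v w; rewrite nrmBC; lra.
- apply: continuous_compact; first exact: continuous_subspaceT.
  by apply: compact_setX; exact: segment_compact.
- move=> c /= cM; exists (complex.Re c, complex.Im c); last by case: (c).
  split; rewrite /= in_itv /= -ler_norml; apply: le_trans cM; [exact: nrm_Re|exact: nrm_Im].
Qed.

Lemma compact_cball z (r : R) : compact [set x | nrm (x - z) <= r].
Proof.
pose A (j : 'I_N) := [set c : R[i] | nrm c <= nrm z + r].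
have cB : compact [set v : Cn | forall j, A j (v ord0 j)].
  by apply: rV_compact => j; exact: compact_disc.
apply: subclosed_compact cB _.
- rewrite -[X in closed X]setCK; apply: open_closedC; apply/open_nrmP => v /= /negP.
  rewrite -ltNge => vM; exists (nrm (v - z) - r); first by rewrite subr_gt0.
  move=> w wv; apply/negP; rewrite -ltNge.
  by have := nrm_tri w v z; rewrite (nrmBC v w); lra.
- move=> x /= xz j; apply: le_trans (nrm_coord _ _) _.
  by have := nrm_subr x z; lra.
Qed.

Lemma bounded_nrm (D : set Cn) : bounded_set D ->
  exists2 M : R, 0 < M & forall x, D x -> nrm x <= M.
Proof.
move=> [M0 [M0r h]]; exists (`|complex.Re M0| + 1); first by rewrite ltr_wpDl.
move=> x Dx; have := h (`|complex.Re M0| + 1)%:C.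
have -> : M0 < (`|complex.Re M0| + 1)%:C.
  by rewrite -(RRe_real M0r) ltcR (le_lt_trans (ler_norm _))// ltrDl.
by move=> /(_ isT x Dx) /=; rewrite nrmE lecR.
Qed.

(** Compactness makes the [eta] of [small_propagates] uniform. *)
Lemma small_propagates_compact (D K : set Cn) (M del e : R) z0 :
  open D -> connected D -> D z0 -> compact K -> K `<=` D -> 0 < del -> 0 < e ->
  exists2 eta : R, 0 < eta & forall F : Cn -> R[i],
    (forall x, D x -> differentiable F x /\ nrm (F x) <= M) ->
    (forall x, D x -> nrm (x - z0) < del -> nrm (F x) <= eta) ->
    forall x, K x -> nrm (F x) <= e.
Proof.
move=> oD cD Dz0 /compact_near_coveringP cK KD del0 e0.
pose P (eta : R) x := forall F : Cn -> R[i],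
    (forall x, D x -> differentiable F x /\ nrm (F x) <= M) ->
    (forall x, D x -> nrm (x - z0) < del -> nrm (F x) <= eta) -> nrm (F x) <= e.
have H x : K x -> \forall x' \near x & eta \near 0^'+, P eta x'.
  move=> /KD Dx; have [d d0 h] := small_propagates M oD cD Dz0 del0 Dx.
  have [eta eta0 {}h] := h e e0.
  have [r r0 hr] := (open_nrmP D).1 oD x Dx.
  exists ([set y | nrm (y - x) < Num.min r d], [set t | t < eta]).
    split => /=; first by apply: (nbhs_nrmP x _).2; exists (Num.min r d); rewrite ?lt_min ?r0.
    exact: nbhs_right_lt.
  move=> [y t] /= [yx te] F FM Fs; move: yx; rewrite lt_min => /andP[yr yd].
  apply: h => //; last exact: hr.
  by move=> u Du uz; apply: le_trans (Fs u Du uz) (ltW te).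
have hK := cK R (0^'+) P (at_right_proper_filter 0) H.
have [eta [eta0 KP]] := filter_ex (filterI (nbhs_right_gt (0 : R)) hK).
by exists eta => // F FM Fs x Kx; exact: KP.
Qed.

End RowVectors.

(** * Recurrence of automorphisms with a fixed point *)

Section Recurrence.
Context {R : realType} {N : nat}.
Local Notation Cn := 'rV[R[i]]_N.
Variable D : set Cn.
Implicit Types (g h k : Aut D) (x y z : D).

Definition pt (u : Cn) (Du : D u) : D := exist _ u (mem_set Du).

Lemma val_in x : D (val x).
Proof. exact: set_mem (valP x). Qed.

Lemma pt_val x (Dx : D (val x)) : pt Dx = x.
Proof. exact: val_inj. Qed.

Lemma expgE g n x : (g ^+ n.+1)%g x = g ((g ^+ n)%g x).
Proof. by rewrite expgS. Qed.

Lemma expg_addE g n m x : (g ^+ (n + m))%g x = (g ^+ n)%g ((g ^+ m)%g x).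
Proof. by elim: n => [|n IH]//; rewrite addSn !expgE IH. Qed.

Lemma expg_fix g x n : g x = x -> (g ^+ n)%g x = x.
Proof. by move=> gx; elim: n => [|n IH]//; rewrite expgE IH. Qed.

Lemma invg_app g x : (g^-1)%g (g x) = x.
Proof. exact: aut_funK. Qed.

Lemma holomorphic_map_coord (D' : set Cn) (f : D -> D') : holomorphic_map f ->
  exists F : 'I_N -> Cn -> R[i], forall j x,
    differentiable (F j) (val x) /\ F j (val x) = (val (f x)) ord0 j.
Proof.
move=> [F hF]; exists (fun j u => F u ord0 j) => j x; have [dF eF] := hF x I.
split; last by rewrite eF.
exact: (differentiable_comp dF (differentiable_coord _ _ _)).
Qed.

(** The coordinates of all automorphisms share the bound [M], hence all
    automorphisms share a Lipschitz constant near [z]. *)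
Lemma aut_lipschitz (r M : R) z : 0 < r -> (forall u, D u -> nrm u <= M) ->
  (forall u, nrm (u - val z) < r -> D u) -> forall h x y,
  nrm (val x - val z) < r / 2 -> nrm (val y - val z) < r / 2 ->
  nrm (val (h y) - val (h x)) <= 40 * M / r * nrm (val y - val x).
Proof.
move=> r0 DM ballD h x y hx hy.
have M0 : 0 <= M by apply: le_trans (DM _ (val_in z)); exact: nrm_ge0.
have [F hF] := holomorphic_map_coord (aut_fun_holo h).
apply: nrm_le_coord => [|j]; first by rewrite mulr_ge0 ?nrm_ge0// divr_ge0 ?mulr_ge0// ltW.
rewrite !mxE -(hF j x).2 -(hF j y).2.
apply: (bounded_holo_lipschitz r0 _ hx hy) => u /ballD Du.
have [d e] := hF j (pt Du); split; first exact: d.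
by rewrite [F j u]e; apply: le_trans (nrm_coord _ _) (DM _ (val_in _)).
Qed.

(** A compactness principle of Arzela-Ascoli type: along an ultrafilter the maps
    converge at each point, and by equicontinuity uniformly on the compact set, so
    two of them with distinct indices are close to their common limit. *)
Lemma equilipschitz_close (K : set Cn) (f : nat -> Cn -> Cn) (M L e : R) :
  compact K -> 0 <= L -> 0 < e -> (forall n u, K u -> nrm (f n u) <= M) ->
  (forall n u v, K u -> K v -> nrm (f n v - f n u) <= L * nrm (v - u)) ->
  exists n n', (n < n')%N /\ forall u, K u -> nrm (f n' u - f n u) <= e.
Proof.
move=> cK L0 e0 fM lip.
have [G [GU ooG]] := ultraFilterLemma eventually_filter.
have GF : ProperFilter G by exact: ultra_proper.
have cvgG u : exists q : Cn, K u -> forall d : R, 0 < d ->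
    G [set n | nrm (f n u - q) < d].
  have [Ku|nKu] := pselect (K u); last by exists 0.
  have [|q [_ hq]] := @compact_cball R N 0 M (f^~ u @ G) _.
    suff h : G [set n | nrm (f n u - 0) <= M] by exact: h.
    by apply: filterS filterT => n _ /=; rewrite subr0; exact: fM.
  exists q => _ d d0.
  have nq : nbhs q [set v | nrm (v - q) < d] by apply: (nbhs_nrmP q _).2; exists d.
  have [//|Gn] := in_ultra_setVsetC [set n | nrm (f n u - q) < d] GU.
  have fGn : (f^~ u @ G) (~` [set v | nrm (v - q) < d]) by exact: Gn.
  by have [v []] := hq _ _ fGn nq.
have [p hp] := choice cvgG.
(* the pointwise limit inherits the Lipschitz constant *)
have plip u v : K u -> K v -> nrm (p v - p u) <= L * nrm (v - u).
  move=> Ku Kv; apply/ler_addgt0Pr => d d0.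
  have d20 : 0 < d / 2 by rewrite divr_gt0.
  have [n [/= h1 h2]] :=
    filter_ex (@filterI _ G _ _ _ (hp u Ku _ d20) (hp v Kv _ d20)).
  have := lip n u v Ku Kv; have := nrm_tri (f n v) (p v) (p u).
  have := nrm_tri (f n u) (f n v) (p u); rewrite (nrmBC (p v) (f n v)).
  by clear -h1 h2; lra.
have L1 : 0 < 8 * (L + 1) by rewrite mulr_gt0// ltr_wpDl.
pose d := e / (8 * (L + 1)).
have d0 : 0 < d by rewrite divr_gt0.
have dE : L * d <= e / 8.
  rewrite (_ : L * d = e / 8 - d) ?gerBl ?(ltW d0)//.
  by rewrite /d; field; rewrite gt_eqF// ltr_wpDl.
have e80 : 0 < e / 8 by rewrite divr_gt0.
have A : G [set n | K `<=` (fun u => K u -> nrm (f n u - p u) <= e / 2)].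
  apply: ((compact_near_coveringP K).1 cK _ G
    (fun n u => K u -> nrm (f n u - p u) <= e / 2)) => u /= Ku.
  exists ([set v | nrm (v - u) < d], [set n | nrm (f n u - p u) < e / 8]).
    by split; [apply: (nbhs_nrmP u _).2; exists d|exact: hp].
  move=> [v n] /= [vu hn] Kv.
  have h1 := lip n _ _ Ku Kv; have h2 := plip _ _ Kv Ku.
  rewrite (nrmBC u) in h2.
  have Ld : L * nrm (v - u) <= e / 8 by apply: le_trans dE; rewrite ler_wpM2l// ltW.
  have := nrm_tri (f n u) (f n v) (p v); have := nrm_tri (p u) (f n u) (p v).
  by clear -h1 h2 Ld hn e0; lra.
have [n /= hn] := filter_ex A.
have An : G [set n' | (n < n')%N] by apply: ooG; exists n.+1.
have [n' [/= hn' nn']] := filter_ex (@filterI _ G _ _ _ A An).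
exists n, n'; split=> // u Ku.
have := nrm_tri (p u) (f n' u) (f n u); have := hn _ Ku Ku; have := hn' _ Ku Ku.
by rewrite (nrmBC (p u)); clear; lra.
Qed.

(** The powers of [k] are uniformly Lipschitz near the fixed point, so two of them,
    [k ^+ n] and [k ^+ n'], are close there; applying [k ^- n], which is Lipschitz
    with the same constant, shows that [k ^+ (n' - n)] is close to the identity. *)
Lemma recurrent_near_fixpoint (M : R) k z : open D -> (forall u, D u -> nrm u <= M) ->
  k z = z -> exists2 del : R, 0 < del & forall e, 0 < e ->
  exists2 m, (0 < m)%N & forall x, nrm (val x - val z) < del ->
    nrm (val ((k ^+ m)%g x) - val x) <= e.
Proof.
move=> oD DM kz.
have [r r0 ballD] := (open_nrmP D).1 oD _ (val_in z).
have lip := aut_lipschitz r0 DM ballD.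
set L := 40 * M / r in lip.
have L0 : 0 <= L.
  by rewrite divr_ge0 ?mulr_ge0 ?(ltW r0)//; exact: le_trans (nrm_ge0 _) (DM _ (val_in z)).
have L1 : 0 < L + 1 by rewrite ltr_wpDl.
pose del := r / (4 * (L + 1)).
have del0 : 0 < del by rewrite divr_gt0// mulr_gt0.
have delE : del * (L + 1) = r / 4 by rewrite /del; field; rewrite gt_eqF.
have delr : del < r / 2.
  have : del <= r / 4 by rewrite -delE ler_peMr ?lerDr ?(ltW del0).
  by clear -r0; lra.
have Ldel : L * del < r / 2.
  rewrite mulrC; move: delE; rewrite mulrDr mulr1 => E.
  by clear -E del0 r0; lra.
exists del => // e e0.
have [F hF] := choice (fun n => aut_fun_holo (k ^+ n)%g).
have FE n x : F n (val x) = val ((k ^+ n)%g x) by have [] := hF n x I.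
have inD (u : Cn) : nrm (u - val z) <= del -> D u.
  by move=> h; apply: ballD; clear -h delr r0; lra.
have e1 : 0 < e / (L + 1) by rewrite divr_gt0.
have [| |n [n' [nn' hn]]] := @equilipschitz_close _ F M L _
  (@compact_cball R N (val z) del) L0 e1.
- by move=> n u /inD Du; rewrite (FE n (pt Du)); exact: DM _ (val_in _).
- move=> n u v /= uz vz; rewrite (FE n (pt (inD _ uz))) (FE n (pt (inD _ vz))).
  by apply: lip; exact: le_lt_trans delr.
exists (n' - n)%N; first by rewrite subn_gt0.
move=> x xz.
have inb m : nrm (val ((k ^+ m)%g x) - val z) < r / 2.
  have := lip (k ^+ m)%g z x; rewrite (expg_fix m kz) subrr nrm0 => h.
  apply: le_lt_trans (h _ _) _; [by rewrite divr_gt0|exact: lt_trans delr|].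
  by apply: le_lt_trans Ldel; rewrite ler_wpM2l// ltW.
have -> : (k ^+ (n' - n))%g x = ((k ^+ n)%g^-1)%g ((k ^+ n')%g x).
  by rewrite -[in RHS](subnKC (ltnW nn')) expg_addE invg_app.
rewrite -[X in _ - val X](invg_app (k ^+ n)%g x).
apply: le_trans (lip _ _ _ (inb n) (inb n')) _.
have := hn _ (ltW xz); rewrite !FE ler_pdivlMr// mulrC => h; apply: le_trans h.
by rewrite ler_wpM2r ?nrm_ge0// lerDl.
Qed.

(** The coordinates of [k ^+ m - id] are bounded by [2 * M] whatever [m], so their
    smallness near the fixed point, given by [recurrent_near_fixpoint], spreads to
    [K]. *)
Theorem recurrent_on_compacts (K : set Cn) (e : R) k z : open D -> connected D ->
  bounded_set D -> k z = z -> compact K -> K `<=` D -> 0 < e ->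
  exists2 m, (0 < m)%N & forall x, K (val x) -> nrm (val ((k ^+ m)%g x) - val x) <= e.
Proof.
move=> oD cD /bounded_nrm[M M0 DM] kz cK KD e0.
have [del del0 hdel] := recurrent_near_fixpoint oD DM kz.
have [eta eta0 heta] := small_propagates_compact (2 * M) oD cD (val_in z) cK KD del0 e0.
have [m m0 hm] := hdel eta eta0; exists m => // x Kx.
have [F hF] := holomorphic_map_coord (aut_fun_holo (k ^+ m)%g).
apply: nrm_le_coord => [|j]; first exact: ltW.
rewrite !mxE -(hF j x).2; apply: (heta (fun u => F j u - u ord0 j)) => // u Du.
  have [d E] := hF j (pt Du); split.
    by apply: differentiableB => //; exact: differentiable_coord.
  apply: le_trans (nrmB _ _) _.
  rewrite [F j u]E mulr_natl mulr2n; apply: lerD.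
    exact: le_trans (nrm_coord _ _) (DM _ (val_in _)).
  exact: le_trans (nrm_coord _ _) (DM _ Du).
move=> uz; have [_ E] := hF j (pt Du); rewrite [F j u]E.
apply: le_trans (hm (pt Du) uz).
by have := nrm_coord (val ((k ^+ m)%g (pt Du)) - val (pt Du)) j; rewrite !mxE.
Qed.

End Recurrence.

(** * The automorphism group and its topology *)

Section SubsetTopology.
Context {R : realType} {V : normedModType R[i]} (D : set V).
Implicit Types (x y : D).

Lemma nbhs_subP x (A : set D) :
  nbhs x A <-> exists2 e : R, 0 < e & forall y, nrm (val y - val x) < e -> A y.
Proof.
split=> [[_ [[B oB <-] /= Bx BA]]|[e e0 h]].
  have [e e0 he] := (open_nrmP B).1 oB _ Bx.
  by exists e => // y yx; apply: BA; exact: he.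
exists (set_val @^-1` [set u | nrm (u - val x) < e]); split => //=; last by rewrite subrr nrm0.
exists [set u | nrm (u - val x) < e] => //.
apply/open_nrmP => u /= ux; exists (e - nrm (u - val x)); first by rewrite subr_gt0.
by move=> w wu; have := nrm_tri u w (val x); lra.
Qed.

Lemma open_subP (A : set D) : open A <-> forall x, A x ->
  exists2 e : R, 0 < e & forall y, nrm (val y - val x) < e -> A y.
Proof.
rewrite openE; split => [h x /h/nbhs_subP//|h x /h hx].
by apply/nbhs_subP.
Qed.

End SubsetTopology.

Section AutTopology.
Context {R : realType} {N : nat}.
Local Notation Cn := 'rV[R[i]]_N.
Implicit Types (D : set Cn).

Lemma holomorphic_on_continuous (W : normedModType R[i]) D (U : set D) (f : D -> W) z :
  holomorphic_on U f -> U z -> forall e : R, 0 < e -> exists2 d : R, 0 < d &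
  forall y, U y -> nrm (val y - val z) < d -> nrm (f y - f z) < e.
Proof.
move=> [F hF] Uz e e0; have [dF E] := hF z Uz.
have ne : nbhs (F (val z)) [set u | nrm (u - F (val z)) < e].
  by apply: (nbhs_nrmP _ _).2; exists e.
have /nbhs_nrmP[d d0 hd] := differentiable_continuous dF ne.
by exists d => // y Uy yz; rewrite -(hF y Uy).2 -E; exact: hd.
Qed.

Lemma holomorphic_map_continuous D D' (f : D -> D') : holomorphic_map f -> continuous f.
Proof.
move=> hf z A /nbhs_subP[e e0 he]; apply/nbhs_subP.
have [d d0 hd] := holomorphic_on_continuous (z := z) hf I e0.
by exists d => // y yz; apply: he; exact: hd.
Qed.

Lemma aut_continuous D (g : Aut D) : continuous g.
Proof. exact: holomorphic_map_continuous (aut_fun_holo g). Qed.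

Lemma aut_cvgP D (F : set_system (Aut D)) (g : Aut D) : Filter F ->
  (forall K O, compact K -> open O -> g @` K `<=` O -> F [set h | h @` K `<=` O]) ->
  F --> g.
Proof.
move=> FF H A [_ [[B oB <-] /= Bg BA]].
apply: filterS BA _.
have cF : ((fun h : Aut D => (h : D -> D) : {compact-open, D -> D}) @ F) -->
    ((g : D -> D) : {compact-open, D -> D}).
  by apply/compact_open_cvgP => K O cK oO KO; exact: H.
by apply: cF; exact: open_nbhs_nbhs.
Qed.

Lemma nbhs_aut_subbasis D (g : Aut D) (K O : set D) : compact K -> open O ->
  g @` K `<=` O -> nbhs g [set h : Aut D | h @` K `<=` O].
Proof.
move=> cK oO gKO.
exists ((fun h : Aut D => (h : D -> D) : {compact-open, D -> D}) @^-1`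
  [set h | h @` K `<=` O]); split => //.
by exists [set h | h @` K `<=` O] => //; exact: compact_open_open.
Qed.

Lemma aut_mulr_continuous D (h : Aut D) : continuous (fun g : Aut D => (g * h)%g).
Proof.
move=> g; have FF := fmap_filter (fun g : Aut D => (g * h)%g) (nbhs_filter g).
apply: (aut_cvgP FF) => K O cK oO KO.
have cK' : compact (h @` K).
  by apply: continuous_compact => //; apply: continuous_subspaceT; exact: aut_continuous.
have gO : g @` (h @` K) `<=` O by move=> _ [_ [x Kx <-] <-]; apply: KO; exists x.
apply: filterS (nbhs_aut_subbasis cK' oO gO) => k kO _ [x Kx <-].
by apply: kO; exists (h x) => //; exists x.
Qed.

Definition subgroup_set D (S : set (Aut D)) :=
  [/\ S 1%g, (forall g h, S g -> S h -> S (g * h)%g) & (forall g, S g -> S (g^-1)%g)].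

Lemma subgroup_expg D (S : set (Aut D)) g n : subgroup_set S -> S g -> S (g ^+ n)%g.
Proof.
move=> [S1 SM _] Sg; elim: n => [|n IH]; first by rewrite expg0.
by rewrite expgS; exact: SM.
Qed.

(** Right translations are continuous, hence they carry the identity component to
    connected sets; the translate by [g^-1] contains both [1] and [g^-1]. *)
Lemma component_subgroup D (S : set (Aut D)) : subgroup_set S ->
  subgroup_set (connected_component S 1%g).
Proof.
move=> [S1 SM SV]; set C := connected_component S 1%g.
have C1 : C 1%g by exact: connected_component_refl.
have CS : C `<=` S by exact: connected_component_sub.
have cC : connected C by exact: component_connected.
have cT h : connected ((fun g => (g * h)%g) @` C).
  apply: connected_continuous_connected => //; apply: continuous_subspaceT.
  exact: aut_mulr_continuous.
have sT h : S h -> (fun g => (g * h)%g) @` C `<=` S.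
  by move=> Sh _ [g /CS Sg <-]; exact: SM.
split=> // [g h Cg Ch|g Cg].
  rewrite /C (same_connected_component Ch).
  apply: (@connected_component_max _ S ((fun g => (g * h)%g) @` C)); last by exists g.
  - by exists 1%g; rewrite ?mul1g.
  - exact: sT (CS _ Ch).
  - exact: cT.
apply: (@connected_component_max _ S ((fun h => (h * g^-1)%g) @` C)).
- by exists g; rewrite ?mulgV.
- exact: sT (SV _ (CS _ Cg)).
- exact: cT.
- by exists 1%g; rewrite ?mul1g.
Qed.

Lemma Aut0_subgroup D : subgroup_set (@Aut0 R N D).
Proof. exact: component_subgroup. Qed.

(** The elements of [Aut0 D] whose image under [phi] lies in a matrix group form a
    subgroup because [phi] is multiplicative there; its identity component is then a
    subgroup. *)
Lemma algebraic_component_subgroup D m (A : set 'M[R]_m) (phi : Aut D -> 'M[R]_m) G :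
  linear_realization A phi -> algebraic_identity_component phi G -> subgroup_set G.
Proof.
move=> [[[Aunit _ _ _] _] phiM [phiA _ _] _ _] [H [[Hunit H1 HM HV] _] ->].
have [A1 AM AV] := Aut0_subgroup D.
apply: component_subgroup.
have pu g : Aut0 g -> phi g \in unitmx.
  by move=> /phiA/connected_component_sub/Aunit.
have p1 : phi 1%g = 1%:M.
  have := phiM _ _ A1 A1; rewrite mulg1 => E.
  by rewrite -(mulVmx (pu _ A1)) [in X in _ = _ *m X]E mulmxA mulVmx ?pu// mul1mx.
split.
- by split => //; rewrite /preimage /= p1.
- move=> g h [Ag Hg] [Ah Hh]; split; first exact: AM.
  by rewrite /preimage /= phiM//; exact: HM.
- move=> g [Ag Hg]; split; first exact: AV.
  rewrite /preimage /=.
  have E : phi (g^-1)%g *m phi g = 1%:M by rewrite -phiM ?mulVg//; exact: AV.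
  have -> : phi (g^-1)%g = invmx (phi g).
    by rewrite -[LHS]mulmx1 -(mulmxV (pu _ Ag)) mulmxA E mul1mx.
  exact: HV.
Qed.

Section Transport.
Variables (D D' : set Cn) (f : D -> D') (f' : D' -> D).
Hypotheses (fK : cancel f f') (f'K : cancel f' f).
Hypotheses (hf : holomorphic_map f) (hf' : holomorphic_map f').

Definition conj_aut (k : Aut D) : Aut D' :=
  MkAut (can_comp (can_comp fK (aut_funK k)) f'K)
        (can_comp fK (can_comp (aut_invK k) f'K))
        (holomorphic_map_comp (holomorphic_map_comp hf (aut_fun_holo k)) hf')
        (holomorphic_map_comp hf (holomorphic_map_comp (aut_inv_holo k) hf')).

Lemma conj_autX k n x : (conj_aut k ^+ n)%g x = f ((k ^+ n)%g (f' x)).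
Proof.
elim: n x => [|n IH] x; first by rewrite !expg0 /= f'K.
by rewrite !expgE IH /= fK.
Qed.

(** After conjugation by [f] the domain is bounded, and [recurrent_on_compacts]
    provides positive powers as close to the identity as desired on a given compact
    set. It remains to see that uniform closeness on compact sets forces convergence
    in the compact-open topology of [Aut D]. *)
Theorem powers_recur_at_one (k : Aut D) z : is_domain D' -> bounded_set D' ->
  k z = z -> forall V : set (Aut D), nbhs (1%g : Aut D) V ->
  exists2 n, (0 < n)%N & V (k ^+ n)%g.
Proof.
move=> [_ oD' cD'] bD' kz V nV.
pose good (K : set Cn) (e : R) n := (0 < n)%N /\
  forall x : D', K (val x) -> nrm (val ((conj_aut k ^+ n)%g x) - val x) <= e.
(* the filter generated by the sets of positive powers of [k] which are close
   to the identity, in the bounded model, on a given compact set *)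
pose FF : set_system (Aut D) := [set A | exists K e,
  [/\ compact K, K `<=` D', 0 < e & forall n, good K e n -> A (k ^+ n)%g]].
have FFF : Filter FF.
  split.
  - by exists set0, 1; split => //; [exact: compact0].
  - move=> P Q [K1 [e1 [c1 s1 p1 h1]]] [K2 [e2 [c2 s2 p2 h2]]].
    exists (K1 `|` K2), (Num.min e1 e2); split.
    + exact: compactU.
    + by move=> u [/s1|/s2].
    + by rewrite lt_min p1.
    + move=> n [n0 hn]; split; [apply: h1|apply: h2]; split => // x Kx.
        by apply: le_trans (hn x (or_introl Kx)) _; rewrite ge_min lexx.
      by apply: le_trans (hn x (or_intror Kx)) _; rewrite ge_min lexx orbT.
  - move=> P Q PQ [K [e [c s p h]]]; exists K, e; split => // n gn.
    exact/PQ/h.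
suff FF1 : FF --> (1%g : Aut D).
  have [K [e [cK KD e0 h]]] := FF1 _ nV.
  have kz' : conj_aut k (f z) = f z by rewrite /= fK kz.
  have [n n0 hn] := recurrent_on_compacts oD' cD' bD' kz' cK KD e0.
  by exists n => //; exact: h.
apply: (aut_cvgP FFF) => K O cK oO KO.
pose K' : set Cn := (fun x : D => val (f x)) @` K.
have cf : continuous (fun x : D => val (f x) : Cn).
  move=> x A /nbhs_nrmP[e e0 he]; apply/nbhs_subP.
  have [d d0 hd] := holomorphic_on_continuous (z := x) hf I e0.
  by exists d => // y yx; apply: he; exact: hd.
have cK' : compact K'.
  by apply: continuous_compact => //; exact: continuous_subspaceT.
pose P (e : R) (u : Cn) := forall y : D', nrm (val y - u) <= e -> O (f' y).
(* points close enough to [K'] are sent into [O] by [f']; compactness makes the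
   distance uniform *)
have H u : K' u -> \forall u' \near u & e \near 0^'+, P e u'.
  move=> [x Kx <-].
  have Ox : O (f' (f x)) by rewrite fK; apply: KO; exists x.
  have := holomorphic_map_continuous hf' (open_nbhs_nbhs (conj oO Ox)).
  move=> /nbhs_subP[d d0 hd].
  have d20 : 0 < d / 2 by rewrite divr_gt0.
  exists ([set v | nrm (v - val (f x)) < d / 2], [set e | e < d / 2]).
    split => /=; last exact: nbhs_right_lt.
    by apply: (nbhs_nrmP (val (f x) : Cn) _).2; exists (d / 2).
  move=> [v e] /= [vu ed] y yv; apply: hd.
  by have := nrm_tri v (val y : Cn) (val (f x)); lra.
have hK := (compact_near_coveringP _).1 cK' R (0^'+) P (at_right_proper_filter 0) H.
have [e [e0 KP]] := filter_ex (filterI (nbhs_right_gt (0 : R)) hK).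
exists K', e; split => //; first by move=> _ [x _ <-]; exact: val_in.
move=> n [n0 hn] _ [x Kx <-].
have Kfx : K' (val (f x)) by exists x.
have := KP _ Kfx ((conj_aut k ^+ n)%g (f x)) (hn _ Kfx).
by rewrite conj_autX !fK.
Qed.

End Transport.

End AutTopology.

(** * Isotropy groups act by unimodular scalars *)

Section Isotropy.
Context {R : realType} {N : nat} {D : set 'rV[R[i]]_N} (L : line_bundle D).
Implicit Types (i j : lb_chart L) (z : D) (e : total L).

(** The coordinate in the chart [i] of a vector given as a point of the total space,
    where vectors over different points can be compared; [fcoord] is its counterpart on
    one fibre. *)
Definition tcoord i e : R[i] := lb_triv i (projT1 e) (projT2 e).
Definition tmod i e : R := nrm (tcoord i e).

Definition frame i z : total L := in_total (lb_inv i z 1).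

Lemma lb_triv_scale i z c (v : lb_fiber L z) :
  lb_triv i z (c *: v) = c * lb_triv i z v :> R[i].
Proof. by rewrite linearZ. Qed.

Lemma lb_inv_scale i z c : lb_dom i z -> lb_inv i z c = c *: lb_inv i z 1.
Proof.
move=> iz; apply: (can_inj (lb_trivK iz)).
by rewrite lb_triv_scale !(lb_invK iz) mulr1.
Qed.

Lemma lb_fiberE i z (v : lb_fiber L z) : lb_dom i z ->
  v = (lb_triv i z v : R[i]) *: lb_inv i z 1.
Proof. by move=> iz; rewrite -lb_inv_scale// lb_trivK. Qed.

Lemma tmod_frame i z : lb_dom i z -> tmod i (frame i z) = 1.
Proof. by move=> iz; rewrite /tmod /tcoord /= lb_invK// nrm1. Qed.

Definition tube i (r : R) := [set e : total L | lb_dom i (projT1 e) /\ tmod i e < r].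

(** In a chart [j] the modulus of the coordinate with respect to [i] is [nrm c * nrm
    (t y)], where [c] is the coordinate with respect to [j] and [t] the transition
    function, which is continuous. *)
Lemma tube_open i r : open (tube i r).
Proof.
move=> j; rewrite openE => -[x c] [/= jx [/= ix xr]].
pose t y : R[i] := lb_triv i y (lb_inv j y 1).
have tE y d : lb_dom j y -> tmod i (in_total (lb_inv j y d)) = nrm d * nrm (t y).
  by move=> jy; rewrite /tmod /tcoord /= lb_inv_scale// lb_triv_scale nrmM.
rewrite tE// in xr.
have o1 := (open_subP _).1 (@lb_open _ _ _ L i) x ix.
have [e1 e10 h1] := o1.
have [e2 e20 h2] := (open_subP _).1 (@lb_open _ _ _ L j) x jx.
pose q := r - nrm c * nrm (t x).
have q0 : 0 < q by rewrite subr_gt0.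
have c1 : 0 < nrm c + 1 by rewrite ltr_wpDl ?nrm_ge0.
have t1 : 0 < nrm (t x) + 1 by rewrite ltr_wpDl ?nrm_ge0.
pose d1 := q / (2 * (nrm c + 1)).
have d10 : 0 < d1 by rewrite divr_gt0// mulr_gt0.
have d1E : d1 * (nrm c + 1) = q / 2 by rewrite /d1; field; rewrite gt_eqF.
have [d2 [d20 d21 d2q]] : exists d2 : R,
    [/\ 0 < d2, d2 <= 1 & d2 <= q / (2 * (nrm (t x) + 1))].
  exists (Num.min 1 (q / (2 * (nrm (t x) + 1)))).
  by split; [rewrite lt_min ltr01 divr_gt0// mulr_gt0|rewrite ge_min lexx|
             rewrite ge_min lexx orbT].
have d2E : d2 * (nrm (t x) + 1) <= q / 2.
  apply: le_trans (_ : _ <= q / (2 * (nrm (t x) + 1)) * (nrm (t x) + 1)) _.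
    by rewrite ler_wpM2r// ltW.
  by rewrite le_eqVlt; apply/orP; left; apply/eqP; field; rewrite gt_eqF.
have [e3 e30 h3] := holomorphic_on_continuous (z := x) (lb_transition j i) (conj jx ix) d10.
exists ([set y : D | nrm (val y - val x) < Num.min (Num.min e1 e2) e3],
        [set c' : R[i] | nrm (c' - c) < d2]).
  split; last by apply: (nbhs_nrmP c _).2; exists d2.
  apply/nbhs_subP; exists (Num.min (Num.min e1 e2) e3) => //.
  by rewrite !lt_min e10 e20.
move=> [y c'] /= []; rewrite !lt_min => /andP[/andP[ye1 ye2] ye3] cc'.
have jy := h2 _ ye2; have iy := h1 _ ye1.
split => //; split => //=; rewrite tE//.
have ty := h3 y (conj jy iy) ye3; rewrite -/(t y) -/(t x) in ty.
have nc : nrm c' <= nrm c + 1 by have := nrm_subr c' c; lra.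
have nt : nrm (t y) <= nrm (t x) + nrm (t y - t x) by exact: nrm_subr.
have a1 : nrm c' * nrm (t y) <= nrm c' * nrm (t x) + (nrm c + 1) * nrm (t y - t x).
  apply: le_trans (ler_wpM2l (nrm_ge0 _) nt) _.
  by rewrite mulrDr lerD2l ler_wpM2r ?nrm_ge0.
have a2 : nrm c' * nrm (t x) <= nrm c * nrm (t x) + nrm (c' - c) * nrm (t x).
  by rewrite -mulrDl ler_wpM2r ?nrm_ge0// nrm_subr.
have a3 : nrm (c' - c) * nrm (t x) <= d2 * (nrm (t x) + 1).
  by apply: ler_pM; rewrite ?nrm_ge0 ?(ltW cc') ?lerDl.
have a4 : (nrm c + 1) * nrm (t y - t x) < q / 2.
  by rewrite -d1E mulrC ltr_pM2r.
by rewrite /q in a3 a4 d2E; lra.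
Qed.

Variables (G : set (Aut D)) (E : equivariant_structure G L).
Hypothesis G_subgroup : subgroup_set G.
Local Notation act := (total_act (eq_act E)).
Implicit Types (g h k : Aut D).

(** For [k] fixing [z], this is the modulus of the scalar by which [k] acts on the
    fibre over [z]. *)
Definition char_mod i z k := tmod i (act k (frame i z)).

Lemma tcoord_act i j k e : G k -> lb_dom j (projT1 e) ->
  tcoord i (act k e) = tcoord j e * tcoord i (act k (frame j (projT1 e))).
Proof.
move=> Gk; case: e => x v /= jx.
have lin := @eq_act_linear _ _ _ _ _ E k x Gk.
have actZ (c : R[i]) (w : lb_fiber L x) : eq_act E k (c *: w) = c *: eq_act E k w.
  have := lin c w 0; rewrite addr0 => ->.
  have -> : eq_act E k (0 : lb_fiber L x) = 0.
    have := lin (-1) 0 0; rewrite scaleN1r oppr0 add0r => {1}->.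
    by rewrite scaleN1r addNr.
  by rewrite addr0.
by rewrite /tcoord /= {1}(lb_fiberE v jx) actZ lb_triv_scale.
Qed.

Lemma tmod_act i z k e : G k -> lb_dom i z -> projT1 e = z ->
  tmod i (act k e) = tmod i e * char_mod i z k.
Proof.
by move=> Gk iz ez; rewrite -ez in iz *; rewrite /char_mod /tmod (tcoord_act i Gk iz) nrmM.
Qed.

Lemma char_modM i z g h : G g -> G h -> lb_dom i z -> h z = z ->
  char_mod i z (g * h)%g = char_mod i z h * char_mod i z g.
Proof.
move=> Gg Gh iz hz; rewrite /char_mod (eq_actM E)//.
by rewrite (tmod_act (z := z)).
Qed.

Lemma char_mod1 i z : lb_dom i z -> char_mod i z 1%g = 1.
Proof. by move=> iz; rewrite /char_mod eq_act1 tmod_frame. Qed.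

Lemma char_modX i z k n : G k -> lb_dom i z -> k z = z ->
  char_mod i z (k ^+ n)%g = char_mod i z k ^+ n.
Proof.
move=> Gk iz kz; elim: n => [|n IH]; first by rewrite expg0 char_mod1.
rewrite expgS char_modM//; last exact: expg_fix.
  by rewrite IH exprSr.
exact: subgroup_expg.
Qed.

Hypothesis D_bounded : exists2 D' : set 'rV[R[i]]_N,
  is_domain D' /\ bounded_set D' & biholomorphic D D'.

(** If the modulus were larger than 1, it would exceed 2 for some power of [k], and
    so for all positive powers of that power. But these accumulate at the identity,
    near which the modulus is less than 2 by continuity of the action. *)
Lemma char_mod_le1 i z k : G k -> lb_dom i z -> k z = z -> char_mod i z k <= 1.
Proof.
move=> Gk iz kz; rewrite leNgt; apply/negP => k1.
have [D' [domD' bD'] [f [f' [fK f'K hf hf']]]] := D_bounded.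
have [q hq] : exists q, 2 < char_mod i z k ^+ q.
  pose b := char_mod i z k - 1; have b0 : 0 < b by rewrite subr_gt0.
  exists (Num.bound `|2 / b|); set n := Num.bound _.
  have hn : 2 / b < n%:R by apply: le_lt_trans (ler_norm _) _; exact: archi_boundP.
  have bern m : 1 + m%:R * b <= char_mod i z k ^+ m.
    elim: m => [|m IH]; first by rewrite mul0r addr0 expr0.
    rewrite exprS (_ : char_mod i z k = 1 + b); last by rewrite /b; ring.
    rewrite (_ : char_mod i z k = 1 + b) in IH; last by rewrite /b; ring.
    have m0 : 0 <= m%:R * b * b by rewrite !mulr_ge0// ltW.
    apply: le_trans (ler_wpM2l _ IH); last by lra.
    by rewrite -natr1; lra.
  apply: lt_le_trans (bern n); move: hn; rewrite ltr_pdivrMr//; lra.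
have Gkq := subgroup_expg q G_subgroup Gk.
have kqz : (k ^+ q)%g z = z by exact: expg_fix.
have /subspace_continuousP/(_ (1%g, frame i z)) := @eq_act_continuous _ _ _ _ _ E.
have G1 : G 1%g by case: G_subgroup.
move=> /(_ G1); rewrite [X in _ --> X](eq_act1 E) => ct.
have nt : nbhs (frame i z) (tube i 2).
  apply: open_nbhs_nbhs; split; first exact: tube_open.
  by split => //; rewrite tmod_frame//; lra.
have [[V W] [/= nV nW] hVW] := ct _ nt.
have [n n0 Vn] := powers_recur_at_one fK f'K hf hf' domD' bD' kqz nV.
have Gn := subgroup_expg n G_subgroup Gkq.
have := hVW ((k ^+ q) ^+ n, frame i z)%g (conj Vn (nbhs_singleton nW)) Gn.
move=> [_]; rewrite -/(char_mod i z _) char_modX// ltNge => /negP; apply.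
rewrite char_modX//; apply: le_trans (ltW hq) _.
case: n n0 {Vn Gn} => // n _; rewrite exprS ler_peMr// ?exprn_ge0 ?(le_trans _ (ltW k1))//.
by rewrite exprn_ege1// exprn_ege1// ltW.
Qed.

Lemma char_mod_eq1 i z k : G k -> lb_dom i z -> k z = z -> char_mod i z k = 1.
Proof.
move=> Gk iz kz.
have Gk' : G (k^-1)%g by case: G_subgroup => _ _; exact.
have kz' : (k^-1)%g z = z by rewrite -[in LHS]kz invg_app.
have h1 := char_mod_le1 Gk iz kz; have h2 := char_mod_le1 Gk' iz kz'.
have := char_modM Gk' Gk iz kz; rewrite mulVg char_mod1// => E1.
apply/eqP; rewrite eq_le h1 /= E1 ler_piMr//.
by rewrite nrm_ge0.
Qed.

Theorem isotropy_unitary i z k e : G k -> lb_dom i z -> k z = z -> projT1 e = z ->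
  tmod i (act k e) = tmod i e.
Proof.
by move=> Gk iz kz ez; rewrite (tmod_act (z := z))// char_mod_eq1// mulr1.
Qed.

End Isotropy.

(** * Representation and transfer in Hilbert spaces *)

Section Hilbert.
Context {R : realType} {H : completeNormedModType R[i]} (d : {dot H for Num.conj}).
Hypothesis d_norm : forall v, `|v| ^+ 2 = d v v.
Implicit Types (u v w p : H) (a : R[i]).

Lemma dDl u v w : d (u + v) w = d u w + d v w. Proof. exact: linearDl. Qed.
Lemma dBl u v w : d (u - v) w = d u w - d v w. Proof. exact: linearBl. Qed.
Lemma dZl a u w : d (a *: u) w = a * d u w. Proof. by rewrite linearZl_LR. Qed.
Lemma dC u v : d u v = Num.conj (d v u).
Proof. by rewrite (hermC d) expr0 mul1r. Qed.
Lemma dDr u v w : d w (u + v) = d w u + d w v. Proof. exact: linearDr. Qed.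
Lemma dBr u v w : d w (u - v) = d w u - d w v. Proof. exact: linearBr. Qed.
Lemma dZr a u w : d w (a *: u) = Num.conj a * d w u.
Proof. by rewrite linearZr_LR. Qed.
Lemma d0l u : d 0 u = 0. Proof. exact: linear0l. Qed.
Lemma d0r u : d u 0 = 0. Proof. exact: linear0r. Qed.
Lemma dsuml (I : Type) (r : seq I) (F : I -> H) w :
  d (\sum_(i <- r) F i) w = \sum_(i <- r) d (F i) w.
Proof. by elim/big_rec2: _ => [|i y x _ <-]; rewrite ?d0l ?dDl. Qed.
Lemma dsumr (I : Type) (r : seq I) (F : I -> H) w :
  d w (\sum_(i <- r) F i) = \sum_(i <- r) d w (F i).
Proof. by elim/big_rec2: _ => [|i y x _ <-]; rewrite ?d0r ?dDr. Qed.

Lemma d_self v : d v v = (nrm v ^+ 2)%:C.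
Proof. by rewrite -d_norm nrmE rmorphXn. Qed.

Lemma conj_Re (z : R[i]) : complex.Re (Num.conj z) = complex.Re z.
Proof. by case: z. Qed.

Lemma nrm_sqrD u v :
  nrm (u + v) ^+ 2 = nrm u ^+ 2 + nrm v ^+ 2 + 2 * complex.Re (d u v).
Proof.
have E := d_self (u + v); rewrite dDl !dDr !d_self (dC v u) in E.
have := congr1 (@complex.Re R) E; rewrite /= !cReD conj_Re /= => <-.
ring.
Qed.

Lemma parallelogram u v :
  nrm (u + v) ^+ 2 + nrm (u - v) ^+ 2 = 2 * nrm u ^+ 2 + 2 * nrm v ^+ 2.
Proof.
rewrite !nrm_sqrD nrmN -[- v]scaleN1r dZr rmorphN rmorph1 mulN1r cReN; ring.
Qed.

Lemma cauchy_schwarz u v : nrm (d u v) <= nrm u * nrm v.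
Proof.
have [->|v0] := eqVneq v 0; first by rewrite d0r nrm0 mulr_ge0 ?nrm_ge0.
have n0 : 0 < nrm v by exact: nrm_gt0.
rewrite -(@ler_pXn2r _ 2)// ?nnegrE ?mulr_ge0 ?nrm_ge0// exprMn.
pose t := d u v / (nrm v ^+ 2)%:C.
have nC : (nrm v ^+ 2)%:C != 0 :> R[i].
  by apply/eqP => /complexI/eqP; rewrite expf_eq0 /= gt_eqF.
have cn : Num.conj (nrm v ^+ 2)%:C = (nrm v ^+ 2)%:C.
  by apply: conj_Creal; rewrite complex_real.
have := d_self (u - t *: v).
rewrite dBl !dBr !dZl !dZr d_self (d_self v) (dC v u).
have ct : Num.conj t = Num.conj (d u v) / (nrm v ^+ 2)%:C.
  by rewrite /t rmorphM fmorphV /= cn.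
rewrite ct.
have -> : forall x : R[i], x - Num.conj (d u v) / (nrm v ^+ 2)%:C * d u v -
  (t * Num.conj (d u v) - t * (Num.conj (d u v) / (nrm v ^+ 2)%:C * (nrm v ^+ 2)%:C)) =
  x - d u v * Num.conj (d u v) / (nrm v ^+ 2)%:C.
  by move=> x; rewrite /t; move: (nrm v ^+ 2)%:C nC => n n1; field.
rewrite -normCK nrmE -rmorphXn -fmorphV -rmorphM -rmorphB /= => /complexI E.
have : 0 <= nrm u ^+ 2 - nrm (d u v) ^+ 2 / nrm v ^+ 2 by rewrite E sqr_ge0.
by rewrite subr_ge0 ler_pdivrMr// exprn_gt0.
Qed.

Lemma complete_lim (F : set_system H) : ProperFilter F ->
  (forall e : R, 0 < e -> exists x, F [set y | nrm (y - x) < e]) ->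
  exists p, forall e : R, 0 < e -> F [set y | nrm (y - p) < e].
Proof.
move=> FF Fc; have cF : cauchy F.
  apply: cauchy_exP => e e0; have er : e = (complex.Re e)%:C by rewrite RRe_real// gtr0_real.
  have e0' : 0 < complex.Re e by rewrite er ltcR in e0.
  have [x Fx] := Fc _ e0'; exists x; apply: filterS Fx => y /= yx.
  by rewrite -ball_normE /= er -opprB normrN nrmE ltcR.
have [p hp] := (cvg_ex _).1 (cauchy_cvg F cF).
exists p => e e0; have np : nbhs p [set y | nrm (y - p) < e].
  by apply: (nbhs_nrmP _ _).2; exists e.
exact: hp _ np.
Qed.

(** The vector [p] is the limit of a minimising filter of [J v = nrm v ^+ 2 - 2 * Re
    (lam v)] on [W]: the parallelogram identity makes it Cauchy, and the vanishing
    of the first variation at [p] is the representation of [lam]. The subspace [W]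
    may fail to be closed, so [p] lies only in its closure. *)
Lemma riesz_subspace (W : H -> Prop) (lam : H -> R[i]) (C : R) :
  W 0 -> (forall u v, W u -> W v -> W (u + v)) -> (forall a u, W u -> W (a *: u)) ->
  (forall u v, lam (u + v) = lam u + lam v) -> (forall a u, lam (a *: u) = a * lam u) ->
  (forall u, nrm (lam u) <= C * nrm u) ->
  exists p, (forall e : R, 0 < e -> exists2 w, W w & nrm (p - w) < e) /\
            forall u, W u -> lam u = d u p.
Proof.
move=> W0 WD WZ lamD lamZ lamC.
pose J v : R := nrm v ^+ 2 - 2 * complex.Re (lam v).
have Jlow v : - C ^+ 2 <= J v.
  have h1 : complex.Re (lam v) <= C * nrm v.
    by apply: le_trans (lamC v); apply: le_trans (nrm_Re _); exact: ler_norm.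
  have : 0 <= (nrm v - C) ^+ 2 by exact: sqr_ge0.
  by rewrite /J; nra.
pose S := [set J v | v in [set v | W v]].
have hS : has_inf S.
  by split; [exists (J 0), 0|exists (- C ^+ 2) => _ [v _ <-]].
pose I := inf S.
have Ile v : W v -> I <= J v by move=> Wv; apply: ge_inf; [case: hS|exists v].
have Iadh (e : R) : 0 < e -> exists2 v, W v & J v < I + e.
  by move=> e0; have [_ [v Wv <-] h] := inf_adherent e0 hS; exists v.
have Jpar u v : W u -> W v -> nrm (u - v) ^+ 2 <= 2 * (J u - I) + 2 * (J v - I).
  move=> Wu Wv; have := Ile _ (WZ (2^-1) _ (WD _ _ Wu Wv)).
  have P := parallelogram u v.
  rewrite /J lamZ lamD nrmZ (_ : 2^-1 = (2^-1)%:C); last by rewrite fmorphV rmorph_nat.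
  rewrite nrmC ger0_norm ?invr_ge0// exprMn cReM /= mul0r subr0 cReD.
  by rewrite (_ : (2^-1 : R) ^+ 2 = 4^-1); [lra|field].
pose F : set_system H := [set A | exists2 e : R, 0 < e & forall v, W v -> J v < I + e -> A v].
have FF : ProperFilter F.
  split; first by move=> [e e0 h]; have [v Wv Jv] := Iadh e e0; exact: h Jv.
  split.
  - by exists 1.
  - move=> P Q [e1 e10 h1] [e2 e20 h2]; exists (Num.min e1 e2).
      by rewrite lt_min e10.
    move=> v Wv Jv; have [m1 m2] : Num.min e1 e2 <= e1 /\ Num.min e1 e2 <= e2.
      by rewrite !ge_min !lexx orbT.
    by split; [apply: h1|apply: h2] => //; lra.
  - by move=> P Q PQ [e e0 h]; exists e => // v Wv Jv; apply/PQ/h.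
have [|p hp] := complete_lim FF.
  move=> e e0; have e2 : 0 < e ^+ 2 / 4 by rewrite divr_gt0// exprn_gt0.
  have [x Wx Jx] := Iadh _ e2; exists x; exists (e ^+ 2 / 4) => // v Wv Jv /=.
  rewrite -(@ltr_pXn2r _ 2)// ?nnegrE ?nrm_ge0 ?(ltW e0)//.
  by apply: le_lt_trans (Jpar _ _ Wv Wx) _; lra.
have near (e : R) : 0 < e -> exists v, [/\ W v, nrm (v - p) < e & J v < I + e].
  move=> e0; have [e1 e10 h] := hp e e0.
  have m0 : 0 < Num.min e e1 by rewrite lt_min e0.
  have [v Wv Jv] := Iadh _ m0; exists v.
  have [m1 m2] : Num.min e e1 <= e /\ Num.min e e1 <= e1 by rewrite !ge_min !lexx orbT.
  by split=> //; [apply: h => //; lra|lra].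
exists p; split; first by move=> e /near[v [Wv vp _]]; exists v; rewrite // nrmBC.
have main u : W u -> complex.Re (d u p) = complex.Re (lam u).
  move=> Wu; pose q := complex.Re (d u p) - complex.Re (lam u).
  (* the variation of [J] from [p] to [p + t *: u] *)
  have quad (t : R) : 0 <= 2 * t * q + t ^+ 2 * nrm u ^+ 2.
    apply/ler_addgt0Pr => e e0; rewrite addrC -lerBlDl sub0r.
    have K0 : 0 < 2 * `|t| * nrm u + 1 by rewrite ltr_wpDl// !mulr_ge0// nrm_ge0.
    pose e1 := e / (2 * `|t| * nrm u + 1).
    have e10 : 0 < e1 by rewrite divr_gt0.
    have e1E : 2 * `|t| * (nrm u * e1) + e1 = e.
      by rewrite /e1; field; rewrite gt_eqF.
    have [v [Wv vp Jv]] := near e1 e10.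
    have := Ile _ (WD _ _ Wv (WZ t%:C _ Wu)).
    rewrite /J nrm_sqrD lamD lamZ nrmZ nrmC exprMn real_normK ?num_real//.
    rewrite dZr (conj_Creal (_ : t%:C \is Num.real)) ?complex_real//.
    rewrite cReD !cReM /= !mul0r !subr0 => h.
    have h2 : complex.Re (d v u) = complex.Re (d u v) by rewrite dC conj_Re.
    rewrite h2 in h.
    have h3 : `|complex.Re (d u v) - complex.Re (d u p)| <= nrm u * e1.
      rewrite -cReB -dBr; apply: le_trans (nrm_Re _) _.
      by apply: le_trans (cauchy_schwarz _ _) _; rewrite ler_wpM2l ?nrm_ge0// ltW.
    have h4 : t * (complex.Re (d u v) - complex.Re (d u p)) <= `|t| * (nrm u * e1).
      by apply: le_trans (ler_norm _) _; rewrite normrM ler_wpM2l.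
    by rewrite /J in Jv; rewrite /q; lra.
  have K0 : 0 < nrm u ^+ 2 + 1 by rewrite ltr_wpDl// sqr_ge0.
  have := quad (- q / (nrm u ^+ 2 + 1)).
  rewrite (_ : _ + _ = - (q ^+ 2 * (nrm u ^+ 2 + 2)) / (nrm u ^+ 2 + 1) ^+ 2); last first.
    by field; rewrite gt_eqF.
  rewrite ler_pdivlMr ?exprn_gt0// mul0r oppr_ge0 => h.
  have q2 : 0 <= q ^+ 2 by exact: sqr_ge0.
  have n2 : 0 <= nrm u ^+ 2 by exact: sqr_ge0.
  have q0 : q ^+ 2 <= 0 by nra.
  have : q = 0 by apply/eqP; rewrite -sqrf_eq0 eq_le q0 q2.
  by rewrite /q; lra.
move=> u Wu; apply/eqP; rewrite eq_complex; apply/andP; split; apply/eqP.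
  by rewrite main.
have := main _ (WZ 'i%C _ Wu); rewrite lamZ dZl !cReM /= !mul0r !mul1r !sub0r.
by move=> /oppr_inj ->.
Qed.

Lemma riesz (lam : H -> R[i]) (C : R) :
  (forall u v, lam (u + v) = lam u + lam v) -> (forall a u, lam (a *: u) = a * lam u) ->
  (forall u, nrm (lam u) <= C * nrm u) -> exists p, forall u, lam u = d u p.
Proof.
move=> lD lZ lC.
have [//|//|p [_ h]] := @riesz_subspace (fun=> True) lam C I _ _ lD lZ lC.
by exists p => u; exact: h.
Qed.

(** As the Gram matrices agree, sending a finite combination of the [k t] to the
    same combination of the [k' t] is well defined and isometric. By totality [v] is
    a limit of such combinations, and [w] is the limit of their images. *)
Theorem gram_transfer (T : Type) (k k' : T -> H) :
  (forall s t, d (k s) (k t) = d (k' s) (k' t)) ->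
  (forall v, (forall t, d v (k t) = 0) -> v = 0) ->
  forall v, exists w, nrm w = nrm v /\ forall t, d w (k' t) = d v (k t).
Proof.
move=> gram total v.
(* formal linear combinations, so that the same [c] can be read with [k] and
   with [k'] *)
pose S (f : T -> H) (c : seq (R[i] * T)) := \sum_(x <- c) x.1 *: f x.2.
have SD f c c' : S f (c ++ c') = S f c + S f c' by rewrite /S big_cat.
have SZ f a c : S f [seq (a * x.1, x.2) | x <- c] = a *: S f c.
  by rewrite /S big_map scaler_sumr; apply: eq_bigr => x _; rewrite scalerA.
have dS c c' : d (S k c) (S k c') = d (S k' c) (S k' c').
  rewrite /S !dsuml; apply: eq_bigr => x _; rewrite !dsumr; apply: eq_bigr => y _.
  by rewrite !dZl !dZr gram.
have nS c : nrm (S k c) = nrm (S k' c).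
  apply/eqP; rewrite -(@eqrXn2 _ 2)// ?nrm_ge0//; apply/eqP/complexI.
  by rewrite -!d_self dS.
have nSB c c' : nrm (S k' c - S k' c') = nrm (S k c - S k c').
  have E f : S f c - S f c' = S f (c ++ [seq ((-1) * x.1, x.2) | x <- c']).
    by rewrite SD SZ scaleN1r.
  by rewrite !E nS.
have S1 f t : S f [:: (1, t)] = f t by rewrite /S big_seq1 scale1r.
have appr (e : R) : 0 < e -> exists c, nrm (v - S k c) < e.
  have [||||||p [hp ep]] := @riesz_subspace (fun u => exists c, u = S k c) (d^~ v) (nrm v).
  - by exists [::]; rewrite /S big_nil.
  - by move=> _ _ [c ->] [c' ->]; exists (c ++ c'); rewrite SD.
  - by move=> a _ [c ->]; exists [seq (a * x.1, x.2) | x <- c]; rewrite SZ.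
  - by move=> u w; exact: dDl.
  - by move=> a u; exact: dZl.
  - by move=> u; rewrite mulrC; exact: cauchy_schwarz.
  have vp : v = p.
    apply/eqP; rewrite -subr_eq0; apply/eqP/total => t.
    rewrite dC dBr -(ep (k t)); first by rewrite subrr conjC0.
    by exists [:: (1, t)]; rewrite S1.
  by move=> e0; have [_ [c ->] h] := hp e e0; exists c; rewrite vp.
pose F : set_system H := [set A | exists2 e : R, 0 < e &
  forall c, nrm (v - S k c) < e -> A (S k' c)].
have FF : ProperFilter F.
  split; first by move=> [e e0 h]; have [c hc] := appr e e0; exact: h hc.
  split.
  - by exists 1.
  - move=> P Q [e1 e10 h1] [e2 e20 h2]; exists (Num.min e1 e2).
      by rewrite lt_min e10.
    move=> c; rewrite lt_min => /andP[c1 c2].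
    by split; [exact: h1|exact: h2].
  - by move=> P Q PQ [e e0 h]; exists e => // c hc; apply/PQ/h.
have [|w hw] := complete_lim FF.
  move=> e e0; have e2 : 0 < e / 2 by rewrite divr_gt0.
  have [c0 hc0] := appr _ e2; exists (S k' c0), (e / 2) => // c hc /=.
  rewrite nSB; have := nrm_tri v (S k c) (S k c0); rewrite (nrmBC (S k c) v); lra.
have near (e : R) : 0 < e -> exists c, nrm (v - S k c) < e /\ nrm (S k' c - w) < e.
  move=> e0; have [e1 e10 h] := hw e e0.
  have m0 : 0 < Num.min e e1 by rewrite lt_min e0.
  have [c] := appr _ m0; rewrite lt_min => /andP[c1 c2].
  by exists c; split=> //; exact: h.
exists w; split.
  apply/eqP; rewrite eq_le; apply/andP; split; apply/ler_addgt0Pr => e e0;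
    have e2 : 0 < e / 2 by rewrite divr_gt0.
    have [c [h1 h2]] := near _ e2.
    have := nrm_subr w (S k' c); have := nrm_subr (S k c) v.
    by rewrite nS (nrmBC w) (nrmBC (S k c) v); lra.
  have [c [h1 h2]] := near _ e2.
  have := nrm_subr v (S k c); have := nrm_subr (S k' c) w.
  by rewrite nS; lra.
move=> t; apply/eqP; rewrite -subr_eq0; apply/eqP; apply: nrm_eps0 => e e0.
have K0 : 0 < nrm (k t) + nrm (k' t) + 1 by rewrite ltr_wpDl// addr_ge0// nrm_ge0.
pose e1 := e / (nrm (k t) + nrm (k' t) + 1).
have e10 : 0 < e1 by rewrite divr_gt0.
have e1E : e1 * (nrm (k t) + nrm (k' t) + 1) = e by rewrite /e1 divfK// gt_eqF.
have [c [h1 h2]] := near e1 e10.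
have -> : d w (k' t) - d v (k t) = d (w - S k' c) (k' t) - d (v - S k c) (k t).
  have := dS c [:: (1, t)]; rewrite !S1 => E.
  by rewrite !dBl E; ring.
apply: le_trans (nrmB _ _) _.
have a1 := cauchy_schwarz (w - S k' c) (k' t); have a2 := cauchy_schwarz (v - S k c) (k t).
rewrite (nrmBC w) in a1.
have b1 : nrm (S k' c - w) * nrm (k' t) <= e1 * nrm (k' t).
  by rewrite ler_wpM2r ?nrm_ge0// ltW.
have b2 : nrm (v - S k c) * nrm (k t) <= e1 * nrm (k t).
  by rewrite ler_wpM2r ?nrm_ge0// ltW.
by lra.
Qed.

End Hilbert.

(** * Polarisation along complex lines *)

Section Polarisation.
Context {R : realType} {H : completeNormedModType R[i]} (d : {dot H for Num.conj}).
Hypothesis d_norm : forall v, `|v| ^+ 2 = d v v.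
Implicit Types (u v w : H) (s t : R[i]).

(** The model of the evaluations of a space of sections along a complex line. As [d]
    is conjugate linear in its second argument, [k] is antiholomorphic. *)
Definition disc_family (ev : H -> R[i] -> R[i]) (k : R[i] -> H) (rho C : R) :=
  (forall v s, nrm s <= 2 * rho -> derivable (ev v) s 1) /\
  (forall s, nrm s <= 2 * rho -> nrm (k s) <= C /\ forall v, ev v s = d v (k s)).

(** The Taylor coefficients of [ev v] are unique, hence linear in [v], and bounded
    by Cauchy's estimates; so they are represented by vectors. The bound of the
    remainder is uniform in [v], which gives an estimate in norm. *)
Lemma kernel_taylor ev k (rho C : R) : 0 < rho -> disc_family ev k rho C ->
  exists c : nat -> H, forall T s, nrm s <= rho / 2 ->
    nrm (k s - \sum_(n < T) (Num.conj s ^+ n) *: c n) <= 8 * C * (nrm s / rho) ^+ T.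
Proof.
move=> rho0 [ev_diff ev_k].
have C0 : 0 <= C.
  have [h _] := ev_k 0 ltac:(by rewrite nrm0 mulr_ge0// ltW).
  by apply: le_trans h; exact: nrm_ge0.
have evC v s : nrm s <= 2 * rho -> nrm (ev v s) <= C * nrm v.
  move=> hs; have [h ->] := ev_k s hs; rewrite mulrC.
  apply: le_trans (cauchy_schwarz d_norm _ _) _.
  by rewrite ler_wpM2l// nrm_ge0.
have r20 : 0 < rho / 2 by rewrite divr_gt0.
have half s : nrm s <= rho / 2 -> nrm s <= 2 * rho by move=> ?; lra.
have expansion v : exists c : nat -> R[i],
    (forall n, nrm (c n) <= 8 * (C * nrm v) / rho ^+ n) /\
    forall T z, nrm z <= rho / 2 -> nrm (ev v z - \sum_(n < T) c n * z ^+ n) <=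
      8 * (C * nrm v) * (nrm z / rho) ^+ T.
  by have [c h1 h2] := taylor rho0 (ev_diff v) (evC v); exists c.
have [a ha] := choice expansion.
have aD u v n : a (u + v) n = a u n + a v n.
  move: n; apply: (@coef_unique _ _ _ (ev (u + v)) (8 * (C * nrm (u + v)))
    (8 * (C * nrm u) + 8 * (C * nrm v)) rho rho (rho / 2) r20) => T z hz.
    by have [_] := ha (u + v); exact.
  under eq_bigr => j _ do rewrite mulrDl.
  rewrite big_split /=.
  have -> : ev (u + v) z = ev u z + ev v z.
    have [_ kz] := ev_k z (half _ hz); by rewrite !kz dDl.
  have [_ /(_ T z hz) h1] := ha u; have [_ /(_ T z hz) h2] := ha v.
  rewrite opprD addrACA mulrDl; apply: le_trans (nrmD _ _) _; exact: lerD.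
have aZ (b : R[i]) v n : a (b *: v) n = b * a v n.
  move: n; apply: (@coef_unique _ _ _ (ev (b *: v)) (8 * (C * nrm (b *: v)))
    (nrm b * (8 * (C * nrm v))) rho rho (rho / 2) r20) => T z hz.
    by have [_] := ha (b *: v); exact.
  under eq_bigr => j _ do rewrite -mulrA.
  rewrite -mulr_sumr.
  have -> : ev (b *: v) z = b * ev v z.
    have [_ kz] := ev_k z (half _ hz); by rewrite !kz dZl.
  have [_ /(_ T z hz) h1] := ha v.
  by rewrite -mulrBr nrmM -mulrA ler_wpM2l ?nrm_ge0.
have repr n : exists p, forall v, a v n = d v p.
  apply: (@riesz R H d d_norm (fun v => a v n) (8 * C / rho ^+ n)) => // v.
  by apply: le_trans ((ha v).1 n) _; rewrite mulrA mulrAC.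
have [c hc] := choice repr.
exists c => T s hs; set kT := \sum_(n < T) _.
have E v : d v (k s - kT) = ev v s - \sum_(n < T) a v n * s ^+ n.
  have [_ kz] := ev_k s (half _ hs).
  rewrite dBr kz dsumr; congr (_ - _); apply: eq_bigr => n _.
  by rewrite dZr rmorphXn /= conjCK hc mulrC.
have [->|n0] := eqVneq (k s - kT) 0.
  by rewrite nrm0 mulr_ge0 ?mulr_ge0// exprn_ge0// divr_ge0 ?nrm_ge0// ltW.
have np : 0 < nrm (k s - kT) by exact: nrm_gt0.
have [_ /(_ T s hs)] := ha (k s - kT).
rewrite -E d_self// nrmC ger0_norm ?sqr_ge0//.
rewrite (_ : 8 * _ * _ = nrm (k s - kT) * (8 * C * (nrm s / rho) ^+ T)); last by ring.
by rewrite expr2 ler_pM2l.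
Qed.

(** On the diagonal, [d (k s) (k s)] expands into a power series in [s] and its
    conjugate whose coefficients are the scalar products of the Taylor coefficients
    of [k]. By [hermitian_coef0] they are determined by the values on the diagonal,
    and they determine [d (k s) (k t)]. *)
Theorem polar_slice ev ev' k k' (rho C : R) : 0 < rho ->
  disc_family ev k rho C -> disc_family ev' k' rho C ->
  (forall s, nrm s <= rho / 2 -> nrm (k s) = nrm (k' s)) ->
  forall s t, nrm s <= rho / 2 -> nrm t <= rho / 2 -> d (k s) (k t) = d (k' s) (k' t).
Proof.
move=> rho0 F F' nk.
have C0 : 0 <= C.
  have [h _] := F.2 0 ltac:(by rewrite nrm0 mulr_ge0// ltW).
  by apply: le_trans h; exact: nrm_ge0.
have half s : nrm s <= rho / 2 -> nrm s <= 2 * rho by move=> ?; lra.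
have [c hc] := kernel_taylor rho0 F; have [c' hc'] := kernel_taylor rho0 F'.
pose kT (c : nat -> H) T s := \sum_(n < T) (Num.conj s ^+ n) *: c n.
have dkT b T s t : d (kT b T s) (kT b T t) =
    \sum_(n < T) \sum_(m < T) d (b m) (b n) * t ^+ n * Num.conj s ^+ m.
  rewrite /kT dsumr; apply: eq_bigr => n _; rewrite dsuml; apply: eq_bigr => m _.
  by rewrite dZr dZl rmorphXn /= conjCK; ring.
have pow1 T s : nrm s <= rho / 2 -> (nrm s / rho) ^+ T <= 1.
  move=> hs; rewrite exprn_ile1 ?divr_ge0 ?nrm_ge0 ?(ltW rho0)//.
  by rewrite ler_pdivrMr// mul1r; lra.
have pow0 T s : 0 <= (nrm s / rho) ^+ T.
  by rewrite exprn_ge0// divr_ge0 ?nrm_ge0// ltW.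
have appr e kk b T s t : disc_family e kk rho C ->
    (forall T s, nrm s <= rho / 2 -> nrm (kk s - kT b T s) <= 8 * C * (nrm s / rho) ^+ T) ->
    nrm s <= rho / 2 -> nrm t <= rho / 2 ->
    nrm (d (kk s) (kk t) - d (kT b T s) (kT b T t)) <=
      80 * C ^+ 2 * ((nrm s / rho) ^+ T + (nrm t / rho) ^+ T).
  move=> [_ kkC] hb hs ht.
  have [ks _] := kkC s (half _ hs); have [kt _] := kkC t (half _ ht).
  have ns : nrm (kT b T s) <= 9 * C.
    have h1 := hb T s hs.
    have h2 : 8 * C * (nrm s / rho) ^+ T <= 8 * C * 1 by rewrite ler_wpM2l ?mulr_ge0// pow1.
    by have := nrm_subr (kT b T s) (kk s); rewrite nrmBC; lra.
  have -> : d (kk s) (kk t) - d (kT b T s) (kT b T t) =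
      d (kk s - kT b T s) (kk t) + d (kT b T s) (kk t - kT b T t).
    by rewrite dBl dBr; ring.
  apply: le_trans (nrmD _ _) _.
  have h1 : nrm (d (kk s - kT b T s) (kk t)) <= 8 * C * (nrm s / rho) ^+ T * C.
    apply: le_trans (cauchy_schwarz d_norm _ _) _.
    by apply: ler_pM; rewrite ?nrm_ge0// hb.
  have h2 : nrm (d (kT b T s) (kk t - kT b T t)) <= 9 * C * (8 * C * (nrm t / rho) ^+ T).
    apply: le_trans (cauchy_schwarz d_norm _ _) _.
    by apply: ler_pM; rewrite ?nrm_ge0// hb.
  have p1 : 0 <= C ^+ 2 * (nrm s / rho) ^+ T by rewrite mulr_ge0// sqr_ge0.
  have p2 : 0 <= C ^+ 2 * (nrm t / rho) ^+ T by rewrite mulr_ge0// sqr_ge0.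
  by lra.
have r20 : 0 < rho / 2 by rewrite divr_gt0.
(* equality of norms on the diagonal passes to the Taylor coefficients *)
have gram n m : d (c m) (c n) = d (c' m) (c' n).
  apply/eqP; rewrite -subr_eq0; apply/eqP.
  apply: (@hermitian_coef0 R (n + m).+1 (fun n m => d (c m) (c n) - d (c' m) (c' n))
    (320 * C ^+ 2 / rho ^+ (n + m).+1) _ r20) => // s hs.
  set T := (n + m).+1.
  have -> : \sum_(i < T) \sum_(j < T) (d (c j) (c i) - d (c' j) (c' i)) * s ^+ i * Num.conj s ^+ j
      = d (kT c T s) (kT c T s) - d (kT c' T s) (kT c' T s).
    rewrite !dkT -sumrB; apply: eq_bigr => i _; rewrite -sumrB; apply: eq_bigr => j _.
    by ring.
  have E : d (k s) (k s) = d (k' s) (k' s) by rewrite !d_self// nk.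
  have -> : d (kT c T s) (kT c T s) - d (kT c' T s) (kT c' T s) =
     (d (k' s) (k' s) - d (kT c' T s) (kT c' T s)) - (d (k s) (k s) - d (kT c T s) (kT c T s)).
    by rewrite E; ring.
  apply: le_trans (nrmB _ _) _.
  have h1 := appr _ _ _ T s s F hc hs hs; have h2 := appr _ _ _ T s s F' hc' hs hs.
  rewrite (_ : 320 * _ / _ * _ = 320 * C ^+ 2 * (nrm s / rho) ^+ T); first by lra.
  by rewrite expr_div_n; ring.
move=> s t hs ht; apply/eqP; rewrite -subr_eq0; apply/eqP; apply: nrm_eps0 => e e0.
have [T hT] := half_pow_lt (320 * C ^+ 2) e0.
have h1 := appr _ _ _ T s t F hc hs ht; have h2 := appr _ _ _ T s t F' hc' hs ht.
have E : d (kT c T s) (kT c T t) = d (kT c' T s) (kT c' T t).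
  by rewrite !dkT; apply: eq_bigr => n _; apply: eq_bigr => m _; rewrite gram.
rewrite (_ : _ - _ = (d (k s) (k t) - d (kT c T s) (kT c T t)) -
  (d (k' s) (k' t) - d (kT c' T s) (kT c' T t))); last by rewrite E; ring.
apply: le_trans (nrmB _ _) _.
have pw (z : R[i]) : nrm z <= rho / 2 -> (nrm z / rho) ^+ T <= (2 ^+ T)^-1.
  move=> hz; rewrite -exprVn; apply: lerXn2r; rewrite ?nnegrE ?invr_ge0//.
    by rewrite divr_ge0 ?nrm_ge0// ltW.
  by rewrite ler_pdivrMr// mulrC; lra.
have := ler_wpM2l (sqr_ge0 C) (pw s hs); have := ler_wpM2l (sqr_ge0 C) (pw t ht).
by lra.
Qed.

End Polarisation.

(** * Comparison of two families of sections *)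

Section SectionFamilies.
Context {R : realType} {N : nat} {D : set 'rV[R[i]]_N} (L : line_bundle D).
Local Notation Cn := 'rV[R[i]]_N.
Hypothesis D_domain : is_domain D.
Implicit Types (i j : lb_chart L) (z : D).

Definition fcoord i z (v : lb_fiber L z) : R[i] := lb_triv i z v.

(** Agreement near a point is a locally constant condition: by [slice_small] with
    arbitrarily small [e], a bounded holomorphic function vanishing near [y]
    vanishes on a ball whose radius is the same for all such [y]. *)
Lemma holomorphic_section_identity (s s' : sections L) (w : D) (r0 : R) : 0 < r0 ->
  holomorphic_section s -> holomorphic_section s' ->
  (forall z, nrm (val z - val w : Cn) < r0 -> s z = s' z) -> forall z, s z = s' z.
Proof.
move=> r00 hs hs' near_w.
have [_ oD cD] := D_domain.
pose P (x : Cn) := exists2 r : R, 0 < r & forall z, nrm (val z - x) < r -> s z = s' z.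
suff H x : D x -> P x.
  by move=> z; have [r rp h] := H _ (val_in z); apply: h; rewrite subrr nrm0.
apply: (@connected_locally_constant R Cn D P (val w)) => //; [exact: val_in|by exists r0|].
move=> {}x Dx; have [i ix] := lb_cover L (pt Dx).
have [F hF] := hs i; have [F' hF'] := hs' i.
have dF : differentiable (F \- F') x.
  by apply: differentiableB; [exact: (hF _ ix).1|exact: (hF' _ ix).1].
have [e1 e10 h1] := (open_nrmP D).1 oD x Dx.
have [e2 e20 h2] := (open_subP _).1 (@lb_open _ _ _ L i) _ ix.
pose M := nrm ((F \- F') x) + 1.
have nM : nbhs ((F \- F') x) [set c : R[i] | nrm (c - (F \- F') x) < 1].
  by apply: (nbhs_nrmP _ _).2; exists 1.
have /nbhs_nrmP[e3 e30 h3] := differentiable_continuous dF nM.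
pose r := Num.min (Num.min e1 e2) e3.
have rP (y : Cn) : nrm (y - x) < r -> exists2 Dy : D y, lb_dom i (pt Dy) &
    nrm ((F \- F') y) <= M.
  rewrite !lt_min => /andP[/andP[y1 y2] y3].
  exists (h1 y y1); first exact: h2.
  by have := h3 y y3; have := nrm_subr ((F \- F') y) ((F \- F') x); rewrite /= /M; lra.
have rp : 0 < r by rewrite !lt_min e10 e20.
exists (r / 16) => [|y y' Dy Dy' yx y'x [del del0 hy]]; first by rewrite divr_gt0.
exists (r / 16 - nrm (y' - x)); first by rewrite subr_gt0.
move=> z zy'.
have zx : nrm (val z - x : Cn) < r / 16 by have := nrm_tri y' (val z) x; lra.
have zr : nrm (val z - x : Cn) < r by apply: lt_trans zx _; rewrite ltr_pdivrMr// ltr_pMr// ltr1n.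
have [Dz iz _] := rP _ zr; rewrite pt_val in iz.
apply: (can_inj (lb_trivK iz)); rewrite -[LHS](hF z iz).2 -[RHS](hF' z iz).2.
apply/eqP; rewrite -subr_eq0; apply/eqP; apply: nrm_eps0 => e e0.
have [eta eta0 hsl] := @slice_small R Cn M e r del e0 rp del0.
have bF : bounded_holo (F \- F') x r M.
  move=> u ux; have [Du iu Mu] := rP u ux; split; last exact: Mu.
  exact: (differentiableB (hF _ iu).1 (hF' _ iu).1).
have sF u : nrm (u - x) < r -> nrm (u - y) < del -> nrm ((F \- F') u) <= eta.
  move=> ux uy; have [Du iu Mu] := rP u ux.
  rewrite /= [F u](hF _ iu).2 [F' u](hF' _ iu).2 (hy (pt Du) uy).
  by rewrite subrr nrm0 ltW.
exact: hsl bF y yx sF (val z) zx.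
Qed.

Context {H : completeNormedModType R[i]} (d : {dot H for Num.conj}).
Hypothesis d_norm : forall v, `|v| ^+ 2 = d v v.

(** The features that the inclusion of a reproducing kernel Hilbert space shares
    with its translates under the group. *)
Record hilbert_family (sg : H -> sections L) := HilbertFamily {
  hf_linear : forall (a : R[i]) u v z, sg (a *: u + v) z = a *: sg u z + sg v z;
  hf_holo : forall v, holomorphic_section (sg v);
  hf_bound : forall i z, lb_dom i z -> exists r C : R, 0 < r /\
    forall y : D, nrm (val y - val z : Cn) < r -> lb_dom i y /\
      forall v, nrm (fcoord i (sg v y)) <= C * nrm v }.

Lemma family_kernel sg : hilbert_family sg -> exists k : lb_chart L * D -> H,
  forall i z, lb_dom i z -> forall v, fcoord i (sg v z) = d v (k (i, z)).
Proof.
move=> hsg; suff ex (p : lb_chart L * D) :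
    exists k, lb_dom p.1 p.2 -> forall v, fcoord p.1 (sg v p.2) = d v k.
  by have [k hk] := choice ex; exists k => i z; exact: hk (i, z).
case: p => i z /=; have [iz|niz] := pselect (lb_dom i z); last by exists 0.
have [r [C [r0 hC]]] := hf_bound hsg iz.
have zz : nrm (val z - val z : Cn) < r by rewrite subrr nrm0.
have [_ bz] := hC z zz.
have sg0 : sg 0 z = 0.
  have := hf_linear hsg (-1) 0 0 z; rewrite scaleN1r oppr0 add0r => {1}->.
  by rewrite scaleN1r addNr.
have [||//|k hk] := @riesz R H d d_norm (fun v => fcoord i (sg v z)) C.
- move=> u v; have := hf_linear hsg 1 u v z; rewrite !scale1r => ->.
  by rewrite /fcoord linearD.
- move=> a u; have := hf_linear hsg a u 0 z; rewrite addr0 sg0 addr0 => ->.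
  by rewrite /fcoord linearZ.
by exists k.
Qed.

Lemma kernel_norm_le (sg : H -> sections L) i z k (C : R) :
  (forall v, fcoord i (sg v z) = d v k) -> (forall v, nrm (fcoord i (sg v z)) <= C * nrm v) ->
  0 <= C -> nrm k <= C.
Proof.
move=> hk hC C0; have [->|k0] := eqVneq k 0; first by rewrite nrm0.
have := hC k; rewrite hk d_self// nrmC ger0_norm ?sqr_ge0// expr2.
by rewrite ler_pM2r// nrm_gt0.
Qed.

(** The line through [w] is parametrised so that the disc of radius 4 is mapped into
    the ball where the evaluations are bounded; the points [Y s] are those of the
    line, as elements of [D]. *)
Lemma family_slice (sg : H -> sections L) k i (w : D) (r C : R) : hilbert_family sg ->
  (forall i z, lb_dom i z -> forall v, fcoord i (sg v z) = d v (k (i, z))) -> 0 <= C ->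
  (forall y : D, nrm (val y - val w : Cn) < r -> lb_dom i y /\
      forall v, nrm (fcoord i (sg v y)) <= C * nrm v) ->
  forall (x : Cn) (Y : R[i] -> D),
  (forall s, nrm s <= 4 -> val (Y s) = val w + s *: x :> Cn) ->
  4 * nrm x < r ->
  exists ev, disc_family d ev (fun s => k (i, Y s)) 2 C.
Proof.
move=> hsg hk C0 hr x Y hY xr.
have [F hF] := choice (fun v => hf_holo hsg v i).
have inY s : nrm s <= 4 -> nrm (val (Y s) - val w : Cn) < r.
  move=> s4; rewrite hY// addrAC subrr add0r nrmZ.
  by apply: le_lt_trans xr; rewrite ler_wpM2r// nrm_ge0.
have e4 : 2 * 2 = 4 :> R by rewrite -natrM.
exists (fun v s => F v (val w + s *: x)); split; rewrite e4.
  move=> v s s4; have [iY _] := hr _ (inY s s4).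
  by apply: derivable_slice; rewrite -hY//; exact: (hF v _ iY).1.
move=> s s4; have [iY bY] := hr _ (inY s s4); split.
  exact: kernel_norm_le (hk _ _ iY) bY C0.
by move=> v; rewrite -hY// (hF v _ iY).2; exact: hk.
Qed.

Section Transfer.
Variables (sg sg' : H -> sections L).
Hypotheses (Fsg : hilbert_family sg) (Fsg' : hilbert_family sg').
Hypothesis sg_inj : forall v, (forall z, sg v z = 0) -> v = 0.
Hypothesis dom1 : forall i z, lb_dom i z -> forall v : H, exists w : H,
  nrm w = nrm v /\ nrm (fcoord i (sg v z)) = nrm (fcoord i (sg' w z)).
Hypothesis dom2 : forall i z, lb_dom i z -> forall v : H, exists w : H,
  nrm w = nrm v /\ nrm (fcoord i (sg' v z)) = nrm (fcoord i (sg w z)).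

Lemma kernel_norm_dom (f g : H -> sections L) i z k k' :
  (forall v, fcoord i (f v z) = d v k) ->
  (forall v, fcoord i (g v z) = d v k') ->
  (forall v : H, exists w : H,
    nrm w = nrm v /\ nrm (fcoord i (f v z)) = nrm (fcoord i (g w z))) ->
  nrm k <= nrm k'.
Proof.
move=> fk gk h; apply: (@kernel_norm_le f i z) => //; last exact: nrm_ge0.
move=> v; have [w [<- ->]] := h v; rewrite gk mulrC; exact: cauchy_schwarz.
Qed.

(** The hypotheses say that the kernels [k] and [k'] of the two families have the
    same norms. By [polar_slice] their scalar products agree near the diagonal. As
    [sg (k (i, w))] and [sg' (k' (i, w))] are holomorphic sections, these products
    agree everywhere, and [gram_transfer] applies. *)
Theorem family_transfer v : exists w, nrm w = nrm v /\ forall z, sg' w z = sg v z.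
Proof.
have [k hk] := family_kernel Fsg; have [k' hk'] := family_kernel Fsg'.
have nk i z : lb_dom i z -> nrm (k (i, z)) = nrm (k' (i, z)).
  move=> iz; apply/eqP; rewrite eq_le.
  rewrite (kernel_norm_dom (hk _ _ iz) (hk' _ _ iz) (dom1 iz)).
  by rewrite (kernel_norm_dom (hk' _ _ iz) (hk _ _ iz) (dom2 iz)).
have [_ oD cD] := D_domain.
have near_gram i (w : D) : lb_dom i w -> exists2 r : R, 0 < r & forall z,
    nrm (val z - val w : Cn) < r ->
    lb_dom i z /\ d (k (i, w)) (k (i, z)) = d (k' (i, w)) (k' (i, z)).
  move=> iw; have [r [C [r0 hr]]] := hf_bound Fsg iw.
  have [r' [C' [r'0 hr']]] := hf_bound Fsg' iw.
  have [e e0 he] := (open_nrmP D).1 oD _ (val_in w).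
  pose q := Num.min (Num.min r r') e.
  have q0 : 0 < q by rewrite !lt_min r0 r'0.
  have [q1 q2 q3] : [/\ q <= r, q <= r' & q <= e].
    by split; rewrite !ge_min lexx ?orbT.
  pose CC := Num.max 0 (Num.max C C').
  have CC0 : 0 <= CC by rewrite le_max lexx.
  have CC1 : C <= CC by rewrite !le_max lexx orbT.
  have CC2 : C' <= CC by rewrite !le_max lexx !orbT.
  (* so that parameters of modulus at most 4 stay in the ball of radius [q] *)
  exists (q / 5); first by rewrite divr_gt0.
  move=> z zw; pose x : Cn := val z - val w.
  have xq : 4 * nrm x < q by move: zw; rewrite -/x; have := nrm_ge0 x; lra.
  have xsmall (s : R[i]) : nrm s <= 4 -> nrm (s *: x) < q.
    move=> s4; rewrite nrmZ; apply: le_lt_trans xq.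
    by rewrite ler_wpM2r// nrm_ge0.
  have exY (s : R[i]) : exists y : D, nrm s <= 4 -> val y = val w + s *: x :> Cn.
    have [s4|ns4] := pselect (nrm s <= 4); last by exists w.
    have Du : D (val w + s *: x).
      by apply: he; rewrite addrAC subrr add0r; have := xsmall s s4; lra.
    by exists (pt Du).
  have [Y hY] := choice exY.
  have bq (y : D) : nrm (val y - val w : Cn) < q -> lb_dom i y /\
      forall v, nrm (fcoord i (sg v y)) <= CC * nrm v.
    move=> yq; have [iy b] := hr y ltac:(lra); split=> // u.
    by apply: le_trans (b u) _; rewrite ler_wpM2r// nrm_ge0.
  have bq' (y : D) : nrm (val y - val w : Cn) < q -> lb_dom i y /\
      forall v, nrm (fcoord i (sg' v y)) <= CC * nrm v.
    move=> yq; have [iy b] := hr' y ltac:(lra); split=> // u.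
    by apply: le_trans (b u) _; rewrite ler_wpM2r// nrm_ge0.
  have [ev hev] := family_slice Fsg hk CC0 bq hY xq.
  have [ev' hev'] := family_slice Fsg' hk' CC0 bq' hY xq.
  have [iz _] := bq z ltac:(rewrite -/x; have := nrm_ge0 x; lra).
  split=> //.
  have Y0 : Y 0 = w by apply: val_inj; rewrite hY ?nrm0// scale0r addr0.
  have Y1 : Y 1 = z.
    by apply: val_inj; rewrite hY ?nrm1 ?ler1n// scale1r addrC subrK.
  have := @polar_slice R H d d_norm ev ev' _ _ 2 CC (ltr0Sn R 1) hev hev' _ 0 1.
  rewrite nrm0 nrm1 divff// ler01 lexx Y0 Y1; apply => //.
  move=> s s1; apply: nk; apply: (bq _ _).1; rewrite hY; last by lra.
  by rewrite addrAC subrr add0r; apply: xsmall; lra.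
(* the kernels are meaningful only for charts defined at the point *)
pose T := {p : lb_chart L * D | lb_dom p.1 p.2}.
have gram (s t : T) : d (k (sval s)) (k (sval t)) = d (k' (sval s)) (k' (sval t)).
  case: s t => [[i w] /= iw] [[j z] /= jz].
  have [r r0 hr] := near_gram i w iw.
  have E := @holomorphic_section_identity _ _ w r r0
    (hf_holo Fsg (k (i, w))) (hf_holo Fsg' (k' (i, w))).
  rewrite -!(hk j z jz) -!(hk' j z jz) E// => y yw.
  have [iy gy] := hr y yw; apply: (can_inj (lb_trivK iy)).
  by have := hk i y iy (k (i, w)); rewrite gy -(hk' i y iy).
have total u : (forall t : T, d u (k (sval t)) = 0) -> u = 0.
  move=> h; apply: sg_inj => z; have [j jz] := lb_cover L z.
  apply: (can_inj (lb_trivK jz)); rewrite linear0.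
  by have := h (exist _ (j, z) jz); rewrite /= -(hk j z jz).
have [w [nw hw]] := gram_transfer d_norm gram total v.
exists w; split=> // z; have [j jz] := lb_cover L z.
apply: (can_inj (lb_trivK jz)).
by have := hw (exist _ (j, z) jz); rewrite /= -(hk j z jz) -(hk' j z jz).
Qed.

End Transfer.
End SectionFamilies.

(** * Translation of the Hilbert space by the group *)

Section Local.
Context {R : realType}.

Lemma differentiable_near (V W : normedModType R[i]) (F F' : V -> W) x (r : R) : 0 < r ->
  (forall y, nrm (y - x) < r -> F' y = F y) -> differentiable F x -> differentiable F' x.
Proof.
move=> r0 FF' dF.
have Ex : F' x = F x by apply: FF'; rewrite subrr nrm0.
have [dc de] := (diff_locallyP x F).1 dF.
have E : F' \o shift x = cst (F' x) + 'd F x +o_ (0 : V) id.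
  apply/eqaddoP => e e0.
  have nf := (eqaddoP _ _ _ _).1 de e e0.
  have nr : nbhs (0 : V) [set h | nrm h < r].
    by apply: (nbhs_nrmP (0 : V) _).2; exists r => // w; rewrite subr0.
  apply: filterS2 nr nf => h hr /=; rewrite !fctE /= Ex FF'//.
  by rewrite addrK.
have D : 'd F' x = 'd F x :> (V -> W) by exact: diff_unique.
by apply: (diff_locallyP x F').2; rewrite D.
Qed.

Context {N : nat} {D : set 'rV[R[i]]_N}.
Local Notation Cn := 'rV[R[i]]_N.

(** A single function on C^N is provided by the extension of [f] by 0, which is
    differentiable where [f] is because [D] is open. *)
Lemma holomorphic_on_local (W : normedModType R[i]) (U : set D) (f : D -> W) : open D ->
  (forall z, U z -> exists (F : Cn -> W) (r : R), [/\ 0 < r, differentiable F (val z) &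
     forall y : D, nrm (val y - val z : Cn) < r -> F (val y) = f y]) ->
  holomorphic_on U f.
Proof.
move=> oD H.
pose F (x : Cn) : W := match pselect (D x) with left Dx => f (pt Dx) | right _ => 0 end.
have FE z : F (val z) = f z.
  rewrite /F; case: pselect => [Dz|nD]; first by rewrite pt_val.
  by case: nD; exact: val_in.
exists F => z Uz; split; last exact: FE.
have [G [r [r0 dG hG]]] := H z Uz.
have [e e0 he] := (open_nrmP D).1 oD _ (val_in z).
apply: (@differentiable_near _ _ G F _ (Num.min r e)) => //; first by rewrite lt_min r0.
move=> y; rewrite lt_min => /andP[yr ye]; have Dy := he y ye.
by rewrite [LHS](FE (pt Dy)) -hG.
Qed.

Lemma compact_subball (z : D) (r : R) : (forall x : Cn, nrm (x - val z) <= r -> D x) ->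
  compact [set y : D | nrm (val y - val z : Cn) <= r].
Proof.
move=> rD F FF FK.
have [|p [/= pz hp]] := @compact_cball R N (val z) r ((fun y : D => val y : Cn) @ F) _.
  exact: FK.
exists (pt (rD p pz)); split=> // A B FA /nbhs_subP[e e0 he].
have sA : A `<=` (fun y : D => val y : Cn) @^-1` ((fun y : D => val y : Cn) @` A).
  by move=> y Ay; exists y.
have FA' : ((fun y : D => val y : Cn) @ F) ((fun y : D => val y : Cn) @` A).
  exact: (filterS sA FA).
have np : nbhs p [set x | nrm (x - p) < e] by apply: (nbhs_nrmP _ _).2; exists e.
have [_ [[y Ay <-] /= ye]] := hp _ _ FA' np.
by exists y; split=> //; exact: he.
Qed.

End Local.

Section Conclusion.
Context {R : realType} {N : nat} {D : set 'rV[R[i]]_N} (L : line_bundle D).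
Local Notation Cn := 'rV[R[i]]_N.
Hypothesis D_domain : is_domain D.
Implicit Types (i j : lb_chart L) (z : D).

Lemma in_total_inj z : injective (@in_total _ _ _ L z).
Proof.
move=> v w E; have := projT2_eq E.
by rewrite (Prop_irrelevance (projT1_eq E) erefl).
Qed.

Lemma in_total_eq_rect y z (e : y = z) (v : lb_fiber L y) :
  in_total (eq_rect y (lb_fiber L) v z e) = in_total v.
Proof. by case: _ / e. Qed.

Lemma in_total_section (s : sections L) y z : y = z -> in_total (s y) = in_total (s z).
Proof. by move=> ->. Qed.

(** By continuity of the inclusion at 0, the sections of small norm map a compact
    neighbourhood of [z] into the vectors of modulus less than 1; by homogeneity
    this bounds the evaluations. *)
Lemma rk_incl_family (H : rkhs L) : hilbert_family (@rk_incl _ _ _ _ H).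
Proof.
have [_ oD _] := D_domain.
split; [exact: rk_linear|exact: rk_holo|].
move=> i z iz.
have [e1 e10 h1] := (open_nrmP D).1 oD _ (val_in z).
have [e2 e20 h2] := (open_subP _).1 (@lb_open _ _ _ L i) _ iz.
pose r := Num.min e1 e2 / 2.
have m0 : 0 < Num.min e1 e2 by rewrite lt_min e10.
have [m1 m2] : Num.min e1 e2 <= e1 /\ Num.min e1 e2 <= e2.
  by rewrite !ge_min !lexx orbT.
have r0 : 0 < r by rewrite divr_gt0.
have rE : 2 * r = Num.min e1 e2 by rewrite /r; field.
pose K := [set y : D | nrm (val y - val z : Cn) <= r].
have cK : compact K.
  by apply: compact_subball => x xr; apply: h1; lra.
have Ki y : K y -> lb_dom i y by move=> yr; apply: h2; rewrite /K /= in yr; lra.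
pose ev (v : rk_space H) : {compact-open, D -> total L} := section_map (rk_incl v).
have oO := compact_open_open cK (@tube_open _ _ _ L i 1).
have lin0 y : rk_incl (0 : rk_space H) y = 0.
  have := rk_linear (-1) (0 : rk_space H) 0 y; rewrite scaleN1r oppr0 add0r => {1}->.
  by rewrite scaleN1r addNr.
have O0 : ev 0 @` K `<=` tube i 1.
  move=> _ [y Ky <-]; split; first exact: Ki.
  by rewrite /tmod /tcoord /= lin0 linear0 nrm0.
have nO := open_nbhs_nbhs (conj oO O0).
have /nbhs_nrmP[d d0 hd] := @rk_continuous _ _ _ _ H 0 _ nO.
exists r, (2 / d); split=> // y yr.
have Ky : K y by exact: ltW.
split; first exact: Ki.
move=> v; have [->|v0] := eqVneq v 0.
  by rewrite /fcoord lin0 linear0 !nrm0 mulr0.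
have nv : 0 < nrm v by exact: nrm_gt0.
pose a : R := d / (2 * nrm v).
have a0 : 0 < a by rewrite divr_gt0// mulr_gt0.
have anv : a * nrm v = d / 2 by rewrite /a; field; rewrite gt_eqF.
have := hd (a%:C *: v); rewrite subr0 nrmZ nrmC gtr0_norm// anv.
move=> /(_ ltac:(lra))/(_ (section_map (rk_incl (a%:C *: v)) y)) [|_].
  by exists y.
rewrite /tmod /tcoord /= -[a%:C *: v]addr0 rk_linear lin0 addr0 lb_triv_scale.
rewrite nrmM nrmC gtr0_norm// => h.
rewrite -(ler_pM2l a0) (_ : a * (2 / d * nrm v) = 1) ?ltW//.
by rewrite mulrCA anv; field; rewrite gt_eqF.
Qed.

Variables (G : set (Aut D)) (E : equivariant_structure G L).
Hypothesis G_subgroup : subgroup_set G.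
Local Notation act := (total_act (eq_act E)).

Lemma lrep_total g (s : sections L) z :
  in_total (lrep E g s z) = act g (in_total (s ((g^-1)%g z))).
Proof. exact: in_total_eq_rect. Qed.

Lemma fcoord_lrep i j k (s : sections L) z : G k -> lb_dom j ((k^-1)%g z) ->
  fcoord i (lrep E k s z) =
  fcoord j (s ((k^-1)%g z)) * tcoord i (act k (frame j ((k^-1)%g z))).
Proof.
move=> Gk jz; rewrite -[LHS]/(tcoord i (in_total (lrep E k s z))) lrep_total.
exact: tcoord_act.
Qed.

(** In local charts, [l(k) s] is the product of [s] and of the holomorphic factor of
    the action, both composed with [k^-1]. *)
Lemma lrep_holomorphic k (s : sections L) : G k -> holomorphic_section s ->
  holomorphic_section (lrep E k s).
Proof.
move=> Gk hs i; have [_ oD _] := D_domain.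
apply: holomorphic_on_local => // z iz.
have [j jz] := lb_cover L ((k^-1)%g z).
have [g hg] := aut_fun_holo (k^-1)%g.
have [F hF] := hs j; have [h hh] := eq_act_holo E j i Gk.
have kz x : k ((k^-1)%g x) = x by exact: aut_mulVK.
have cg := aut_continuous (g := (k^-1)%g) (open_nbhs_nbhs (conj (@lb_open _ _ _ L j) jz)).
have [e1 e10 h1] := (nbhs_subP _ _).1 cg.
have [e2 e20 h2] := (open_subP _).1 (@lb_open _ _ _ L i) _ iz.
exists (fun x => F (g x) * h (g x)), (Num.min e1 e2).
have jiz y : lb_dom i y -> lb_dom j ((k^-1)%g y) ->
    (lb_dom j `&` k @^-1` lb_dom i) ((k^-1)%g y).
  by move=> iy jy; split=> //; rewrite /preimage /= kz.
split; first by rewrite lt_min e10.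
  have [dg eg] := hg z I.
  have dF : differentiable F (g (val z)) by rewrite eg; exact: (hF _ jz).1.
  have dh : differentiable h (g (val z)) by rewrite eg; exact: (hh _ (jiz _ iz jz)).1.
  exact: (differentiableM (differentiable_comp dg dF) (differentiable_comp dg dh)).
move=> y; rewrite lt_min => /andP[ye1 ye2].
have jy : lb_dom j ((k^-1)%g y) by exact: h1.
have iy := h2 _ ye2.
rewrite (hg y I).2 (hF _ jy).2 (hh _ (jiz _ iy jy)).2.
by rewrite -[RHS]/(fcoord i (lrep E k s y)) (fcoord_lrep i s Gk jy).
Qed.

Lemma lrep_family (H : completeNormedModType R[i]) (sg : H -> sections L) k :
  G k -> hilbert_family sg -> hilbert_family (fun v => lrep E k (sg v)).
Proof.
move=> Gk hsg; split.
- move=> a u v z; have [i iz] := lb_cover L z; have [j jz] := lb_cover L ((k^-1)%g z).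
  apply: (can_inj (lb_trivK iz)).
  rewrite linearD linearZ -![lb_triv i z _]/(fcoord i _) !(fcoord_lrep i _ Gk jz).
  rewrite (hf_linear hsg) /fcoord linearD linearZ /=.
  by rewrite mulrDl -mulrA.
- by move=> v; apply: lrep_holomorphic => //; exact: hf_holo.
- move=> i z iz; have [j jz] := lb_cover L ((k^-1)%g z).
  have [r [C [r0 hC]]] := hf_bound hsg jz.
  have kz x : k ((k^-1)%g x) = x by exact: aut_mulVK.
  have jiz : (lb_dom j `&` k @^-1` lb_dom i) ((k^-1)%g z).
    by split=> //; rewrite /preimage /= kz.
  have [e3 e30 h3] := holomorphic_on_continuous (z := (k^-1)%g z) (eq_act_holo E j i Gk) jiz ltr01.
  have m0 : 0 < Num.min r e3 by rewrite lt_min r0.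
  have [e1 e10 h1] := holomorphic_on_continuous (z := z) (aut_fun_holo (k^-1)%g) I m0.
  have [e2 e20 h2] := (open_subP _).1 (@lb_open _ _ _ L i) _ iz.
  pose M := nrm (tcoord i (act k (frame j ((k^-1)%g z)))) + 1.
  exists (Num.min e1 e2), (C * M); split; first by rewrite lt_min e10.
  move=> y; rewrite lt_min => /andP[ye1 ye2]; have iy := h2 _ ye2; split=> // v.
  have := h1 y I ye1; rewrite lt_min => /andP[yr ye3].
  have [jy by_] := hC _ yr.
  have jiy : (lb_dom j `&` k @^-1` lb_dom i) ((k^-1)%g y).
    by split=> //; rewrite /preimage /= kz.
  have hM : nrm (tcoord i (act k (frame j ((k^-1)%g y)))) <= M.
    have := h3 _ jiy ye3.
    have := nrm_subr (tcoord i (act k (frame j ((k^-1)%g y))))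
      (tcoord i (act k (frame j ((k^-1)%g z)))).
    by rewrite /M; rewrite /tcoord /frame /=; lra.
  rewrite (fcoord_lrep i _ Gk jy) nrmM (mulrAC C).
  by apply: ler_pM; rewrite ?nrm_ge0.
Qed.

Variable B : set (Aut D).
Hypotheses (B_G : B `<=` G) (B_transitive : transitive_on B).
Hypothesis D_bounded : exists2 D' : set Cn,
  is_domain D' /\ bounded_set D' & biholomorphic D D'.

(** At each point the evaluations of [sg] and of its translate [sg'] by [g^-1] have
    the same norms, because an element of [B] moving [z] to [g z] differs from [g]
    by an element of the isotropy group, which acts by a unimodular scalar. So
    [family_transfer] yields [w] with [l(g^-1) w = v]. *)
Lemma transport_by_B (H : rkhs L) g : stable_under E B H -> isometric_under E B H -> G g ->
  forall v : rk_space H, exists w : rk_space H,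
    nrm w = nrm v /\ rk_incl w = lrep E g (rk_incl v).
Proof.
move=> st iso Gg.
have [G1 GM GV] := G_subgroup.
have Gg' : G (g^-1)%g by exact: GV.
pose sg v := @rk_incl _ _ _ _ H v.
pose sg' v := lrep E (g^-1)%g (sg v).
have Fsg : hilbert_family sg by exact: rk_incl_family.
have Fsg' : hilbert_family sg' by exact: lrep_family.
have sg'E v z : in_total (sg' v z) = act (g^-1)%g (in_total (sg v (g z))).
  by rewrite lrep_total invgK.
have trB b v : B b -> exists w, nrm w = nrm v /\ sg w = lrep E b (sg v).
  move=> Bb; have [w hw] := st b Bb v; exists w; split=> //.
  by rewrite /nrm (iso b Bb v w hw).
have lin0 y : sg 0 y = 0.
  have := hf_linear Fsg (-1) 0 0 y; rewrite scaleN1r oppr0 add0r => {1}->.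
  by rewrite scaleN1r addNr.
have sg_inj v : (forall z, sg v z = 0) -> v = 0.
  by move=> h; apply: rk_inj; apply: functional_extensionality_dep => z; rewrite [LHS]h [RHS]lin0.
have dom1 i z : lb_dom i z -> forall v, exists w,
    nrm w = nrm v /\ nrm (fcoord i (sg v z)) = nrm (fcoord i (sg' w z)).
  move=> iz v; have [b Bb bz] := B_transitive z (g z).
  have [w [nw hw]] := trB b v Bb; exists w; split=> //.
  have Gb := B_G Bb.
  have kz : (g^-1 * b)%g z = z by rewrite -[LHS]/((g^-1)%g (b z)) bz invg_app.
  rewrite -[LHS]/(tmod i (in_total (sg v z))) -[RHS]/(tmod i (in_total (sg' w z))).
  rewrite sg'E hw lrep_total.
  rewrite (@in_total_section (sg v) _ z); last by rewrite -bz invg_app.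
  rewrite -(eq_actM E)//; apply/esym.
  by apply: (isotropy_unitary E G_subgroup D_bounded (GM _ _ Gg' Gb) iz kz).
have dom2 i z : lb_dom i z -> forall v, exists w,
    nrm w = nrm v /\ nrm (fcoord i (sg' v z)) = nrm (fcoord i (sg w z)).
  move=> iz v; have [b Bb bz] := B_transitive (g z) z.
  have [w [nw hw]] := trB b v Bb; exists w; split=> //.
  have Gb := B_G Bb.
  have kz : (b * g)%g z = z by exact: bz.
  rewrite -[LHS]/(tmod i (in_total (sg' v z))) -[RHS]/(tmod i (in_total (sg w z))).
  rewrite hw lrep_total (@in_total_section (sg v) _ (g z)); last by rewrite -[in LHS]bz invg_app.
  have <- : act (b * g)%g (in_total (sg' v z)) = act b (in_total (sg v (g z))).
    by rewrite sg'E -(eq_actM E)//; [rewrite mulgK|exact: GM].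
  by apply/esym; apply: (isotropy_unitary E G_subgroup D_bounded (GM _ _ Gb Gg) iz kz).
move=> v; have [w [nw hw]] :=
  family_transfer D_domain (@rk_norm _ _ _ _ H) Fsg Fsg' sg_inj dom1 dom2 v.
exists w; split=> //; apply: functional_extensionality_dep => z; apply: in_total_inj.
rewrite lrep_total -[rk_incl v _]/(sg v _) -hw sg'E -(eq_actM E)// mulgV (eq_act1 E).
by apply/esym; apply: (@in_total_section (sg w)); exact: aut_mulVK.
Qed.

End Conclusion.

(** * The theorem *)

Theorem theorem1p7 (R : realType) (N : nat) (D : set 'rV[R[i]]_N)
  (D_domain : is_domain D)
  (D_homogeneous : exists2 D' : set 'rV[R[i]]_N,
     bounded_homogeneous_domain D' & biholomorphic D D')
  (m : nat) (A : set 'M[R]_m) (phi : Aut D -> 'M[R]_m)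
  (phi_iso : linear_realization A phi)
  (G : set (Aut D)) (G_algebraic : algebraic_identity_component phi G)
  (G_transitive : transitive_on G)
  (B : set (Aut D)) (B_iwasawa : iwasawa_subgroup phi G B)
  (B_simply_transitive : simply_transitive_on B)
  (L : line_bundle D) (E : equivariant_structure G L) :
  (forall H : rkhs L,
     stable_under E B H -> isometric_under E B H ->
     stable_under E G H /\ isometric_under E G H) /\
  (unitarizable E B -> unitarizable E G).
Proof.
have G_subgroup := algebraic_component_subgroup phi_iso G_algebraic.
have B_transitive : transitive_on B.
  by move=> z w; have [b [[Bb bz] _]] := B_simply_transitive z w; exists b.
have D_bounded : exists2 D' : set 'rV[R[i]]_N,
    is_domain D' /\ bounded_set D' & biholomorphic D D'.
  by have [D' [? ? _] ?] := D_homogeneous; exists D'.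
have main (H : rkhs L) : stable_under E B H -> isometric_under E B H ->
    stable_under E G H /\ isometric_under E G H.
  move=> st iso.
  have T g (Gg : G g) := transport_by_B D_domain G_subgroup B_iwasawa.1 B_transitive
    D_bounded st iso Gg.
  split=> g Gg v; first by have [w [_ hw]] := T g Gg v; exists w.
  move=> w hw; have [w' [nw' hw']] := T g Gg v.
  by rewrite (rk_inj (etrans hw (esym hw'))) !nrmE nw'.
split=> // -[H [v0 st iso]]; exists H.
by have [stG isoG] := main H st iso; split.
Qed.
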